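(* Let $f(z)=z^2+c$, $c\in\mathbb{C}$, be a Siegel or Cremer quadratic polynomial. Then the set of biaccessible points in the Julia set $J(f)$ has Brolin measure zero.
   Context: A fixed point $\alpha$ of $f$ is irrationally indifferent if $f'(\alpha)=e^{2\pi i\theta}$ with $\theta\in\mathbb{R}/\mathbb{Z}$ irrational. The polynomial $f(z)=z^2+c$ is called Siegel (respectively Cremer) if it has an irrationally indifferent fixed point $\alpha$ and $f$ is (respectively is not) holomorphically linearizable near $\alpha$. The filled Julia set is $K(f)=\{z\in\mathbb{C}:\{f^{\circ n}(z)\}_{n\ge 0}\text{ is bounded}\}$ and the Julia set is $J(f)=\partial K(f)$. In the present setting $K(f)$ is compact, connected and full. Let $\varphi:\overline{\mathbb{C}}\setminus K(f)\to\overline{\mathbb{C}}\setminus\overline{\mathbb{D}}$ be the unique conformal isomorphism with $\varphi(\infty)=\infty$ and $\varphi'(\infty)>0$. For $t\in\mathbb{R}/\mathbb{Z}$ the external ray of angle $t$ is $R_t=\varphi^{-1}\{re^{2\pi i t}:r>1\}$; it lands at $p\in J(f)$ if $\lim_{r\to 1^+}\varphi^{-1}(re^{2\pi i t})=p$. A point $p\in J(f)$ is biaccessible if at least two distinct external rays land at $p$. The Brolin measure $\mu$ is the unique $f$-invariant probability measure of maximal entropy $\log 2$, supported on $J(f)$. It coincides with the harmonic measure, i.e. the push-forward of normalized Lebesgue measure on $\mathbb{R}/\mathbb{Z}$ under the almost everywhere defined map $t\mapsto\lim_{r\to 1^+}\varphi^{-1}(re^{2\pi i t})$. *)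

(* Defs.v *)
From HB Require Import structures.
From mathcomp Require Import all_boot all_order all_algebra.
From mathcomp Require Import all_classical all_reals all_analysis.
From mathcomp Require Import complex.

Set Implicit Arguments.
Unset Strict Implicit.
Unset Printing Implicit Defensive.

Import Order.TTheory GRing.Theory Num.Theory.
Import numFieldNormedType.Exports.

Local Open Scope classical_set_scope.
Local Open Scope ring_scope.
Local Open Scope complex_scope.

(* [R[i]] is converted to its regular module [R[i]^o] because MathComp-Analysis
   attaches the norm topology of a concrete field to the latter.  The base
   field is [R[i]] itself, so [derivable f z 1] is complex differentiability. *)
Notation Cplx R := (R[i]^o)%type.

Notation borelC R := (g_sigma_algebraType (@open (Cplx R))).

Section Holomorphy.
Variable R : realType.
Local Notation C := (Cplx R).

Definition holomorphic_on (U : set C) (g : C -> C) : Prop :=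
  forall z, U z -> derivable g z 1.

(* e^{2 pi i t} *)
Definition expi2pi (t : R) : C := cos (2 * pi * t) +i* sin (2 * pi * t).

End Holomorphy.

Section QuadraticDynamics.
Variable R : realType.
Local Notation C := (Cplx R).

Definition quadratic (c : C) : C -> C := fun z => z ^+ 2 + c.

Definition irrationally_indifferent (f : C -> C) (alpha : C) : Prop :=
  f alpha = alpha /\
  exists2 theta : R, irrational theta & derive1 f alpha = expi2pi theta.

(* [h] is a local holomorphic coordinate at the fixed point [alpha] in which
   [f] becomes multiplication by its multiplier. *)
Definition linearizable_near (f : C -> C) (alpha : C) : Prop :=
  exists h : C -> C,
    [/\ \forall z \near alpha, derivable h z 1,
        h alpha = 0,
        derive1 h alpha != 0 &
        \forall z \near alpha, h (f z) = derive1 f alpha * h z].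

Definition siegel (c : C) : Prop :=
  exists2 alpha, irrationally_indifferent (quadratic c) alpha
               & linearizable_near (quadratic c) alpha.

Definition cremer (c : C) : Prop :=
  exists2 alpha, irrationally_indifferent (quadratic c) alpha
               & ~ linearizable_near (quadratic c) alpha.

Definition filled_julia (f : C -> C) : set C :=
  [set z | bounded_set (range (fun n => iter n f z : C))].

Definition julia (f : C -> C) : set C :=
  closure (filled_julia f) `\` interior (filled_julia f).

End QuadraticDynamics.

Section ExternalRays.
Variable R : realType.
Local Notation C := (Cplx R).

(* [phi] read in the coordinate [w = 1/z] of the Riemann sphere at infinity,
   both in the source and in the target, with infinity sent to infinity. *)
Definition at_infinity (phi : C -> C) : C -> C :=
  fun w => if w == 0 then 0 else (phi w^-1)^-1.

(* The conformal isomorphism from the complement of [K] in the sphere onto the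
   complement of the closed unit disk, fixing infinity with positive
   derivative there.  Only the values of [phi] at finite points outside [K]
   matter.  In the order of [R[i]], [0 < x] says that [x] is real and
   positive. *)
Definition exterior_map (K : set C) (phi : C -> C) : Prop :=
  [/\ set_bij (~` K) [set w : C | 1 < `|w|] phi,
      holomorphic_on (~` K) phi,
      derivable (at_infinity phi) 0 1 &
      0 < derive1 (at_infinity phi) 0].

Definition exterior_inv (K : set C) (phi : C -> C) : C -> C :=
  'pinv_(fun=> 0) (~` K) phi.

Definition radial (t r : R) : C := r%:C * expi2pi t.

(* Angles in R/Z are given by real representatives. *)
Definition external_ray (K : set C) (phi : C -> C) (t : R) : set C :=
  exterior_inv K phi @` (radial t @` [set r | 1 < r]).

Definition lands_at (K : set C) (phi : C -> C) (t : R) (p : C) : Prop :=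
  exterior_inv K phi (radial t r) @[r --> 1^'+] --> p.

Definition biaccessible (f : C -> C) (phi : C -> C) : set C :=
  [set p | julia f p /\
     exists s t : R,
       [/\ external_ray (filled_julia f) phi s
             <> external_ray (filled_julia f) phi t,
           lands_at (filled_julia f) phi s p &
           lands_at (filled_julia f) phi t p]].

End ExternalRays.

Section Entropy.
Context {d : measure_display} {T : measurableType d} {R : realType}.
Implicit Types (mu : probability T R) (g : T -> T).

Definition invariant_measure mu g : Prop :=
  forall A, measurable A -> mu (g @^-1` A) = mu A.

(* A finite measurable partition with cells indexed by ['I_k], given by the
   function sending a point to the index of its cell; cells may be empty. *)
Definition measurable_partition (k : nat) (xi : T -> 'I_k) : Prop :=
  forall j, measurable (xi @^-1` [set j]).

(* Shannon entropy of the join of the [g^-i xi] for [i < n]; the cells of the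
   join are indexed by words of length [n].  Note that [ln 0 = 0]. *)
Definition join_entropy mu g (k : nat) (xi : T -> 'I_k) (n : nat) : R :=
  \sum_(w : {ffun 'I_n -> 'I_k})
    let p := fine (mu [set x | forall i : 'I_n, xi (iter i g x) = w i]) in
    - (p * ln p).

Definition partition_entropy mu g (k : nat) (xi : T -> 'I_k) : R :=
  limn (fun n => join_entropy mu g xi n / n%:R).

(* Kolmogorov-Sinai entropy *)
Definition measure_entropy mu g : \bar R :=
  ereal_sup [set h | exists k (xi : T -> 'I_k),
    measurable_partition xi /\ h = (partition_entropy mu g xi)%:E].

Definition maximal_entropy_measure mu g : Prop :=
  invariant_measure mu g /\
  forall nu : probability T R, invariant_measure nu g ->
    (measure_entropy nu g <= measure_entropy mu g)%E.

End Entropy.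

Definition brolin_measure (R : realType) (f : Cplx R -> Cplx R)
    (mu : probability (borelC R) R) : Prop :=
  [/\ maximal_entropy_measure mu (f : borelC R -> borelC R),
      measure_entropy mu (f : borelC R -> borelC R) = (ln 2)%:E &
      mu (~` julia f) = 0%E].

(* Main.v *)
Require Import Defs.
From mathcomp Require Import all_boot all_order all_algebra ring lra zify.
From mathcomp Require Import all_classical all_reals all_analysis.
From mathcomp Require Import complex.

Set Implicit Arguments.
Unset Strict Implicit.
Unset Printing Implicit Defensive.

Import Order.TTheory GRing.Theory Num.Theory.
Import numFieldNormedType.Exports.

Local Open Scope classical_set_scope.
Local Open Scope ring_scope.
Local Open Scope complex_scope.

(* Write K for the filled Julia set.  A biaccessible point either is eventually mapped to the
   critical point 0 or has a finite orbit.  Indeed, let two rays land at p, and suppose that the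
   orbit of p is infinite and avoids 0.  The two rays cut the plane into two sides.  Angle
   doubling turns a side whose opening is less than 1/2 into a side of twice the opening, so some
   image of p (up to sign) has a sector W of opening larger than 1/2 whose complement contains
   the fixed point alpha.  Doubling W, reduced modulo one turn, gives sectors W_1, W_2, ..., all
   missing alpha, until one of them, W_n, is no longer contained in the complement of W.  By
   alpha-avoidance, W_n is either contained in W or contains the closure of W.  In the second case
   the set of angles outside W, W_1, ..., W_(n-1) is invariant under doubling although it contains
   an interval.  In the first case the complement V of the closed sectors carries an inverse
   branch g : V -> V of f that fixes alpha.  On the basin of infinity the derivatives of the
   iterates g^k tend to 0 because g^k z tends to K and a derivative bounded below would force a
   disc into the image; by Vitali's theorem they tend to 0 at alpha, where they have modulus 1.

   The boundary of the two sides is handled without the Jordan curve theorem: a continuous square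
   root of z - p, up to a holomorphic square, is built off each ray, and the sign by which the two
   roots differ tells the sides apart.

   Points eventually mapped to 0 and preperiodic points form a countable union of preimages of
   finite sets, which is null since mu has no atom.  An atom of an invariant probability has a
   finite orbit, hence yields an invariant finite set O with mu O > 0; the normalized restriction
   of mu to the complement of O has entropy h / (1 - mu O), against the maximality of h, and if
   mu O = 1 the entropy of mu vanishes. *)

(** * The plane with a real-valued modulus *)

Section ComplexNorm.
Variable R : realType.
Local Notation C := (Cplx R).
Implicit Types (x y z w : C) (r e d : R).

(** The obstacle is that the topology of the Julia set is unknown, so sides of ray pairs cannot be
    compared inside K directly. In the basin, however, a side is described by its angles, and its
    boundary meets K in one point only. Two open sets whose boundaries meet K in finitely many
    points are disjoint as soon as they are disjoint in the basin; hence inclusions of sides reduce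
    to inequalities between angles. The threshold 1/2 comes from -z lying half a turn away from z: a
    sector of smaller opening is disjoint from its opposite, and the complement of a sector of
    larger opening never contains both z and -z, which singles out a square root. Opening exactly
    1/2 would make p = -p, which is excluded because the orbit avoids 0. The infinite orbit keeps
    the landing points of the successive sectors distinct, so that these sectors never touch at
    their vertices. The exterior map is given only as a conformal isomorphism. Its equation phi (f
    z) = phi z ^ 2, on which angle doubling rests, is derived from the maximum principle. *)

Definition nm (z : C) : R := complex.Re `|z : R[i]|.

(** The norm of [R[i]] takes its values in [R[i]]. [nm] is the same number read in [R], so that
    estimates take place in a totally ordered field. *)
Lemma normE z : `|z| = (nm z)%:C.
Proof. by rewrite /nm (_ : `|z| = `|z : R[i]|)// normc_def. Qed.

Lemma nm_ge0 z : 0 <= nm z.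
Proof. by rewrite -lecR -normE normr_ge0. Qed.

Lemma nmM x y : nm (x * y) = nm x * nm y.
Proof. by apply: complexI; rewrite rmorphM/= -!normE normrM. Qed.

Lemma nmD x y : nm (x + y) <= nm x + nm y.
Proof. by rewrite -lecR rmorphD/= -!normE ler_normD. Qed.

Lemma nmN x : nm (- x) = nm x.
Proof. by apply: complexI; rewrite -!normE normrN. Qed.

Lemma nmB x y : nm (x - y) = nm (y - x).
Proof. by rewrite -nmN opprB. Qed.

Lemma nm0 : nm 0 = 0.
Proof. by apply: complexI; rewrite -normE normr0. Qed.

Lemma nm1 : nm 1 = 1.
Proof. by apply: complexI; rewrite -normE normr1. Qed.

Lemma nm_eq0 z : (nm z == 0) = (z == 0).
Proof. by rewrite -(normr_eq0 z) normE -(inj_eq (@complexI R)). Qed.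

Lemma nm_gt0 z : (0 < nm z) = (z != 0).
Proof. by rewrite lt_def nm_eq0 nm_ge0 andbT. Qed.

Lemma nmV z : nm z^-1 = (nm z)^-1.
Proof. by apply: complexI; rewrite -normE normfV fmorphV/= normE. Qed.

Lemma nmX z n : nm (z ^+ n) = nm z ^+ n.
Proof. by apply: complexI; rewrite -normE normrX rmorphXn/= normE. Qed.

Lemma nmR r : nm (r%:C) = `|r|.
Proof. by rewrite /nm normc_def/= expr0n addr0 sqrtr_sqr. Qed.

Lemma nmE z : nm z = Num.sqrt (complex.Re z ^+ 2 + complex.Im z ^+ 2).
Proof. by rewrite /nm normc_def. Qed.

Lemma nm_sqr z : nm z ^+ 2 = complex.Re z ^+ 2 + complex.Im z ^+ 2.
Proof. by rewrite nmE sqr_sqrtr// addr_ge0 ?sqr_ge0. Qed.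

Lemma cReD x y : complex.Re (x + y : C) = complex.Re x + complex.Re y.
Proof. by case: x; case: y. Qed.
Lemma cImD x y : complex.Im (x + y : C) = complex.Im x + complex.Im y.
Proof. by case: x; case: y. Qed.
Lemma cReN x : complex.Re (- x : C) = - complex.Re x.
Proof. by case: x. Qed.
Lemma cImN x : complex.Im (- x : C) = - complex.Im x.
Proof. by case: x. Qed.
Lemma cReM x y : complex.Re (x * y : C) = complex.Re x * complex.Re y - complex.Im x * complex.Im y.
Proof. by case: x; case: y. Qed.
Lemma cImM x y : complex.Im (x * y : C) = complex.Re x * complex.Im y + complex.Im x * complex.Re y.
Proof. by case: x => a b; case: y => c d /=; rewrite addrC. Qed.

Lemma Re_le_nm z : `|complex.Re z| <= nm z.
Proof.
rewrite -ler_sqr ?nnegrE ?nm_ge0 ?normr_ge0//.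
by rewrite nm_sqr -normrX ger0_norm ?sqr_ge0// lerDl sqr_ge0.
Qed.

Lemma Im_le_nm z : `|complex.Im z| <= nm z.
Proof.
rewrite -ler_sqr ?nnegrE ?nm_ge0 ?normr_ge0//.
by rewrite nm_sqr -normrX ger0_norm ?sqr_ge0// lerDr sqr_ge0.
Qed.

Lemma nm_le_ReIm z : nm z <= `|complex.Re z| + `|complex.Im z|.
Proof.
rewrite -ler_sqr ?nnegrE ?nm_ge0 ?addr_ge0 ?normr_ge0//.
rewrite nm_sqr sqrrD !real_normK ?num_real// -addrA lerD2l addrC lerDl.
by rewrite mulrn_wge0// mulr_ge0.
Qed.

Lemma nmBD x y z : nm (x - z) <= nm (x - y) + nm (y - z).
Proof. by apply: le_trans (nmD _ _); rewrite addrA subrK. Qed.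

Lemma nm_lbB x y : nm x - nm y <= nm (x - y).
Proof. by rewrite lerBlDr; apply: le_trans (nmD _ _); rewrite subrK. Qed.

Lemma nm_lbD x y : nm x - nm y <= nm (x + y).
Proof. by rewrite -(nmN y) -{2}(opprK y) nm_lbB. Qed.

Lemma nmZn (n : nat) : nm (n%:R) = n%:R.
Proof. by rewrite -(rmorph_nat (real_complex R)) nmR ger0_norm. Qed.

Lemma nbhsCP z (A : set C) :
  nbhs z A <-> exists2 r : R, 0 < r & forall y, nm (y - z) < r -> A y.
Proof.
split=> [/nbhs_ballP[e /= e0 zA]|[r r0 zA]].
  (* A ball has its radius in [R[i]]; being positive there forces the imaginary part to vanish. *)
  have er : e = (complex.Re e)%:C.
    by move: e0; rewrite ltcE => /andP[/eqP ei _]; case: e ei {zA} => a b /= ->.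
  exists (complex.Re e); first by move: e0; rewrite ltcE => /andP[].
  by move=> y yr; apply: zA; rewrite /ball/= er distrC normE ltcR.
apply/nbhs_ballP; exists r%:C => /=; first by rewrite ltcR.
by move=> y; rewrite /ball/= distrC normE ltcR => /zA.
Qed.

Lemma openCP (A : set C) :
  open A <-> forall z, A z -> exists2 r : R, 0 < r & forall y, nm (y - z) < r -> A y.
Proof.
rewrite openE; split=> [oA z Az|oA z Az]; first exact: (nbhsCP z A).1 (oA z Az).
exact: (nbhsCP z A).2 (oA z Az).
Qed.

Lemma closedCP (A : set C) :
  closed A <-> forall z, (forall e : R, 0 < e -> exists2 y, A y & nm (y - z) < e) -> A z.
Proof.
split=> cA z zA; apply: cA; last move=> e e0.
  move=> B /nbhsCP[r r0 rB].
  by have [y Ay yz] := zA r r0; exists y; split => //; exact: rB.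
have [|y [Ay yz]] := zA [set y | nm (y - z) < e]; last by exists y.
by apply/nbhsCP; exists e.
Qed.

Lemma cvgCP T (F : set_system T) {FF : Filter F} (f : T -> C) l :
  f @ F --> l <-> forall e : R, 0 < e -> \forall t \near F, nm (f t - l) < e.
Proof.
split=> [fl e e0|fl A /nbhsCP[r r0 rA]].
  have /fl : nbhs l [set y | nm (y - l) < e] by apply/nbhsCP; exists e.
  exact.
by near=> t; apply: rA; near: t; exact: fl.
Unshelve. all: by end_near. Qed.

Lemma cvgRP T (F : set_system T) {FF : Filter F} (f : T -> R) l :
  f @ F --> l <-> forall e : R, 0 < e -> \forall t \near F, `|f t - l| < e.
Proof.
split=> [/cvgrPdist_lt fl e /fl|fl]; last apply/cvgrPdist_lt => e /fl.
  by apply: filterS => t; rewrite distrC.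
by apply: filterS => t; rewrite distrC.
Qed.

Lemma nearCP z (P : C -> Prop) :
  (\forall y \near z, P y) <-> exists2 r : R, 0 < r & forall y, nm (y - z) < r -> P y.
Proof. exact: nbhsCP. Qed.

Lemma contCP (f : C -> C) z : {for z, continuous f} <->
  forall e : R, 0 < e -> exists2 d : R, 0 < d & forall y, nm (y - z) < d -> nm (f y - f z) < e.
Proof.
by split=> [/(@cvgCP _ (nbhs z)) h e /h /nearCP|h]//;
  apply/(@cvgCP _ (nbhs z)) => e /h ?; apply/nearCP.
Qed.

Lemma contCRP (f : C -> R) z : {for z, continuous f} <->
  forall e : R, 0 < e -> exists2 d : R, 0 < d & forall y, nm (y - z) < d -> `|f y - f z| < e.
Proof.
by split=> [/(@cvgRP _ (nbhs z)) h e /h /nearCP|h]//;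
  apply/(@cvgRP _ (nbhs z)) => e /h ?; apply/nearCP.
Qed.

Lemma nearRP (x : R) (P : R -> Prop) :
  (\forall y \near x, P y) <-> exists2 r : R, 0 < r & forall y : R, `|y - x| < r -> P y.
Proof.
split=> [/nbhs_ballP[e e0 h]|[e e0 h]].
  by exists e => // y ye; apply: h; rewrite /ball/= distrC.
by apply/nbhs_ballP; exists e => // y; rewrite /ball/= distrC => /h.
Qed.

Lemma contRCP (f : R -> C) (x : R) : {for x, continuous f} <->
  forall e : R, 0 < e -> exists2 d : R, 0 < d & forall y : R, `|y - x| < d -> nm (f y - f x) < e.
Proof.
by split=> [/(@cvgCP _ (nbhs x)) h e /h /nearRP|h]//;
  apply/(@cvgCP _ (nbhs x)) => e /h ?; apply/nearRP.
Qed.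

Lemma cont_nm : continuous nm.
Proof.
move=> z; apply/contCRP => e e0; exists e => // y ye.
apply: le_lt_trans ye; have := nm_lbB y z; have := nm_lbB z y.
by rewrite (nmB z) ler_norml => ? ?; apply/andP; split; lra.
Qed.

Lemma cont_Re : continuous (@complex.Re R : C -> R).
Proof.
move=> z; apply/contCRP => e e0; exists e => // y ye.
by apply: le_lt_trans ye; rewrite -cReN -cReD Re_le_nm.
Qed.

Lemma cont_Im : continuous (@complex.Im R : C -> R).
Proof.
move=> z; apply/contCRP => e e0; exists e => // y ye.
by apply: le_lt_trans ye; rewrite -cImN -cImD Im_le_nm.
Qed.

Lemma cont_cplx : continuous (fun p : R * R => (p.1 +i* p.2) : C).
Proof.
move=> [x y]; apply/(@cvgCP _ (nbhs (x, y))) => e e0.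
have e20 : 0 < e / 2 by rewrite divr_gt0.
exists ([set x' | `|x' - x| < e / 2], [set y' | `|y' - y| < e / 2]) => /=.
  by split; apply/nearRP; exists (e / 2).
move=> [x' y'] /= [xe ye]; apply: le_lt_trans (nm_le_ReIm _) _ => /=.
by rewrite (splitr e) ltrD.
Qed.

(** Heine-Borel: E is a closed part of the image of the square [-B, B]^2, which is compact as a
    product of segments. *)
Lemma closed_bounded_compact (E : set C) (B : R) :
  closed E -> (forall z, E z -> nm z <= B) -> compact E.
Proof.
move=> cE EB; set Q := (fun p : R * R => (p.1 +i* p.2) : C) @` (`[- B, B] `*` `[- B, B]).
have cQ : compact Q.
  apply: continuous_compact; first exact/continuous_subspaceT/cont_cplx.
  by apply: compact_setX; exact: segment_compact.
have hC : hausdorff_space C by exact: norm_hausdorff.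
apply: subclosed_compact cE cQ _ => z /EB zB.
exists (complex.Re z, complex.Im z); last by case: z {zB}.
split; rewrite /= in_itv/= -ler_norml.
  exact: le_trans (Re_le_nm z) zB.
exact: le_trans (Im_le_nm z) zB.
Qed.

Lemma evt_max (E : set C) (B : R) (h : C -> R) :
  closed E -> (forall z, E z -> nm z <= B) -> E !=set0 ->
  (forall z, E z -> {for z, continuous h}) ->
  exists2 z, E z & forall y, E y -> h y <= h z.
Proof.
move=> cE EB E0 ch; have kE := closed_bounded_compact cE EB.
have hE : {within E, continuous h}.
  by apply: continuous_in_subspaceT => z /set_mem /ch.
have [z zE zm] := compact_EVT_max E0 kE hE.
by exists z; [exact/set_mem|move=> y yE; apply: zm; exact/mem_set].
Qed.

(** Bolzano-Weierstrass, with a cluster point instead of a convergent subsequence; the later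
    compactness arguments by contradiction rest on it. *)
Lemma cluster_seq (B : R) (u : nat -> C) : (forall n, nm (u n) <= B) ->
  exists z, forall e : R, 0 < e -> forall N, exists2 n, (N <= n)%N & nm (u n - z) < e.
Proof.
move=> uB; have cB : closed [set z : C | nm z <= B].
  apply/closedCP => z zB /=; apply/ler_addgt0Pl => e /zB[y /= yB yz].
  by have := nm_lbB z y; rewrite nmB; lra.
have kB := closed_bounded_compact cB (fun z => id).
have [|z [zB zc]] := kB (u @ \oo) _.
  by exists 0%N => // n _; exact: uB.
exists z => e e0 N.
have [||y [[n Nn <-] ye]] := zc (u @` [set n | (N <= n)%N]) [set y | nm (y - z) < e].
- by exists N => // n /= Nn; exists n.
- by apply/nbhsCP; exists e.
by exists n.
Qed.

End ComplexNorm.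

(** * Cauchy's theorem on rectangles and the maximum principle *)

Section Primitive.
Variable R : realType.

(** Integrals along the sides of a rectangle are handled through real primitives. Only differences
    of values matter, so [A] just has to lie to the left of the points in play. *)
Definition prim (A : R) (h : R -> R) (x : R) : R :=
  (\int[lebesgue_measure]_(t in `[A, x]) h t)%R.

(* [is_derive] is a type class; this copy keeps [apply] from starting an instance search. *)
Definition has_deriv (h : R -> R) (x d : R) : Prop := is_derive x 1 h d.

Lemma prim_is_derive (A B : R) (h : R -> R) (x : R) : continuous h ->
  A < x -> x < B -> has_deriv (prim A h) x (h x).
Proof.
move=> ch Ax xB.
have ih : lebesgue_measure.-integrable `[A, B] (EFin \o h).
  apply: continuous_compact_integrable; first exact: segment_compact.
  exact: continuous_subspaceT.
have [dh hE] := continuous_FTC1_closed xB ih Ax (ch x).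
rewrite -hE; exact: (DeriveDef dh (esym (derive1E _ _))).
Qed.

(** Mean value theorem for [P2 - P1 - c x]. It compares integrals along two opposite sides of a
    small rectangle, where the integrands differ by nearly a constant. *)
Lemma prim_diff_est (h1 h2 P1 P2 : R -> R) (a b c e : R) : a <= b ->
  (forall x : R, a <= x <= b -> has_deriv P1 x (h1 x)) ->
  (forall x : R, a <= x <= b -> has_deriv P2 x (h2 x)) ->
  (forall x : R, a <= x <= b -> `|h2 x - h1 x - c| <= e) ->
  `|(P2 b - P2 a) - (P1 b - P1 a) - c * (b - a)| <= e * (b - a).
Proof.
move=> ab d1 d2 he; pose g x := P2 x - P1 x - c * x.
have dg x : a <= x <= b -> is_derive x 1 g (h2 x - h1 x - c).
  move=> xab; have D1 : is_derive x 1 P1 (h1 x) := d1 x xab.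
  have D2 : is_derive x 1 P2 (h2 x) := d2 x xab.
  rewrite /g; apply: is_derive_eq; first by rewrite scaler1.
have [||t tab gE] := @MVT_segment R g (fun x => h2 x - h1 x - c) a b ab.
- by move=> x; rewrite in_itv/= => /andP[/ltW ax /ltW xb]; apply: dg; rewrite ax.
- apply: derivable_within_continuous => x; rewrite in_itv/= => /dg xab.
  exact: ex_derive.
rewrite (_ : _ - _ = g b - g a); last by rewrite /g; ring.
rewrite gE normrM (ger0_norm (_ : 0 <= b - a)) ?subr_ge0// ler_wpM2r ?subr_ge0//.
by apply: he; move: tab; rewrite in_itv.
Qed.

Lemma is_derive_eps (h : R -> R) (x d : R) : is_derive x 1 h d ->
  forall e : R, 0 < e -> exists2 r, 0 < r &
    forall y : R, `|y - x| < r -> `|h y - h x - d * (y - x)| <= e * `|y - x|.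
Proof.
move=> [dh hd] e e0; have /cvg_ex[l hl] := dh.
have ld : l = d by rewrite -hd; apply/esym/cvg_lim.
rewrite {}ld in hl; move/cvgrPdist_le : hl => /(_ e e0).
move=> /nbhs_ballP[r /= r0 hr]; exists r => // y yx.
have [->|yx0] := eqVneq y x; first by rewrite !subrr mulr0 subrr normr0 mulr0.
have yx0' : y - x != 0 by rewrite subr_eq0.
have := hr (y - x); rewrite /ball/= sub0r normrN => /(_ yx yx0').
rewrite /= [(y - x)%:A]mulr1 subrK /GRing.scale/= => H.
rewrite (_ : h y - h x - _ = - ((y - x) * (d - (y - x)^-1 * (h y - h x)))).
  by rewrite normrN normrM [leRHS]mulrC ler_wpM2l.
by field.
Qed.

End Primitive.

(** * Goursat's bisection for an additive function of rectangles *)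

Section Bisection.
Variable R : realType.
Variable T : R -> R -> R -> R -> R.
Variables (a1 a2 b1 b2 : R).
Hypothesis a12 : a1 <= a2.
Hypothesis b12 : b1 <= b2.
Hypothesis TU : forall u u' u'' v v', T u u'' v v' = T u u' v v' + T u' u'' v v'.
Hypothesis TV : forall u u' v v' v'', T u u' v v'' = T u u' v v' + T u u' v' v''.
Hypothesis Tloc : forall u v : R, a1 <= u <= a2 -> b1 <= v <= b2 -> forall e : R, 0 < e ->
  exists2 r, 0 < r & forall u1 u2 v1 v2 : R, a1 <= u1 -> u1 <= u -> u <= u2 -> u2 <= a2 ->
    b1 <= v1 -> v1 <= v -> v <= v2 -> v2 <= b2 -> (u2 - u1) + (v2 - v1) < r ->
    `|T u1 u2 v1 v2| <= e * ((u2 - u1) + (v2 - v1)) ^+ 2.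

Let Q : Type := (R * R * (R * R))%type.
Let TQ (q : Q) := `|T q.1.1 q.1.2 q.2.1 q.2.2|.
Let half (p p' : R * R) := [/\ p.1 <= p'.1, p'.2 <= p.2 & p'.2 - p'.1 = (p.2 - p.1) / 2].

(** By additivity, quarters that all carry less than a fourth of |T| could not add up to the
    whole. *)
Let quarter (q : Q) : q.1.1 <= q.1.2 -> q.2.1 <= q.2.2 ->
  exists q' : Q, [/\ half q.1 q'.1, half q.2 q'.2 & TQ q <= 4 * TQ q'].
Proof.
case: q => [[u1 u2] [v1 v2]] /= u12 v12.
set um := (u1 + u2) / 2; set vm := (v1 + v2) / 2.
have H : TQ (u1, u2, (v1, v2)) <= TQ (u1, um, (v1, vm)) + TQ (um, u2, (v1, vm)) +
   (TQ (u1, um, (vm, v2)) + TQ (um, u2, (vm, v2))).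
  rewrite /TQ/= (TV _ _ v1 vm v2) (TU u1 um u2 v1 vm) (TU u1 um u2 vm v2).
  by apply: le_trans (ler_normD _ _) _; apply: lerD; exact: ler_normD.
have hu1 : half (u1, u2) (u1, um) by rewrite /half/= /um; split; lra.
have hu2 : half (u1, u2) (um, u2) by rewrite /half/= /um; split; lra.
have hv1 : half (v1, v2) (v1, vm) by rewrite /half/= /vm; split; lra.
have hv2 : half (v1, v2) (vm, v2) by rewrite /half/= /vm; split; lra.
have [h1|h1] := lerP (TQ (u1, u2, (v1, v2))) (4 * TQ (u1, um, (v1, vm))).
  by exists (u1, um, (v1, vm)).
have [h2|h2] := lerP (TQ (u1, u2, (v1, v2))) (4 * TQ (um, u2, (v1, vm))).
  by exists (um, u2, (v1, vm)).
have [h3|h3] := lerP (TQ (u1, u2, (v1, v2))) (4 * TQ (u1, um, (vm, v2))).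
  by exists (u1, um, (vm, v2)).
exists (um, u2, (vm, v2)); split => //; lra.
Qed.

Lemma nested_point (s : nat -> R * R) : (forall n, (s n).1 <= (s n).2) ->
  (forall n, half (s n) (s n.+1)) ->
  exists2 x, (forall n, (s n).1 <= x <= (s n).2) &
    forall n, (s n).2 - (s n).1 = ((s 0%N).2 - (s 0%N).1) / 2 ^+ n.
Proof.
move=> s12 sh; have inc m n : (m <= n)%N -> (s m).1 <= (s n).1.
  elim: n => [|n IH]; first by rewrite leqn0 => /eqP ->.
  rewrite leq_eqVlt => /predU1P[->//|]; rewrite ltnS => /IH mn.
  by apply: le_trans mn _; case: (sh n).
have dec m n : (m <= n)%N -> (s n).2 <= (s m).2.
  elim: n => [|n IH]; first by rewrite leqn0 => /eqP ->.
  rewrite leq_eqVlt => /predU1P[->//|]; rewrite ltnS => /IH mn.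
  by apply: le_trans mn; case: (sh n).
have ub m n : (s n).1 <= (s m).2.
  apply: (@le_trans _ _ (s (maxn m n)).1); first by rewrite inc// leq_maxr.
  by apply: le_trans (s12 _) _; rewrite dec// leq_maxl.
exists (sup (range (fun n => (s n).1))) => n.
  apply/andP; split.
    apply: ub_le_sup; last by exists n.
    by exists (s 0%N).2 => _ [m _ <-]; exact: ub.
  apply: ge_sup; first by exists (s 0%N).1; exists 0%N.
  by move=> _ [m _ <-]; exact: ub.
elim: n => [|n IH]; first by rewrite expr0 divr1.
by have [_ _ ->] := sh n; rewrite IH exprSr invfM mulrA.
Qed.

(** Goursat's argument. Successive quarters shrink to a point and keep |T| at least 4^-n of the
    total, while [Tloc] at that point bounds it by e S^2 4^-n, where S is half the perimeter of the
    first rectangle. So the total is at most e S^2 for every e. *)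
Lemma bisection0 : T a1 a2 b1 b2 = 0.
Proof.
have /choice[f fP] : forall q : Q, exists q' : Q, q.1.1 <= q.1.2 -> q.2.1 <= q.2.2 ->
    [/\ half q.1 q'.1, half q.2 q'.2 & TQ q <= 4 * TQ q'].
  move=> q; have [h1|h1] := lerP q.1.1 q.1.2; last by exists q.
  have [h2|h2] := lerP q.2.1 q.2.2; last by exists q.
  by have [q' ?] := quarter h1 h2; exists q'.
pose s n := iter n f ((a1, a2), (b1, b2)).
have sv n : (s n).1.1 <= (s n).1.2 /\ (s n).2.1 <= (s n).2.2.
  elim: n => [//|n [h1 h2]]; have [[_ _ e1] [_ _ e2] _] := fP (s n) h1 h2.
  by rewrite /s iterS -/(s n); split; lra.
have sh n : [/\ half (s n).1 (s n.+1).1, half (s n).2 (s n.+1).2 & TQ (s n) <= 4 * TQ (s n.+1)].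
  by have [h1 h2] := sv n; have := fP (s n) h1 h2.
have [||u uP uL] := @nested_point (fun n => (s n).1).
- by move=> n; case: (sv n).
- by move=> n; case: (sh n).
have [||v vP vL] := @nested_point (fun n => (s n).2).
- by move=> n; case: (sv n).
- by move=> n; case: (sh n).
have sT n : TQ (s 0%N) <= 4 ^+ n * TQ (s n).
  elim: n => [|n IH]; first by rewrite expr0 mul1r.
  apply: le_trans IH _; rewrite exprSr -mulrA ler_wpM2l ?exprn_ge0//.
  by case: (sh n).
have sI n : [/\ a1 <= (s n).1.1, (s n).1.2 <= a2, b1 <= (s n).2.1 & (s n).2.2 <= b2].
  elim: n => [|n [? ? ? ?]]; first by rewrite /s/=; split.
  by case: (sh n) => -[? ? _] [? ? _] _; split; lra.
set S := (a2 - a1) + (b2 - b1).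
have key e : 0 < e -> `|T a1 a2 b1 b2| <= e * S ^+ 2.
  move=> e0; have [||r r0 hr] := @Tloc u v _ _ e e0; first exact: (uP 0%N).
    exact: (vP 0%N).
  have [n nr] : exists n, S / 2 ^+ n < r.
    have S0 : 0 <= S by rewrite addr_ge0 ?subr_ge0.
    exists (Num.truncn (S / r)).+1.
    rewrite ltr_pdivrMr ?exprn_gt0// mulrC -ltr_pdivrMr//.
    apply: lt_le_trans (truncnS_gt _) _.
    by rewrite -natrX ler_nat ltnW// ltn_expl.
  have [i1 i2 i3 i4] := sI n; have /andP[u1 u2] := uP n; have /andP[v1 v2] := vP n.
  have Ln : (s n).1.2 - (s n).1.1 + ((s n).2.2 - (s n).2.1) = S / 2 ^+ n.
    by rewrite uL vL /S/= -mulrDl.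
  have := hr _ _ _ _ i1 u1 u2 i2 i3 v1 v2 i4; rewrite Ln => /(_ nr) Tn.
  apply: le_trans (sT n) _.
  rewrite (_ : e * S ^+ 2 = 4 ^+ n * (e * (S / 2 ^+ n) ^+ 2)).
    by rewrite ler_wpM2l ?exprn_ge0.
  rewrite expr_div_n -exprM mulnC exprM (_ : 2 ^+ 2 = 4 :> R); last by rewrite -natrX.
  have q0 : (4 : R) ^+ n != 0 by rewrite expf_neq0.
  by field.
apply/eqP; rewrite -normr_le0 leNgt; apply/negP => T0.
have S1 : 0 < S ^+ 2 + 1 by rewrite ltr_wpDl// sqr_ge0.
have := key (`|T a1 a2 b1 b2| / (S ^+ 2 + 1)) (divr_gt0 T0 S1).
rewrite mulrAC ler_pdivlMr// mulrDr mulr1; lra.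
Qed.
End Bisection.

(** * Complex differentiability with real error bounds *)

Section ComplexDerivative.
Variable R : realType.
Local Notation C := (Cplx R).

Definition ccont (f : C -> C) (z : C) := forall e : R, 0 < e ->
  exists2 d : R, 0 < d & forall y, nm (y - z) < d -> nm (f y - f z) < e.

Lemma ccontP (f : C -> C) z : ccont f z <-> {for z, continuous f}.
Proof. by rewrite contCP. Qed.

Lemma ccont_cst (k z : C) : ccont (fun=> k) z.
Proof. by move=> e e0; exists 1 => // y _; rewrite subrr nm0. Qed.
Lemma ccont_id (z : C) : ccont id z.
Proof. by move=> e e0; exists e. Qed.
Lemma ccontD (f g : C -> C) z : ccont f z -> ccont g z -> ccont (fun w => f w + g w) z.
Proof. by move=> /ccontP cf /ccontP cg; apply/ccontP; exact: (cvgD cf cg). Qed.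
Lemma ccontN (f : C -> C) z : ccont f z -> ccont (fun w => - f w) z.
Proof. by move=> /ccontP cf; apply/ccontP; exact: (cvgN cf). Qed.
Lemma ccontB (f g : C -> C) z : ccont f z -> ccont g z -> ccont (fun w => f w - g w) z.
Proof. by move=> /ccontP cf /ccontP cg; apply/ccontP; exact: (cvgB cf cg). Qed.
Lemma ccontM (f g : C -> C) z : ccont f z -> ccont g z -> ccont (fun w => f w * g w) z.
Proof. by move=> /ccontP cf /ccontP cg; apply/ccontP; exact: (cvgM cf cg). Qed.
Lemma ccontV (f : C -> C) z : ccont f z -> f z != 0 -> ccont (fun w => (f w)^-1) z.
Proof. by move=> /ccontP cf f0; apply/ccontP; exact: (cvgV f0 cf). Qed.
Lemma ccont_comp (f g : C -> C) z : ccont g z -> ccont f (g z) -> ccont (fun w => f (g w)) z.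
Proof.
by move=> cg cf e /cf[d d0 hd]; have [r r0 hr] := cg d d0; exists r => // y /hr /hd.
Qed.

Definition is_cdiff (f : C -> C) (z d : C) := forall e : R, 0 < e ->
  exists2 r : R, 0 < r &
  forall w, nm (w - z) < r -> nm (f w - f z - d * (w - z)) <= e * nm (w - z).

Definition cdiff (f : C -> C) (z : C) := exists d, is_cdiff f z d.

(* Caratheodory's form of differentiability, which makes the usual calculus rules algebraic. *)
Lemma is_cdiffP (f : C -> C) z d : is_cdiff f z d <->
  exists q : C -> C, [/\ ccont q z, q z = d &
    forall w, f w - f z = q w * (w - z)].
Proof.
split=> [fd|[q [cq <- qE]] e /cq[r r0 hr]].
  pose q w := if w == z then d else (f w - f z) / (w - z).
  exists q; split; rewrite /q ?eqxx//; last first.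
    move=> w; case: eqVneq => [->|wz]; first by rewrite !subrr mulr0.
    by rewrite divfK// subr_eq0.
  move=> e e0; have e20 : 0 < e / 2 by rewrite divr_gt0.
  have [r r0 hr] := fd _ e20.
  exists r => // w wr; rewrite eqxx; case: eqVneq => [_|wz]; first by rewrite subrr nm0.
  have wz0 : w - z != 0 by rewrite subr_eq0.
  have -> : (f w - f z) / (w - z) - d = (f w - f z - d * (w - z)) / (w - z).
    by field.
  rewrite nmM nmV ltr_pdivrMr ?nm_gt0//.
  have := hr w wr; have : 0 < nm (w - z) by rewrite nm_gt0.
  nra.
exists r => // w wr; rewrite qE -mulrBl nmM ler_wpM2r ?nm_ge0// ltW//; exact: hr.
Qed.

Lemma is_cdiff_cont (f : C -> C) z d : is_cdiff f z d -> ccont f z.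
Proof.
move=> /is_cdiffP[q [cq _ qE]].
have fE : f = fun w => f z + q w * (w - z).
  by apply/funext => w; rewrite -qE; ring.
rewrite fE; exact: ccontD (ccont_cst _ _) (ccontM cq (ccontB (@ccont_id z) (ccont_cst z z))).
Qed.

Lemma cdiff_cont (f : C -> C) z : cdiff f z -> ccont f z.
Proof. by move=> [d /is_cdiff_cont]. Qed.

Lemma is_cdiff_cst (k z : C) : is_cdiff (fun=> k) z 0.
Proof. by move=> e e0; exists 1 => // w _; rewrite subrr mul0r subr0 nm0 mulr_ge0 ?nm_ge0// ltW. Qed.

Lemma is_cdiff_id (z : C) : is_cdiff id z 1.
Proof. by move=> e e0; exists 1 => // w _; rewrite mul1r subrr nm0 mulr_ge0 ?nm_ge0// ltW. Qed.

Lemma is_cdiffD f g (z a b : C) : is_cdiff f z a -> is_cdiff g z b ->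
  is_cdiff (fun w => f w + g w) z (a + b).
Proof.
move=> /is_cdiffP[q [cq <- qE]] /is_cdiffP[q' [cq' <- qE']].
apply/is_cdiffP; exists (fun w => q w + q' w); split => //; first exact: ccontD.
by move=> w; rewrite mulrDl -qE -qE'; ring.
Qed.

Lemma is_cdiffM f g (z a b : C) : is_cdiff f z a -> is_cdiff g z b ->
  is_cdiff (fun w => f w * g w) z (a * g z + f z * b).
Proof.
move=> df dg; have cf := is_cdiff_cont df.
move: df dg => /is_cdiffP[q [cq <- qE]] /is_cdiffP[q' [cq' <- qE']].
apply/is_cdiffP; exists (fun w => q w * g z + f w * q' w); split => //.
  exact: ccontD (ccontM cq (ccont_cst _ _)) (ccontM cf cq').
by move=> w; rewrite mulrDl mulrAC -qE -mulrA -qE'; ring.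
Qed.

Lemma is_cdiffN f (z a : C) : is_cdiff f z a -> is_cdiff (fun w => - f w) z (- a).
Proof.
move=> /is_cdiffP[q [cq <- qE]]; apply/is_cdiffP; exists (fun w => - q w).
by split => //; [exact: ccontN|move=> w; rewrite mulNr -qE; ring].
Qed.

Lemma is_cdiff_comp f g (z a b : C) : is_cdiff g z a -> is_cdiff f (g z) b ->
  is_cdiff (fun w => f (g w)) z (b * a).
Proof.
move=> dg; have cg := is_cdiff_cont dg.
move: dg => /is_cdiffP[q [cq <- qE]] /is_cdiffP[q' [cq' <- qE']].
apply/is_cdiffP; exists (fun w => q' (g w) * q w); split => //.
  exact: ccontM (ccont_comp cg cq') cq.
by move=> w; rewrite qE' qE mulrA.
Qed.

Lemma is_cdiff_near f g (z a : C) : is_cdiff f z a -> (\forall w \near z, f w = g w) ->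
  is_cdiff g z a.
Proof.
move=> df /nearCP[r r0 fg] e e0; have [s s0 hs] := df e e0.
exists (Num.min r s); first by rewrite lt_min r0.
move=> w; rewrite lt_min => /andP[wr ws]; rewrite -fg// -fg ?subrr ?nm0//.
exact: hs.
Qed.

Lemma is_cdiff_inv (z : C) : z != 0 -> is_cdiff (fun w => w^-1) z (- (z^-1 * z^-1)).
Proof.
move=> z0; apply/is_cdiffP.
(* As [0^-1 = 0], the slope -1/(wz) is wrong at w = 0; the separate value there makes the
   factorization hold for all w, as Caratheodory's form demands. *)
pose q (w : C) : C := if w == 0 then z^-1 * z^-1 else - (w^-1 * z^-1).
exists q; split; rewrite /q ?(negbTE z0)//.
  have czV : ccont (fun w : C => - (w^-1 * z^-1)) z.
    exact: ccontN (ccontM (ccontV (@ccont_id z) z0) (ccont_cst _ _)).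
  move=> e /czV[r r0 hr].
  exists (Num.min r (nm z)); first by rewrite lt_min r0 nm_gt0.
  move=> w; rewrite lt_min => /andP[wr wz]; rewrite (negbTE z0).
  case: eqVneq => [w0|_]; last exact: hr.
  by move: wz; rewrite w0 sub0r nmN ltxx.
move=> w; case: eqVneq => [->|w0]; last by field; rewrite ?w0 ?z0.
by rewrite invr0 !sub0r mulrN -mulrA mulVf ?mulr1.
Qed.

Lemma cdiffD f g (z : C) : cdiff f z -> cdiff g z -> cdiff (fun w => f w + g w) z.
Proof. by move=> [a fa] [b gb]; eexists; exact: is_cdiffD fa gb. Qed.
Lemma cdiffN f (z : C) : cdiff f z -> cdiff (fun w => - f w) z.
Proof. by move=> [a fa]; eexists; exact: is_cdiffN fa. Qed.
Lemma cdiffM f g (z : C) : cdiff f z -> cdiff g z -> cdiff (fun w => f w * g w) z.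
Proof. by move=> [a fa] [b gb]; eexists; exact: is_cdiffM fa gb. Qed.
Lemma cdiff_comp f g (z : C) : cdiff g z -> cdiff f (g z) -> cdiff (fun w => f (g w)) z.
Proof. by move=> [a fa] [b gb]; eexists; exact: is_cdiff_comp fa gb. Qed.
Lemma cdiff_cst (k z : C) : cdiff (fun=> k) z.
Proof. by eexists; exact: is_cdiff_cst. Qed.
Lemma cdiff_id (z : C) : cdiff id z.
Proof. by eexists; exact: is_cdiff_id. Qed.
Lemma cdiffB f g (z : C) : cdiff f z -> cdiff g z -> cdiff (fun w => f w - g w) z.
Proof. by move=> df dg; apply: cdiffD => //; exact: cdiffN. Qed.
Lemma cdiffV f (z : C) : cdiff f z -> f z != 0 -> cdiff (fun w => (f w)^-1) z.
Proof. by move=> df f0; apply: cdiff_comp => //; eexists; exact: is_cdiff_inv. Qed.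
Lemma cdiffX f (z : C) n : cdiff f z -> cdiff (fun w => f w ^+ n) z.
Proof.
move=> df; elim: n => [|n IH]; first exact: cdiff_cst.
by under eq_fun do rewrite exprS; exact: cdiffM.
Qed.
Lemma cdiff_near f g (z : C) : cdiff f z -> (\forall w \near z, f w = g w) -> cdiff g z.
Proof. by move=> [a fa] fg; exists a; exact: is_cdiff_near fa fg. Qed.

Lemma derivable_is_cdiff (f : C -> C) (z : C) : derivable f z 1 -> is_cdiff f z (derive1 f z).
Proof.
move=> df; have /cvg_ex[l hl] := df.
have ld : l = derive1 f z.
  by rewrite derive1E; apply/esym/cvg_lim.
rewrite -ld => e e0; move/(@cvgCP _ _ (dnbhs 0)) : hl => /(_ e e0).
move=> /nearCP[r r0 hr]; exists r => // w wz.
have [->|wz0] := eqVneq w z; first by rewrite !subrr mulr0 subrr nm0 mulr0.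
have wz0' : w - z != 0 by rewrite subr_eq0.
have := hr (w - z); rewrite subr0 => /(_ wz wz0') /=.
rewrite [(w - z)%:A]mulr1 subrK /GRing.scale/= => H.
have -> : f w - f z - l * (w - z) = (w - z) * ((w - z)^-1 * (f w - f z) - l).
  by field.
by rewrite nmM mulrC ler_wpM2r ?nm_ge0// ltW.
Qed.

Lemma derivable_cdiff (f : C -> C) (z : C) : derivable f z 1 -> cdiff f z.
Proof. by move=> /derivable_is_cdiff; exists (derive1 f z). Qed.

End ComplexDerivative.

(** * Polar coordinates and the complex exponential *)

Section Polar.
Variable R : realType.
Local Notation C := (Cplx R).

Definition cis (v : R) : C := cos v +i* sin v.
Definition pol (u v : R) : C := (expR u)%:C * cis v.

Lemma cisD x y : cis (x + y) = cis x * cis y.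
Proof.
rewrite /cis cosD sinD; apply/eqP; rewrite eq_complex/= eqxx/= addrC.
by rewrite [X in X + _]mulrC.
Qed.

Lemma cis0 : cis 0 = 1.
Proof. by rewrite /cis cos0 sin0. Qed.

Lemma nm_cis v : nm (cis v) = 1.
Proof. by rewrite nmE/= cos2Dsin2 sqrtr1. Qed.

Lemma polD u u' v v' : pol (u + u') (v + v') = pol u v * pol u' v'.
Proof. by rewrite /pol expRD cisD rmorphM/= mulrACA. Qed.

Lemma nm_pol u v : nm (pol u v) = expR u.
Proof. by rewrite /pol nmM nm_cis mulr1 nmR ger0_norm// expR_ge0. Qed.

Lemma polE u v : pol u v = (expR u * cos v) +i* (expR u * sin v).
Proof. by rewrite /pol/cis; apply/eqP; rewrite eq_complex/= !mul0r subr0 addr0 !eqxx. Qed.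

Lemma cis_2pi v : cis (v + 2 * pi) = cis v.
Proof. by rewrite mulr2n mulrDl !mul1r addrA /cis !cosDpi !sinDpi !opprK. Qed.

Lemma cis_ex (z : C) : nm z = 1 -> exists2 v, 0 <= v < 2 * pi & z = cis v.
Proof.
case: z => x y /(congr1 (fun t => t ^+ 2)); rewrite nm_sqr expr1n/= => xy1.
have x1 : -1 <= x <= 1 by rewrite -ler_norml -ler_sqr ?nnegrE// real_normK ?num_real// expr1n -xy1 lerDl sqr_ge0.
have c := @acosK _ x; have s := sin_acos x1.
have y2 : Num.sqrt (1 - x ^+ 2) = `|y| by rewrite -xy1 addrC addKr sqrtr_sqr.
have pi0 := pi_gt0 R.
have [y0|y0] := lerP 0 y.
  exists (acos x); first by rewrite acos_ge0//=; have := acos_lepi x1; lra.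
  by rewrite /cis c ?in_itv// s y2 ger0_norm.
have a0 : 0 < acos x.
  rewrite lt_def acos_ge0// andbT; apply/eqP => a0; move: s; rewrite a0 sin0 y2 => /esym/eqP.
  by rewrite normr_eq0 => /eqP y00; rewrite y00 ltxx in y0.
exists (- acos x + 2 * pi); first by have := acos_lepi x1; lra.
by rewrite cis_2pi /cis cosN sinN c ?in_itv// s y2 ltr0_norm// opprK.
Qed.

Lemma pol_ex (z : C) : z != 0 -> exists2 v, 0 <= v < 2 * pi & z = pol (ln (nm z)) v.
Proof.
move=> z0; have nz : 0 < nm z by rewrite nm_gt0.
have [|v v2 zE] := @cis_ex (z / (nm z)%:C).
  by rewrite nmM nmV nmR ger0_norm ?nm_ge0// divff// gt_eqF.
exists v => //; rewrite /pol lnK// -zE mulrC divfK//.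
by rewrite (_ : 0 = (0 : R)%:C)// (inj_eq (@complexI R)) gt_eqF.
Qed.

(** [pol u v] is the exponential of u + iv, and this says that its derivative at the origin is 1.
    Together with [polD] it gives the derivative everywhere. *)
Lemma pol_is_diff (e : R) : 0 < e -> exists2 r : R, 0 < r &
  forall h k : R, `|h| < r -> `|k| < r -> nm (pol h k - 1 - (h +i* k)) <= e * (`|h| + `|k|).
Proof.
move=> e0; pose e' := Num.min (e / 8) 1.
have e'0 : 0 < e' by rewrite lt_min divr_gt0// ltr01.
have [e'e e'1] : e' <= e / 8 /\ e' <= 1 by rewrite /e' !ge_min !lexx orbT.
have dE : is_derive (0 : R) 1 expR (expR 0) by exact: is_derive_expR.
have dC : is_derive (0 : R) 1 cos (- sin 0) by exact: is_derive_cos.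
have dS : is_derive (0 : R) 1 sin (cos 0) by exact: is_derive_sin.
have [r1 r10 h1] := is_derive_eps dE e'0.
have [r2 r20 h2] := is_derive_eps dC e'0.
have [r3 r30 h3] := is_derive_eps dS e'0.
pose r := Num.min (Num.min r1 (e' / 2)) (Num.min r2 r3).
exists r; first by rewrite !lt_min r10 r20 r30 divr_gt0.
move=> h k; rewrite !lt_min => /andP[/andP[hr1 hre] _] /andP[_ /andP[kr2 kr3]].
have {h1} := h1 h; rewrite subr0 => /(_ hr1); rewrite expR0 mul1r => H1.
have {h2} := h2 k; rewrite subr0 => /(_ kr2); rewrite sin0 cos0 oppr0 mul0r subr0 => H2.
have {h3} := h3 k; rewrite subr0 => /(_ kr3); rewrite cos0 sin0 subr0 mul1r => H3.
set E := expR h in H1 *; set c := cos k in H2 *; set s := sin k in H3 *.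
have E1 : `|E - 1| <= e'.
  have -> : E - 1 = (E - 1 - h) + h by ring.
  apply: le_trans (ler_normD _ _) _; have := normr_ge0 h; nra.
have E2 : `|E| <= 2.
  have -> : E = (E - 1) + 1 by ring.
  apply: le_trans (ler_normD _ _) _; rewrite normr1; lra.
rewrite polE -/E -/c -/s.
apply: le_trans (nm_le_ReIm _) _ => /=; rewrite subr0.
have -> : E * c - 1 - h = (E - 1 - h) + E * (c - 1) by ring.
have -> : E * s - k = E * (s - k) + (E - 1) * k by ring.
have A1 : `|E - 1 - h + E * (c - 1)| <= e' * `|h| + 2 * (e' * `|k|).
  by apply: le_trans (ler_normD _ _) _; rewrite lerD// normrM ler_pM.
have A2 : `|E * (s - k) + (E - 1) * k| <= 2 * (e' * `|k|) + e' * `|k|.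
  apply: le_trans (ler_normD _ _) _; rewrite lerD// normrM; first by rewrite ler_pM.
  by rewrite ler_pM.
apply: le_trans (lerD A1 A2) _.
have := normr_ge0 h; have := normr_ge0 k; nra.
Qed.

End Polar.

(** * Cauchy's theorem in logarithmic polar coordinates *)

Section Goursat.
Variable R : realType.
Local Notation C := (Cplx R).
Variables (Psi : R -> R -> C) (U : R).
Hypothesis cu : forall v, continuous (fun u => Psi u v).
Hypothesis cv : forall u, continuous (Psi u).
Hypothesis dPsi : forall u v : R, u < U -> exists d : C, forall e : R, 0 < e ->
  exists2 r : R, 0 < r & forall u' v' : R, `|u' - u| < r -> `|v' - v| < r ->
    nm (Psi u' v' - Psi u v - d * ((u' - u) +i* (v' - v))) <= e * (`|u' - u| + `|v' - v|).
Hypothesis perPsi : forall u, Psi u (2 * pi) = Psi u 0.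

(** The increment over [0, 2 pi] is the integral of Re Psi over the circle of logarithmic radius u.
    The base point -1 leaves room for a two-sided derivative at 0. *)
Definition circle_prim (u v : R) : R := prim (-1) (fun t => complex.Re (Psi u t)) v.

Lemma circle_prim_is_derive (u v : R) : -1 < v -> has_deriv (circle_prim u) v (complex.Re (Psi u v)).
Proof.
move=> v1; apply: (@prim_is_derive _ _ (v + 1)) => //; last by rewrite ltrDl.
by move=> x; apply: (continuous_comp (@cv u x)); exact: cont_Re.
Qed.

(** [T] is the imaginary part of the integral of Psi around a rectangle in the variable u + iv. It
    vanishes by bisection, and periodicity cancels the two horizontal sides, so the vertical ones
    agree. *)
Lemma circle_prim_const (a1 a2 : R) : a1 <= a2 -> a2 < U ->
  circle_prim a2 (2 * pi) - circle_prim a2 0 = circle_prim a1 (2 * pi) - circle_prim a1 0.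
Proof.
move=> a12 a2U; have pi0 := pi_gt0 R.
pose PX := circle_prim.
pose PY v u := prim (a1 - 1) (fun t => complex.Im (Psi t v)) u.
have dPY (u v : R) : a1 - 1 < u -> has_deriv (PY v) u (complex.Im (Psi u v)).
  move=> u1; apply: (@prim_is_derive _ _ (u + 1)) => //; last by rewrite ltrDl.
  by move=> x; apply: (continuous_comp (@cu v x)); exact: cont_Im.
pose T u u' v v' := (PX u' v' - PX u' v) - (PX u v' - PX u v)
                    - ((PY v' u' - PY v' u) - (PY v u' - PY v u)).
suff : T a1 a2 0 (2 * pi) = 0.
  rewrite /T /PX (_ : PY (2 * pi) = PY 0); first lra.
  by apply/funext => u; rewrite /PY; congr prim; apply/funext => t; rewrite perPsi.
apply: bisection0 => //; first by rewrite mulr_ge0// ltW.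
- by move=> *; rewrite /T; ring.
- by move=> *; rewrite /T; ring.
move=> u v /andP[au ua] /andP[bv vb] e e0.
have [d hd] := @dPsi u v (le_lt_trans ua a2U).
have e20 : 0 < e / 4 by rewrite divr_gt0.
have [r r0 hr] := hd _ e20; exists r => // u1 u2 v1 v2 a1u1 u1u uu2 u2a2 b1v1 v1v vv2 v2b2 sr.
set s := u2 - u1 + (v2 - v1) in sr *.
have est (u' v' : R) : u1 <= u' <= u2 -> v1 <= v' <= v2 ->
    nm (Psi u' v' - Psi u v - d * ((u' - u) +i* (v' - v))) <= e / 4 * s.
  move=> /andP[? ?] /andP[? ?].
  have nu : `|u' - u| <= u2 - u1 by rewrite ler_norml; apply/andP; split; lra.
  have nv : `|v' - v| <= v2 - v1 by rewrite ler_norml; apply/andP; split; lra.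
  apply: le_trans (hr _ _ _ _) _; [rewrite /s in sr; lra|rewrite /s in sr; lra|].
  by rewrite ler_wpM2l ?(ltW e20)// lerD.
have [a [b dE]] : exists a b : R, d = (a +i* b : C) by case: (d) => a b; exists a, b.
pose k : R := e / 2 * s.
have HX : `|(PX u2 v2 - PX u2 v1) - (PX u1 v2 - PX u1 v1) - (a * (u2 - u1)) * (v2 - v1)|
    <= k * (v2 - v1).
  apply: (@prim_diff_est R (fun t => complex.Re (Psi u1 t)) (fun t => complex.Re (Psi u2 t))
    (PX u1) (PX u2) v1 v2 (a * (u2 - u1)) k).
  - lra.
  - by move=> x /andP[? _]; apply: circle_prim_is_derive; lra.
  - by move=> x /andP[? _]; apply: circle_prim_is_derive; lra.
  move=> t /andP[tv1 tv2].
  have e1 := est u1 t; have e2 := est u2 t.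
  rewrite !lexx tv1 tv2 !andbT/= in e1 e2.
  have u12 : u1 <= u2 by lra.
  have {}e1 := e1 u12 isT; have {}e2 := e2 u12 isT.
  have -> : complex.Re (Psi u2 t) - complex.Re (Psi u1 t) - a * (u2 - u1) =
     complex.Re ((Psi u2 t - Psi u v - d * ((u2 - u) +i* (t - v))) -
      (Psi u1 t - Psi u v - d * ((u1 - u) +i* (t - v)))).
    by rewrite !(cReD, cReN, cReM) dE/=; ring.
  apply: le_trans (Re_le_nm _) _; apply: le_trans (nmD _ _) _; rewrite nmN /k; lra.
have HY : `|(PY v2 u2 - PY v2 u1) - (PY v1 u2 - PY v1 u1) - (a * (v2 - v1)) * (u2 - u1)|
    <= k * (u2 - u1).
  apply: (@prim_diff_est R (fun t => complex.Im (Psi t v1)) (fun t => complex.Im (Psi t v2))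
    (PY v1) (PY v2) u1 u2 (a * (v2 - v1)) k).
  - lra.
  - by move=> x /andP[? _]; apply: dPY; lra.
  - by move=> x /andP[? _]; apply: dPY; lra.
  move=> t /andP[tv1 tv2].
  have e1 := est t v1; have e2 := est t v2.
  rewrite !lexx tv1 tv2 !andbT/= in e1 e2.
  have v12 : v1 <= v2 by lra.
  have {}e1 := e1 isT v12; have {}e2 := e2 isT v12.
  have -> : complex.Im (Psi t v2) - complex.Im (Psi t v1) - a * (v2 - v1) =
     complex.Im ((Psi t v2 - Psi u v - d * ((t - u) +i* (v2 - v))) -
      (Psi t v1 - Psi u v - d * ((t - u) +i* (v1 - v)))).
    by rewrite !(cImD, cImN, cImM) dE/=; ring.
  apply: le_trans (Im_le_nm _) _; apply: le_trans (nmD _ _) _; rewrite nmN /k; lra.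
rewrite /T; set X := (PX u2 v2 - _ - _) in HX *; set Y := (PY v2 u2 - _ - _) in HY *.
(* Both increments have the same main term, by the Cauchy-Riemann equations hidden in multiplication
   by d = a + ib; only the errors remain. *)
have -> : X - Y = (X - (a * (u2 - u1)) * (v2 - v1)) - (Y - (a * (v2 - v1)) * (u2 - u1)) by ring.
apply: le_trans (ler_normB _ _) _; apply: le_trans (lerD HX HY) _.
have -> : k * (v2 - v1) + k * (u2 - u1) = e / 2 * s ^+ 2 by rewrite /k /s; ring.
by rewrite ler_wpM2r ?sqr_ge0//; lra.
Qed.

End Goursat.

(** * Mean values and the local maximum principle *)

Section LocalMaximum.
Variable R : realType.
Local Notation C := (Cplx R).

Lemma cont_cplx2 (f g : R -> R) (x : R) : {for x, continuous f} -> {for x, continuous g} ->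
  {for x, continuous (fun t => (f t +i* g t) : C)}.
Proof.
move=> /cvgrPdist_lt cf /cvgrPdist_lt cg; apply/contRCP => e e0.
have e20 : 0 < e / 2 by rewrite divr_gt0.
have /nearRP[r1 r10 h1] := cf _ e20; have /nearRP[r2 r20 h2] := cg _ e20.
exists (Num.min r1 r2); first by rewrite lt_min r10.
move=> y; rewrite lt_min => /andP[/h1 y1 /h2 y2].
apply: le_lt_trans (nm_le_ReIm _) _ => /=.
by rewrite (splitr e) ltrD// distrC.
Qed.

Lemma cont_pol (f g : R -> R) (x : R) : {for x, continuous f} -> {for x, continuous g} ->
  {for x, continuous (fun t => pol (f t) (g t))}.
Proof.
move=> cf cg; have -> : (fun t => pol (f t) (g t)) =
    fun t => (expR (f t) * cos (g t)) +i* (expR (f t) * sin (g t)) :> C.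
  by apply/funext => t; rewrite polE.
have ce : {for x, continuous (fun t => expR (f t))}.
  by apply: (continuous_comp cf); exact: continuous_expR.
apply: cont_cplx2; apply: cvgM => //.
  by apply: (continuous_comp cg); exact: continuous_cos.
by apply: (continuous_comp cg); exact: continuous_sin.
Qed.

Lemma prim_le (h P : R -> R) (a b c : R) : a <= b ->
  (forall x : R, a <= x <= b -> has_deriv P x (h x)) ->
  (forall x : R, a <= x <= b -> h x <= c) -> P b - P a <= c * (b - a).
Proof.
move=> ab dP hc; have [||t tab ->] := @MVT_segment R P h a b ab.
- by move=> x; rewrite in_itv/= => /andP[/ltW ax /ltW xb]; apply: dP; rewrite ax.
- apply: derivable_within_continuous => x; rewrite in_itv/= => /dP xab.
  by case: xab.
by rewrite ler_wpM2r ?subr_ge0// hc//; move: tab; rewrite in_itv.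
Qed.

Section Mean.
Variables (q : C -> C) (a : C) (r : R).
Hypothesis cq : forall z : C, nm (z - a) < r -> ccont q z.
Hypothesis dq : forall z : C, nm (z - a) < r -> z != a -> cdiff q z.
Variable U : R.
Hypothesis Ur : expR U < r.

(** Freezing the radius at e^U < r makes [Psi] continuous for all u, while it stays holomorphic in u
    + iv for u < U. *)
Let Psi (u v : R) := q (a + pol (Num.min u U) v).

Let in_disc (u v : R) : nm (a + pol (Num.min u U) v - a) < r.
Proof.
rewrite [a + _]addrC addrK nm_pol; apply: le_lt_trans Ur.
by rewrite ler_expR ge_min lexx orbT.
Qed.

Let cPsi (f g : R -> R) (x : R) : {for x, continuous f} -> {for x, continuous g} ->
  {for x, continuous (fun t => Psi (f t) (g t))}.
Proof.
move=> cf cg; have cm : {for x, continuous (fun t => Num.min (f t) U)}.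
  apply/cvgrPdist_lt => e e0; move/cvgrPdist_lt : cf => /(_ e e0).
  apply: filterS => t; rewrite !ltr_norml => /andP[? ?].
  by case: (leP (f x) U) => ?; case: (leP (f t) U) => ?; apply/andP; split; lra.
have /contRCP cp := cont_pol cm cg.
apply/contRCP => e e0; have [d d0 hd] := cq (in_disc (f x) (g x)) e0.
have [s s0 hs] := cp d d0; exists s => // y /hs ys; apply: hd.
by rewrite opprD addrACA subrr add0r.
Qed.

Let dPsi (u v : R) : u < U -> exists d : C, forall e : R, 0 < e ->
  exists2 s : R, 0 < s & forall u' v' : R, `|u' - u| < s -> `|v' - v| < s ->
    nm (Psi u' v' - Psi u v - d * ((u' - u) +i* (v' - v))) <= e * (`|u' - u| + `|v' - v|).
Proof.
move=> uU; have muU : Num.min u U = u by rewrite min_l// ltW.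
set P := pol u v; have P0 : 0 < nm P by rewrite nm_pol expR_gt0.
have aP : a + P != a by rewrite -subr_eq0 addrAC subrr add0r -nm_gt0.
have [|d0 hd0] := @dq (a + P) _ aP; first by have := in_disc u v; rewrite muU.
exists (d0 * P) => e e0.
have e10 : 0 < e / (4 * nm P) by rewrite divr_gt0// mulr_gt0.
have [r1 r10 h1] := hd0 _ e10.
have n0 : 0 < nm d0 * nm P + 1 by rewrite ltr_wpDl// mulr_ge0 ?nm_ge0.
pose e2 := Num.min 1 (e / (2 * (nm d0 * nm P + 1))).
have e20 : 0 < e2 by rewrite lt_min ltr01 divr_gt0// mulr_gt0.
have [e2a e2b] : e2 <= 1 /\ e2 <= e / (2 * (nm d0 * nm P + 1)).
  by rewrite /e2 !ge_min !lexx orbT.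
have [r2 r20 h2] := pol_is_diff e20.
have r30 : 0 < r1 / (4 * nm P) by rewrite divr_gt0// mulr_gt0.
have r40 : 0 < U - u by rewrite subr_gt0.
exists (Num.min (Num.min (U - u) r2) (r1 / (4 * nm P))); first by rewrite !lt_min r20 r30 r40.
move=> u' v'; rewrite !lt_min => /andP[/andP[uU' ur2] ur1] /andP[/andP[_ vr2] vr1].
have muU' : Num.min u' U = u'.
  by rewrite min_l//; move: uU'; rewrite ltr_norml => /andP[_]; lra.
rewrite /Psi muU muU' -/P.
set h := u' - u in ur2 ur1 *; set k := v' - v in vr2 vr1 *.
set s := `|h| + `|k|.
have s0 : 0 <= s by rewrite addr_ge0.
have PE : pol u' v' = P * pol h k by rewrite /P -polD /h /k; congr pol; ring.
have H2 := h2 h k ur2 vr2; rewrite -/s in H2.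
have nhk : nm (h +i* k) <= s by exact: nm_le_ReIm.
set W := P * (pol h k - 1).
have WE : a + pol u' v' - (a + P) = W by rewrite PE /W; ring.
have nW : nm W <= 2 * nm P * s.
  rewrite nmM mulrAC [leRHS]mulrC ler_wpM2l ?nm_ge0//.
  have -> : pol h k - 1 = (pol h k - 1 - (h +i* k)) + (h +i* k) by ring.
  apply: le_trans (nmD _ _) _; nra.
have H1 := h1 (a + pol u' v'); rewrite WE in H1.
have {}H1 := H1 _.
have sr : s < r1 / (2 * nm P).
  rewrite (_ : r1 / (2 * nm P) = r1 / (4 * nm P) + r1 / (4 * nm P)) ?ltrD//.
  by field; rewrite gt_eqF.
have {}H1 : nm (q (a + pol u' v') - q (a + P) - d0 * W) <= e / (4 * nm P) * nm W.
  apply: H1; apply: le_lt_trans nW _.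
  by move: sr; rewrite ltr_pdivlMr ?mulr_gt0// mulrC.
set X := q (a + pol u' v') - q (a + P) in H1 *.
have -> : X - d0 * P * (h +i* k) = (X - d0 * W) + d0 * P * (pol h k - 1 - (h +i* k)).
  by rewrite /W; ring.
apply: le_trans (nmD _ _) _; rewrite [in X in _ + X]nmM [nm (d0 * P)]nmM.
have A1 : e / (4 * nm P) * nm W <= e / 2 * s.
  apply: le_trans (ler_wpM2l (ltW e10) nW) _.
  by rewrite le_eqVlt; apply/orP; left; apply/eqP; field; rewrite gt_eqF.
have A2 : nm d0 * nm P * nm (pol h k - 1 - (h +i* k)) <= e / 2 * s.
  apply: (@le_trans _ _ ((nm d0 * nm P + 1) * (e2 * s))).
    by apply: ler_pM; rewrite ?mulr_ge0 ?nm_ge0// lerDl.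
  rewrite mulrA ler_wpM2r//.
  apply: le_trans (ler_wpM2l (ltW n0) e2b) _.
  by rewrite le_eqVlt; apply/orP; left; apply/eqP; field; rewrite gt_eqF.
apply: le_trans (lerD (le_trans H1 A1) A2) _; lra.
Qed.

Let perPsi (u : R) : Psi u (2 * pi) = Psi u 0.
Proof. by rewrite /Psi /pol -[2 * pi]add0r cis_2pi. Qed.

Let X (u v : R) := complex.Re (Psi u v).

(** The mean over the circle does not depend on the radius, and for small radii it tends to the
    value at the centre by continuity. Differentiability is asked off the centre only, so that
    divided differences extended by continuity qualify. *)
Lemma circle_mean (u : R) : u < U ->
  circle_prim Psi u (2 * pi) - circle_prim Psi u 0 = complex.Re (q a) * (2 * pi).
Proof.
have pi0 := pi_gt0 R.
have cu v : continuous (fun u => Psi u v).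
  by move=> x; apply: (@cPsi id (fun=> v)); [exact: cvg_id|exact: cvg_cst].
have cv w : continuous (Psi w).
  by move=> x; apply: (@cPsi (fun=> w) id); [exact: cvg_cst|exact: cvg_id].
move=> uU; apply/eqP; rewrite -subr_eq0 -normr_le0; apply/ler_addgt0Pl => e e0.
rewrite addr0; have e10 : 0 < e / (2 * pi) by rewrite divr_gt0// mulr_gt0.
have r0 : 0 < r by apply: lt_trans Ur; exact: expR_gt0.
have ca0 : nm (a - a) < r by rewrite subrr nm0.
have [d d0 hd] := cq ca0 e10.
pose u1 := Num.min u (ln d - 1).
have u1u : u1 <= u by rewrite ge_min lexx.
rewrite (circle_prim_const cu cv dPsi perPsi u1u uU).
have := @prim_diff_est R (fun=> 0) (X u1) (fun=> 0) (circle_prim Psi u1) 0 (2 * pi)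
   (complex.Re (q a)) (e / (2 * pi)).
rewrite !subr0 divfK ?gt_eqF ?mulr_gt0//; apply; first by rewrite mulr_ge0// ltW.
- by move=> x _; exact: is_derive_cst.
- by move=> x /andP[x0 _]; apply: circle_prim_is_derive => //; lra.
move=> x _; rewrite subr0 /X -cReN -cReD; apply: le_trans (Re_le_nm _) _.
apply/ltW/hd; rewrite [a + _]addrC addrK nm_pol -[ltRHS]lnK// ltr_expR.
rewrite (le_lt_trans (_ : _ <= u1))//; first by rewrite ge_min lexx.
by rewrite /u1 gt_min ltrBlDr ltrDl ltr01 orbT.
Qed.

(** A smaller value at one point of the circle would persist on an arc of length h and pull the mean
    below the maximum. *)
Lemma circle_max (u v : R) : u < U -> 0 <= v < 2 * pi ->
  (forall z : C, nm (z - a) < r -> complex.Re (q z) <= complex.Re (q a)) ->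
  complex.Re (q (a + pol u v)) = complex.Re (q a).
Proof.
move=> uU /andP[v0 v2] qm; have pi0 := pi_gt0 R.
have muU : Num.min u U = u by rewrite min_l// ltW.
have ca := circle_mean uU.
have XM t : X u t <= complex.Re (q a) by apply: qm; exact: in_disc.
suff : complex.Re (q a) <= X u v by rewrite /X /Psi muU => ?; apply/eqP; rewrite eq_le qm//=;
  have := in_disc u v; rewrite muU.
rewrite leNgt; apply/negP => Xlt.
pose k := (complex.Re (q a) - X u v) / 2; have k0 : 0 < k by rewrite divr_gt0// subr_gt0.
have cXu : {for v, continuous (X u)}.
  apply: continuous_comp; last exact: cont_Re.
  by apply: (@cPsi (fun=> u) id); [exact: cvg_cst|exact: cvg_id].
move/cvgrPdist_lt : cXu => /(_ k k0) /nearRP[s s0 hs].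
pose h := Num.min (s / 2) (2 * pi - v).
have h0 : 0 < h by rewrite lt_min divr_gt0//= subr_gt0.
have [hs2 hv] : h <= s / 2 /\ h <= 2 * pi - v by rewrite /h !ge_min !lexx orbT.
have cv w : continuous (Psi w).
  by move=> x; apply: (@cPsi (fun=> w) id); [exact: cvg_cst|exact: cvg_id].
have dP t : 0 <= t -> has_deriv (circle_prim Psi u) t (X u t).
  by move=> t0; apply: circle_prim_is_derive => //; lra.
have A1 := @prim_le (X u) (circle_prim Psi u) 0 v (complex.Re (q a)) v0.
have A2 := @prim_le (X u) (circle_prim Psi u) v (v + h) (complex.Re (q a) - k).
have A3 := @prim_le (X u) (circle_prim Psi u) (v + h) (2 * pi) (complex.Re (q a)).
have {}A1 : circle_prim Psi u v - circle_prim Psi u 0 <= complex.Re (q a) * (v - 0).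
  by apply: A1 => // x /andP[? ?]; apply: dP.
have {}A3 : circle_prim Psi u (2 * pi) - circle_prim Psi u (v + h) <=
   complex.Re (q a) * (2 * pi - (v + h)).
  by apply: A3 => //; [lra|move=> x /andP[? ?]; apply: dP; lra].
have {}A2 : circle_prim Psi u (v + h) - circle_prim Psi u v <= (complex.Re (q a) - k) * (v + h - v).
  apply: A2; [lra|by move=> x /andP[? ?]; apply: dP; lra|].
  move=> x /andP[x1 x2]; have := hs x.
  rewrite ger0_norm; last lra.
  have xs : x - v < s by lra.
  move=> /(_ xs); rewrite ltr_norml => /andP[]; rewrite /k; lra.
have : k * h > 0 by rewrite mulr_gt0.
nra.
Qed.

End Mean.

Lemma local_max_Re (q : C -> C) (a : C) (r : R) :
  (forall z : C, nm (z - a) < r -> ccont q z) ->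
  (forall z : C, nm (z - a) < r -> z != a -> cdiff q z) ->
  (forall z : C, nm (z - a) < r -> complex.Re (q z) <= complex.Re (q a)) ->
  forall z : C, nm (z - a) < r -> complex.Re (q z) = complex.Re (q a).
Proof.
move=> cq dq qm z zr; have [->//|za] := eqVneq z a.
have z0 : z - a != 0 by rewrite subr_eq0.
have n0 : 0 < nm (z - a) by rewrite nm_gt0.
have [v v2 zE] := pol_ex z0.
have m0 : 0 < (nm (z - a) + r) / 2 by rewrite divr_gt0// addr_gt0// (lt_trans n0).
have -> : z = a + pol (ln (nm (z - a))) v by rewrite -zE addrCA subrr addr0.
apply: (circle_max cq dq (U := ln ((nm (z - a) + r) / 2))) => //.
  by rewrite lnK//; lra.
by rewrite ltr_ln ?posrE//; lra.
Qed.

(** With k the conjugate of q a, the real part of q k is maximal at a, hence constant. Together with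
    |q z| <= |q a| this is the equality case of Cauchy-Schwarz, so q z = q a. *)
Lemma local_maxmod (q : C -> C) (a : C) (r : R) :
  (forall z : C, nm (z - a) < r -> ccont q z) ->
  (forall z : C, nm (z - a) < r -> z != a -> cdiff q z) ->
  (forall z : C, nm (z - a) < r -> nm (q z) <= nm (q a)) ->
  forall z : C, nm (z - a) < r -> q z = q a.
Proof.
move=> cq dq qm z zr; pose k : C := complex.Re (q a) +i* (- complex.Im (q a)).
have kE (w : C) : complex.Re (w * k : C) = complex.Re w * complex.Re (q a) + complex.Im w * complex.Im (q a).
  by rewrite cReM /k/=; ring.
have sq (w : C) : nm (w - a) < r -> complex.Re (q w) ^+ 2 + complex.Im (q w) ^+ 2 <=
    complex.Re (q a) ^+ 2 + complex.Im (q a) ^+ 2.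
  by move=> /qm; rewrite -!nm_sqr ler_sqr ?nnegrE ?nm_ge0.
have := @local_max_Re (fun w => q w * k) a r _ _ _ z zr; rewrite !kE => H.
have {}H := H _ _ _.
have {}H : complex.Re (q z) * complex.Re (q a) + complex.Im (q z) * complex.Im (q a) =
    complex.Re (q a) * complex.Re (q a) + complex.Im (q a) * complex.Im (q a).
  apply: H.
  - by move=> w /cq cw; apply: ccontM cw _; exact: ccont_cst.
  - by move=> w wr wa; apply: cdiffM (dq _ wr wa) _; exact: cdiff_cst.
  move=> w /sq sw; rewrite !kE.
  have := sqr_ge0 (complex.Re (q w) - complex.Re (q a)).
  have := sqr_ge0 (complex.Im (q w) - complex.Im (q a)).
  rewrite !sqrrB; lra.
apply/eqP; rewrite -subr_eq0 -nm_eq0 -sqrf_eq0 nm_sqr !cReD !cImD !cReN !cImN.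
rewrite eq_le addr_ge0 ?sqr_ge0// andbT !sqrrB; have := sq z zr; lra.
Qed.

End LocalMaximum.

(** * Global maximum principle, Schwarz lemma and open images *)

Section MaximumPrinciple.
Variable R : realType.
Local Notation C := (Cplx R).

Lemma ccont_nm (q : C -> C) (z : C) : ccont q z -> {for z, continuous (fun w => nm (q w))}.
Proof.
move=> cq; apply/contCRP => e /cq[d d0 hd]; exists d => // y /hd.
apply: le_lt_trans; have := nm_lbB (q y) (q z); have := nm_lbB (q z) (q y).
by rewrite (nmB (q z)) ler_norml => ? ?; apply/andP; split; lra.
Qed.

Lemma disc_open (x : C) (r : R) : open [set z : C | nm (z - x) < r].
Proof.
apply/openCP => z /= zr; exists (r - nm (z - x)); first by rewrite subr_gt0.
by move=> y yz; apply: le_lt_trans (nmBD _ z _) _; rewrite -ltrBrDr.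
Qed.

(* The hypothesis on superlevel sets is the boundary condition [limsup |q| <= B]. *)
Lemma maxmod (Om : set C) (q : C -> C) (x0 : C) (B : R) : open Om ->
  (forall z : C, Om z -> ccont q z) ->
  (forall z : C, Om z -> z != x0 -> cdiff q z) ->
  (forall B' : R, B < B' -> closed [set z : C | Om z /\ B' <= nm (q z)]) ->
  (exists M : R, forall z : C, Om z -> B < nm (q z) -> nm z <= M) ->
  forall z : C, Om z -> nm (q z) <= B.
Proof.
move=> /openCP oOm cq dq cl [M bd] z1 Oz1; rewrite leNgt; apply/negP => Bz1.
have sup_max (b : R) (h : C -> R) : B < b -> [set z : C | Om z /\ b <= nm (q z)] !=set0 ->
    (forall z : C, Om z -> {for z, continuous h}) ->
    exists z : C, [/\ Om z, b <= nm (q z) & forall y : C, Om y -> b <= nm (q y) -> h y <= h z].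
  move=> Bb Enon ch.
  have [|||z [Oz bz] zm] := @evt_max R _ M h (cl b Bb).
  - by move=> z [Oz bz]; apply: bd => //; exact: lt_le_trans bz.
  - exact: Enon.
  - by move=> z [Oz _]; exact: ch.
  by exists z; split => // y Oy by_; apply: zm.
have [||z2 [Oz2 bz2 z2m]] := sup_max _ (fun w => nm (q w)) Bz1.
- by exists z1.
- by move=> z /cq; exact: ccont_nm.
have {}z2m (y : C) : Om y -> nm (q y) <= nm (q z2).
  move=> Oy; have [|h] := leP (nm (q z1)) (nm (q y)); first exact: z2m.
  exact: le_trans (ltW h) bz2.
(* Among the maximizers of |q|, one with the largest real part is taken. As q is constant near it, a
   point slightly to its right is a maximizer too. *)
have [||z3 [Oz3 bz3 z3m]] := sup_max _ (@complex.Re R : C -> R) (lt_le_trans Bz1 bz2).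
- by exists z2.
- by move=> z _; exact: cont_Re.
have [r r0 hr] := oOm z3 Oz3.
(* The disc avoids [x0] unless it is centred there, as the local principle requires. *)
have [s [s0 sr sx]] : exists s : R, [/\ 0 < s, s <= r & z3 != x0 -> s <= nm (z3 - x0)].
  have [->|zx] := eqVneq z3 x0; first by exists r.
  have n0 : 0 < nm (z3 - x0) by rewrite nm_gt0 subr_eq0.
  exists (Num.min r (nm (z3 - x0))); split; rewrite ?lt_min ?r0// ?ge_min ?lexx//.
  by rewrite orbT.
have sub (z : C) : nm (z - z3) < s -> Om z by move=> zs; apply: hr; exact: lt_le_trans sr.
pose z4 : C := z3 + ((s / 2)%:C : C).
have z43 : nm (z4 - z3) < s.
  by rewrite /z4 addrAC subrr add0r nmR ger0_norm; lra.
have q4 : q z4 = q z3.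
  apply: (@local_maxmod R q z3 s) z43 => z zs.
  - exact/cq/sub.
  - move=> zz3; apply: dq; first exact: sub.
    apply/eqP => zx; move: zs; rewrite zx nmB ltNge sx//.
    by rewrite eq_sym -zx.
  - by apply: le_trans bz3; apply: z2m; exact: sub.
have := z3m z4 (sub _ z43); rewrite q4 => /(_ bz3).
by rewrite /z4 cReD/= gerDl leNgt divr_gt0.
Qed.

(** Caratheodory's quotient of h at x is continuous on the disc and differentiable off x; the
    maximum principle bounds it by M / r. *)
Lemma schwarz (h : C -> C) (x : C) (r M : R) : 0 < r -> h x = 0 ->
  (forall z : C, nm (z - x) < r -> cdiff h z) ->
  (forall z : C, nm (z - x) < r -> nm (h z) <= M) ->
  forall z : C, nm (z - x) < r -> nm (h z) <= M / r * nm (z - x).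
Proof.
move=> r0 hx dh hM.
have x_in : nm (x - x) < r by rewrite subrr nm0.
have M0 : 0 <= M by apply: le_trans (hM x x_in); exact: nm_ge0.
have [d /is_cdiffP[q [cq qx qE]]] := dh x x_in.
have hE (w : C) : h w = q w * (w - x) by rewrite -qE hx subr0.
have qw (w : C) : w != x -> q w = h w * (w - x)^-1.
  by move=> wx; rewrite hE mulfK// subr_eq0.
have dq (w : C) : nm (w - x) < r -> w != x -> cdiff q w.
  move=> wr wx; apply: (@cdiff_near _ (fun w => h w * (w - x)^-1)).
    apply: cdiffM; first exact: dh.
    by apply: cdiffV; [apply: cdiffB; [exact: cdiff_id|exact: cdiff_cst]|rewrite subr_eq0].
  apply/nearCP; exists (nm (w - x)); first by rewrite nm_gt0 subr_eq0.
  move=> y yw; rewrite qw//; apply: contraTneq yw => ->.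
  by rewrite nmB -leNgt.
have cqw (w : C) : nm (w - x) < r -> ccont q w.
  by move=> wr; have [->//|wx] := eqVneq w x; exact/cdiff_cont/dq.
suff H : forall z : C, nm (z - x) < r -> nm (q z) <= M / r.
  by move=> z zr; rewrite hE nmM ler_wpM2r ?nm_ge0//; exact: H.
(* No boundary values are available. The bound on h confines the set |q| >= B' to the disc of radius
   M / B' < r, which makes it closed. *)
have lev (B' : R) (z : C) : M / r < B' -> nm (z - x) < r -> B' <= nm (q z) ->
    nm (z - x) <= M / B'.
  move=> MB zr Bz; have B0 : 0 < B' by apply: le_lt_trans MB; rewrite divr_ge0// ltW.
  rewrite ler_pdivlMr//; apply: le_trans (hM z zr); rewrite hE nmM mulrC.
  by rewrite ler_wpM2r ?nm_ge0.
have H := @maxmod [set z | nm (z - x) < r] q x (M / r) (@disc_open x r) cqw dq.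
move=> z0 z0r; apply: (H _ _ z0 z0r) => {z0 z0r}.
  move=> B' MB; apply/closedCP => z zc.
  have B0 : 0 < B' by apply: le_lt_trans MB; rewrite divr_ge0// ltW.
  have zr : nm (z - x) < r.
    apply: (@le_lt_trans _ _ (M / B')); last by rewrite ltr_pdivrMr// mulrC -ltr_pdivrMr.
    apply/ler_addgt0Pr => e /zc[y [yr By] yz]; have := lev _ _ MB yr By.
    have := nmBD z y x; rewrite (nmB z y); lra.
  split=> //; apply/ler_addgt0Pr => e e0.
  have [s s0 hs] := (contCRP _ _).1 (ccont_nm (cqw z zr)) e e0.
  have [y [yr By] yz] := zc s s0; have := hs y yz; rewrite ltr_norml; lra.
exists (nm x + r) => z zr _; have := nm_lbB z x; move: zr => /=; lra.
Qed.

(** If w were omitted, 1 / (F - w) would be holomorphic in the disc and bounded by 2 / m near the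
    circle, although it exceeds 2 / m at the centre. *)
Lemma open_image (F : C -> C) (x : C) (r m : R) : 0 < r ->
  (forall z : C, nm (z - x) <= r -> cdiff F z) ->
  (forall z : C, nm (z - x) = r -> m <= nm (F z - F x)) ->
  forall w : C, nm (w - F x) < m / 2 -> exists2 z : C, nm (z - x) < r & F z = w.
Proof.
move=> r0 dF mF w wm; apply: contrapT => nex.
have Fw (z : C) : nm (z - x) < r -> F z - w != 0.
  by move=> zr; rewrite subr_eq0; apply/eqP => Fz; apply: nex; exists z.
have m0 : 0 < m by have := nm_ge0 (w - F x); lra.
pose q (z : C) := (F z - w)^-1.
have dq (z : C) : nm (z - x) < r -> cdiff q z.
  move=> zr; apply: cdiffV; last exact: Fw.
  by apply: cdiffB; [exact/dF/ltW|exact: cdiff_cst].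
have := @maxmod [set z | nm (z - x) < r] q x (2 / m) (@disc_open x r).
move=> /(_ (fun z zr => cdiff_cont (dq z zr)) (fun z zr _ => dq z zr)).
move=> H; have {}H := H _ _ x.
have x_in : nm (x - x) < r by rewrite subrr nm0.
suff : nm (q x) <= 2 / m.
  have Fx0 : 0 < nm (F x - w) by rewrite nm_gt0 Fw.
  rewrite leNgt => /negP; apply; rewrite /q nmV -invf_div ltf_pV2 ?posrE ?divr_gt0//.
  by rewrite nmB.
apply: H => //.
  move=> B' mB; apply/closedCP => z zc.
  have B0 : 0 < B' by apply: lt_trans mB; rewrite divr_gt0.
  have zr : nm (z - x) <= r.
    apply/ler_addgt0Pr => e /zc[y [/= yr _] yz].
    have := nmBD z y x; rewrite (nmB z y); lra.
  have Fz : nm (F z - w) <= B'^-1.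
    apply/ler_addgt0Pr => e e0.
    have [s s0 hs] := cdiff_cont (dF z zr) e0.
    have [y [yr By] yz] := zc s s0; have Fyz := hs y yz.
    have Fyw : nm (F y - w) <= B'^-1.
      rewrite -[leLHS]invrK lef_pV2 ?posrE ?invr_gt0 ?nm_gt0 ?Fw//.
      by move: By; rewrite /q nmV.
    have := nmBD (F z) (F y) w; rewrite (nmB (F z) (F y)); lra.
  have Bm : B'^-1 < m / 2 by rewrite -[ltRHS]invrK ltf_pV2 ?posrE ?invr_gt0 ?divr_gt0// invf_div.
  have zr' : nm (z - x) < r.
    rewrite lt_neqAle zr andbT; apply/eqP => /mF mz.
    have := nmBD (F z) w (F x); lra.
  split => //; rewrite /q nmV -[leLHS]invrK lef_pV2 ?posrE ?invr_gt0 ?nm_gt0 ?Fw//.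
exists (nm x + r) => z zr _; have := nm_lbB z x; move: zr => /=; lra.
Qed.

End MaximumPrinciple.

(** * Dynamics of the quadratic polynomial *)

Section Escape.
Variable R : realType.
Local Notation C := (Cplx R).
Variable c : C.
Local Notation f := (quadratic c).
Local Notation K := (filled_julia f).
Implicit Types z w : C.

(** Beyond this radius |z|^2 >= |c| + 3 |z|, so that moduli at least double at each step. *)
Definition escape_radius : R := nm c + 3.
Local Notation rho := escape_radius.

Lemma escape_step z : rho < nm z -> 2 * nm z <= nm (f z).
Proof.
rewrite /escape_radius /quadratic => zr; apply: le_trans (nm_lbD _ _).
rewrite nmX expr2; have := nm_ge0 c; nra.
Qed.

Lemma escape_iter z n : rho < nm z -> 2 ^+ n * nm z <= nm (iter n f z).
Proof.
move=> zr; elim: n => [|n IH]; first by rewrite expr0 mul1r.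
rewrite iterS exprS -mulrA; apply: (@le_trans _ _ (2 * nm (iter n f z))).
  by rewrite ler_wpM2l.
apply: escape_step; apply: (lt_le_trans zr); apply: le_trans IH.
by rewrite ler_peMl ?nm_ge0// exprn_ege1// ler1n.
Qed.

Lemma filled_juliaP z : K z <-> forall n, nm (iter n f z) <= rho.
Proof.
split=> [|h]; last first.
  exists (rho%:C); split; first by rewrite complex_real.
  by move=> x xr _ [n _ <-]; rewrite /= (_ : `|_| = (nm (iter n f z))%:C); [apply: le_trans (ltW xr); rewrite lecR|exact: normE].
move=> [M [Mr hM]] n; rewrite leNgt; apply/negP => zr.
have {}hM k : nm (iter k f z) <= complex.Re M + 1.
  rewrite -lecR -normE; apply: hM; last by exists k.
  by rewrite -{1}(RRe_real Mr) ltcR ltrDl.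
pose m := (Num.truncn (complex.Re M + 1)).+1.
have := hM (m + n)%N; rewrite iterD leNgt => /negP; apply.
apply: lt_le_trans (truncnS_gt _) _; rewrite -/m.
apply: le_trans (escape_iter m zr).
have h1 : m%:R <= 2 ^+ m :> R by rewrite -natrX ler_nat ltnW// ltn_expl.
have h2 : (0 : R) <= 2 ^+ m by rewrite exprn_ge0.
have := nm_ge0 c; rewrite /escape_radius in zr; nra.
Qed.

Lemma filled_julia_bounded z : K z -> nm z <= rho.
Proof. by move=> /filled_juliaP/(_ 0%N). Qed.

Lemma filled_juliaN z : K (- z) <-> K z.
Proof.
have h w : K w -> K (- w).
  move=> /filled_juliaP Kw; apply/filled_juliaP => -[|n]; first by rewrite nmN; exact: (Kw 0%N).
  by rewrite iterSr {2}/quadratic sqrrN -/(quadratic c w) -iterSr.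
by split => [/h|/h//]; rewrite opprK.
Qed.

Lemma filled_julia_f z : K (f z) <-> K z.
Proof.
split=> /filled_juliaP h; apply/filled_juliaP; last first.
  by move=> n; have := h n.+1; rewrite iterSr.
move=> [|n]; last by rewrite iterSr.
rewrite leNgt; apply/negP => zr; have := h 0%N => /=.
have := escape_step zr; have := nm_ge0 c; rewrite /escape_radius in zr *; lra.
Qed.

Lemma filled_julia_iter n z : K (iter n f z) <-> K z.
Proof. by elim: n => [//|n IH]; rewrite iterS filled_julia_f. Qed.

Lemma cdiff_quadratic z : cdiff f z.
Proof. by apply: cdiffD; [exact/cdiffX/cdiff_id|exact: cdiff_cst]. Qed.

Lemma cdiff_iter n z : cdiff (iter n f) z.
Proof.
elim: n => [|n IH]; first exact: cdiff_id.
by apply: cdiff_comp => //; exact: cdiff_quadratic.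
Qed.

Lemma filled_julia_closed : closed K.
Proof.
apply/closedCP => z zK; apply/filled_juliaP => n.
apply/ler_addgt0Pr => e e0; have [s s0 hs] := cdiff_cont (cdiff_iter n z) e0.
have [y /filled_juliaP/(_ n) yn yz] := zK s s0.
have := nm_lbB (iter n f z) (iter n f y); have := hs y yz; rewrite nmB; lra.
Qed.

Lemma basin_open : open (~` K).
Proof. by rewrite openC; exact: filled_julia_closed. Qed.

Lemma basin_disc z : ~ K z -> exists2 r : R, 0 < r & forall y : C, nm (y - z) < r -> ~ K y.
Proof. by have /openCP := basin_open; exact. Qed.

(** The boundary of Z lies in K, where all iterates are bounded by [escape_radius]; by the maximum
    principle they are so on Z, which puts Z inside K. This serves in place of the connectedness of
    the basin. *)
Lemma no_bounded_piece (Z : set C) (M : R) : open Z -> (forall z, Z z -> ~ K z) ->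
  (forall z, Z z -> nm z <= M) ->
  (forall z, (forall e : R, 0 < e -> exists2 y, Z y & nm (y - z) < e) -> Z z \/ K z) ->
  forall z, ~ Z z.
Proof.
move=> oZ ZK ZM Zc z Zz; apply: (ZK z Zz); apply/filled_juliaP => n.
apply: (@maxmod R Z (iter n f) 0 rho) Zz => //.
- by move=> w _; exact/cdiff_cont/cdiff_iter.
- by move=> w _ _; exact/cdiff_iter.
- move=> B' rB; apply/closedCP => w wc.
  have Bw : B' <= nm (iter n f w).
    apply/ler_addgt0Pr => e e0; have [s s0 hs] := cdiff_cont (cdiff_iter n w) e0.
    have [y [_ yB] yw] := wc s s0; have := hs y yw.
    have := nm_lbB (iter n f y) (iter n f w); lra.
  split => //; have [|//|/filled_juliaP/(_ n)] := Zc w.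
    by move=> e /wc[y [Zy _] yw]; exists y.
  by rewrite leNgt (lt_le_trans rB Bw).
by exists M => w /ZM.
Qed.

End Escape.

Section InjectiveOpen.
Variable R : realType.
Local Notation C := (Cplx R).

(** Injectivity and compactness give |F - F x| a positive minimum on the circle, and [open_image]
    applies. *)
Lemma injective_open (F : C -> C) (x : C) (r : R) : 0 < r ->
  (forall z : C, nm (z - x) <= r -> cdiff F z) ->
  (forall z : C, nm (z - x) <= r -> F z = F x -> z = x) ->
  exists2 d : R, 0 < d & forall w : C, nm (w - F x) < d -> exists2 z : C, nm (z - x) < r & F z = w.
Proof.
move=> r0 dF iF.
have cS : closed [set z : C | nm (z - x) = r].
  apply/closedCP => z zc; apply/eqP; rewrite -subr_eq0 -normr_le0.
  apply/ler_addgt0Pr => e /zc[y yr yz]; rewrite add0r -yr.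
  have := nmBD z y x; have := nmBD y z x; rewrite (nmB z y) ler_norml => ? ?.
  by apply/andP; split; lra.
have [|||z zr zm] := @evt_max R _ (nm x + r) (fun z => - nm (F z - F x)) cS.
- by move=> z /= zr; have := nm_lbB z x; lra.
- by exists (x + (r%:C : C)) => /=; rewrite addrAC subrr add0r nmR ger0_norm// ltW.
- move=> z /= zr; apply: continuousN; apply: ccont_nm.
  by apply: ccontB; [apply/cdiff_cont/dF; rewrite zr|exact: ccont_cst].
rewrite /= in zr; pose m := nm (F z - F x).
have m0 : 0 < m.
  rewrite nm_gt0 subr_eq0; apply/eqP => FzE.
  have zx : z = x by apply: iF => //; rewrite zr.
  by move: zr; rewrite zx subrr nm0 => /eqP; rewrite lt_eqF.
exists (m / 2); first by rewrite divr_gt0.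
move=> w wm; apply: (open_image r0 dF _ wm) => y yr.
by have := zm y yr; rewrite lerN2.
Qed.

End InjectiveOpen.

(** * The functional equation of the exterior map *)

Section ExteriorMaximum.
Variable R : realType.
Local Notation C := (Cplx R).

(* Maximum principle for a neighbourhood of infinity in the sphere: [qt] is [q] read in the
   coordinate [1/z]. *)
Lemma maxmod_ext (K : set C) (x1 : C) (q qt : C -> C) (s B : R) : open (~` K) -> K x1 ->
  (forall z : C, ~ K z -> cdiff q z) -> 0 < s ->
  (forall w : C, nm w < s -> w != 0 -> ~ K w^-1 /\ qt w = q w^-1) -> ccont qt 0 ->
  (forall B' : R, B < B' -> closed [set z : C | ~ K z /\ B' <= nm (q z)]) ->
  forall z : C, ~ K z -> nm (q z) <= B.
Proof.
move=> oK Kx1 dq s0 hqt cqt cl z1 Kz1; rewrite leNgt; apply/negP => Bz1.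
have far (z : C) : s^-1 < nm z -> [/\ ~ K z, nm z^-1 < s, z^-1 != 0 & qt z^-1 = q z].
  move=> zs; have z0 : 0 < nm z by apply: lt_trans zs; rewrite invr_gt0.
  have zi : z^-1 != 0 by rewrite invr_eq0 -nm_gt0.
  have zs' : nm z^-1 < s by rewrite nmV -[ltRHS]invrK ltf_pV2 ?posrE ?invr_gt0.
  by have [] := hqt _ zs' zi; rewrite invrK.
(* Otherwise a level between |qt 0| and |q z| is exceeded only on a bounded set, where the ordinary
   maximum principle applies. *)
have qt_max (z : C) : ~ K z -> B < nm (q z) -> nm (q z) <= nm (qt 0).
  move=> Kz Bz; rewrite leNgt; apply/negP => qz.
  pose B2 := (nm (q z) + Num.max B (nm (qt 0))) / 2.
  have mx : Num.max B (nm (qt 0)) < nm (q z) by rewrite gt_max Bz qz.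
  have [mB m0] : B <= Num.max B (nm (qt 0)) /\ nm (qt 0) <= Num.max B (nm (qt 0)).
    by rewrite !le_max !lexx orbT.
  suff : nm (q z) <= B2 by rewrite /B2; lra.
  apply: (@maxmod R (~` K) q 0 B2 oK) Kz => //.
  - by move=> w /dq/cdiff_cont.
  - by move=> w /dq.
  - by move=> B' B2B'; apply: cl; rewrite /B2 in B2B'; lra.
  have e0 : 0 < B2 - nm (qt 0) by rewrite /B2; lra.
  have [t t0 ht] := cqt _ e0; exists (Num.max s^-1 t^-1) => w Kw B2w.
  rewrite leNgt gt_max; apply/negP => /andP[ws wt].
  have [_ ws' w0 wE] := far w ws.
  have := ht w^-1; rewrite subr0 wE => H.
  have w0' : 0 < nm w by apply: lt_trans wt; rewrite invr_gt0.
  have : nm w^-1 < t by rewrite nmV -[ltRHS]invrK ltf_pV2 ?posrE ?invr_gt0.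
  by move=> /H; have := nm_lbB (q w) (qt 0); lra.
have B0 : B < nm (qt 0) := lt_le_trans Bz1 (qt_max z1 Kz1 Bz1).
have qtc (w : C) : nm w < s -> qt w = qt 0.
  move=> ws; have inD (y : C) : nm (y - 0) < s -> nm y < s by rewrite subr0.
  have dqt (y : C) : nm (y - 0) < s -> y != 0 -> cdiff qt y.
    move=> /inD ys y0; have [Ky _] := hqt y ys y0.
    apply: (@cdiff_near _ (fun w => q w^-1)).
      by apply: cdiff_comp; [exact: cdiffV (cdiff_id _) y0|exact: dq].
    apply/nearCP; exists (Num.min (nm y) (s - nm y)).
      by rewrite lt_min nm_gt0 y0 subr_gt0.
    move=> u; rewrite lt_min => /andP[uy us].
    have [||_ ->//] := hqt u.
      by have := nm_lbB u y; lra.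
    by apply: contraTneq uy => ->; rewrite sub0r nmN ltxx.
  apply: (@local_maxmod R qt 0 s); rewrite ?subr0//.
  - move=> y ys; have [->//|y0] := eqVneq y 0; apply: cdiff_cont; exact: dqt.
  - move=> y /inD ys; have [->//|y0] := eqVneq y 0.
  have [Ky yE] := hqt y ys y0; rewrite yE.
  have [h|h] := leP (nm (q y^-1)) B; first exact: le_trans h (ltW B0).
  exact: qt_max.
pose S := [set z : C | ~ K z /\ nm (qt 0) <= nm (q z)].
have cS : closed S := cl _ B0.
pose L := nm x1 + s^-1 + 1.
have L0 : 0 < L by rewrite /L; have := nm_ge0 x1; have : 0 < s^-1 by [rewrite invr_gt0]; lra.
pose z2 : C := L%:C.
have nz2 : nm z2 = L by rewrite nmR ger0_norm// ltW.
have Sz2 : S z2.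
  have [|Kz2 ws _ wE] := far z2; first by rewrite nz2 /L; have := nm_ge0 x1; lra.
  by split => //; rewrite -wE qtc.
(* q is constant near infinity, so its maximal modulus is also attained at finite points. One
   closest to the point [x1] of K is taken. *)
have [||||z3 [[Kz3 qz3] z3L] z3m] := @evt_max R (S `&` [set z : C | nm (z - x1) <= nm (z2 - x1)])
    (nm x1 + nm (z2 - x1)) (fun z => - nm (z - x1)).
- apply: closedI => //; apply/closedCP => z zc /=.
  apply/ler_addgt0Pr => e /zc[y /= yL yz]; have := nmBD z y x1; rewrite (nmB z y); lra.
- by move=> z [_ /=]; have := nm_lbB z x1; lra.
- by exists z2; split => /=.
- move=> z _; apply: continuousN; apply: ccont_nm.
  by apply: ccontB; [exact: ccont_id|exact: ccont_cst].
have qz3E : nm (q z3) = nm (qt 0).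
  apply/eqP; rewrite eq_le qz3 andbT; apply: qt_max => //; exact: lt_le_trans qz3.
have [r r0 hr] := (openCP _).1 oK z3 Kz3.
have qcst (z : C) : nm (z - z3) < r -> q z = q z3.
  apply: (@local_maxmod R q z3 r) => y yr.
  - exact/cdiff_cont/dq/hr.
  - by move=> _; exact/dq/hr.
  rewrite qz3E; have [h|h] := leP (nm (q y)) B; first exact: le_trans h (ltW B0).
  by apply: qt_max => //; exact: hr.
have z31 : z3 != x1 by apply/eqP => z3x; apply: Kz3; rewrite z3x.
have n31 : 0 < nm (x1 - z3) by rewrite nm_gt0 subr_eq0 eq_sym.
(* a maximizer slightly closer to [x1] *)
pose t := Num.min (1 / 2) (r / (2 * nm (x1 - z3))).
have t0 : 0 < t by rewrite lt_min !divr_gt0// mulr_gt0.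
have [t1 tr] : t <= 1 / 2 /\ t <= r / (2 * nm (x1 - z3)) by rewrite /t !ge_min !lexx orbT.
pose z4 : C := z3 + (t%:C : C) * (x1 - z3).
have z43 : nm (z4 - z3) < r.
  rewrite /z4 addrAC subrr add0r nmM nmR ger0_norm ?ltW//.
  apply: le_lt_trans (ler_wpM2r (ltW n31) tr) _.
  have -> : r / (2 * nm (x1 - z3)) * nm (x1 - z3) = r / 2 by field; rewrite gt_eqF.
  by rewrite ltr_pdivrMr// ltr_pMr// ltr1n.
have z41 : nm (z4 - x1) = (1 - t) * nm (x1 - z3).
  have -> : z4 - x1 = ((1 - t)%:C : C) * (z3 - x1).
    by rewrite /z4 rmorphB/= rmorph1; ring.
  by rewrite nmM nmR ger0_norm ?(nmB z3); lra.
have z4L : nm (z4 - x1) <= nm (z2 - x1).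
  apply: le_trans z3L; rewrite z41 (nmB z3); nra.
have := z3m z4; rewrite z41 (nmB z3) => H.
suff H2 : - nm (x1 - z3) >= - ((1 - t) * nm (x1 - z3)) by nra.
by apply: H; split => //; split; [exact: hr|rewrite qcst].
Qed.

End ExteriorMaximum.

(** * Bottcher's equation for the exterior map *)

Section Bottcher.
Variable R : realType.
Local Notation C := (Cplx R).
Variables (c : C) (phi : C -> C) (alpha : C).
Local Notation f := (quadratic c).
Local Notation K := (filled_julia f).
Hypothesis ext : exterior_map K phi.
Hypothesis Kalpha : K alpha.
Implicit Types z w : C.

Lemma phi_gt1 z : ~ K z -> 1 < nm (phi z).
Proof.
by case: ext => -[h _ _] _ _ _ /(h z) /=; rewrite normE -(ltcR 1).
Qed.

Lemma phi_neq0 z : ~ K z -> phi z != 0.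
Proof. by move=> /phi_gt1 h; rewrite -nm_gt0; apply: lt_trans h. Qed.

Lemma phi_inj z w : ~ K z -> ~ K w -> phi z = phi w -> z = w.
Proof. by case: ext => -[_ h _] _ _ _ Kz Kw; apply: h; exact/mem_set. Qed.

Lemma phi_surj w : 1 < nm w -> exists2 z, ~ K z & phi z = w.
Proof.
case: ext => -[_ _ h] _ _ _ w1; have [|z Kz <-] := h w; last by exists z.
by rewrite /= normE -(ltcR 1) in w1 *.
Qed.

Lemma phi_cdiff z : ~ K z -> cdiff phi z.
Proof. by case: ext => _ h _ _ /h/derivable_cdiff. Qed.

Lemma phi_cont z : ~ K z -> ccont phi z.
Proof. by move=> /phi_cdiff/cdiff_cont. Qed.

Lemma phi_open z (e : R) : ~ K z -> 0 < e -> exists2 d : R, 0 < d &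
  forall w, nm (w - phi z) < d -> exists y, [/\ ~ K y, nm (y - z) < e & phi y = w].
Proof.
move=> Kz e0; have [r r0 hr] := basin_disc Kz.
pose s := Num.min e (r / 2); have s0 : 0 < s by rewrite lt_min e0 divr_gt0.
have [se sr] : s <= e /\ s <= r / 2 by rewrite /s !ge_min !lexx orbT.
have sub (y : C) : nm (y - z) <= s -> ~ K y by move=> ys; apply: hr; lra.
have [||d d0 hd] := @injective_open R phi z s s0.
- by move=> y /sub/phi_cdiff.
- by move=> y /sub Ky; exact: phi_inj.
exists d => // w /hd[y ys yw]; exists y; split => //; first exact/sub/ltW.
exact: lt_le_trans se.
Qed.

Let A := at_infinity phi.
Let a : C := derive1 A 0.

Lemma at_infinity_quotient : exists Q : C -> C, [/\ ccont Q 0, Q 0 = a & forall w, A w = Q w * w].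
Proof.
case: ext => _ _ /derivable_is_cdiff/is_cdiffP[Q [cQ Q0 QE]] _.
exists Q; split => // w; have := QE w; rewrite !subr0.
by rewrite {2}/at_infinity eqxx subr0.
Qed.

Lemma a_gt0 : a != 0 /\ a = ((nm a)%:C : C).
Proof.
have a0 : 0 < (a : R[i]) by case: ext.
split; first by rewrite gt_eqF.
by rewrite -normE gtr0_norm.
Qed.

(** In the coordinate 1/z, phi is injective near infinity, so it covers a neighbourhood of infinity
    by points far away. Injectivity then forbids large values at bounded points. *)
Lemma phi_bounded (M : R) : exists L : R, forall z, ~ K z -> nm z <= M -> nm (phi z) <= L.
Proof.
(* Enlarging the bound is harmless, and it puts all points of modulus at least M outside K. *)
wlog M1 : M / escape_radius c + 1 < M.
  move=> h; pose M' := Num.max M (escape_radius c + 2).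
  have [MM' rM] : M <= M' /\ escape_radius c + 2 <= M' by rewrite !le_max !lexx orbT.
  have [|L hL] := h M'; first lra.
  by exists L => z Kz zM; apply: hL => //; exact: le_trans MM'.
have M0 : 0 < M by have := nm_ge0 c; rewrite /escape_radius in M1; lra.
have far w : nm w <= M^-1 -> w != 0 -> ~ K w^-1.
  move=> wM w0 /filled_julia_bounded.
  have : M <= nm w^-1 by rewrite nmV -[leLHS]invrK lef_pV2 ?posrE ?invr_gt0 ?nm_gt0.
  lra.
have AE w : w != 0 -> A w = (phi w^-1)^-1 by rewrite /A/at_infinity => /negbTE ->.
have A00 : A 0 = 0 by rewrite /A /at_infinity eqxx.
have [|||d d0 hd] := @injective_open R A 0 (M^-1).
- by rewrite invr_gt0.
- move=> w; rewrite subr0 => wM; have [->|w0] := eqVneq w 0.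
    by case: ext => _ _ /derivable_cdiff.
  apply: (@cdiff_near _ (fun w => (phi w^-1)^-1)).
    apply: cdiffV; last by apply: phi_neq0; exact: far.
    by apply: cdiff_comp; [exact: cdiffV (cdiff_id _) w0|apply: phi_cdiff; exact: far].
  apply/nearCP; exists (nm w); first by rewrite nm_gt0.
  by move=> y yw; rewrite AE//; apply: contraTneq yw => ->; rewrite sub0r nmN ltxx.
- move=> w; rewrite subr0 A00 => wM Aw; apply/eqP; apply: contraTT isT => w0.
  by have := phi_neq0 (far w wM w0); rewrite -invr_eq0 -AE// Aw eqxx.
rewrite A00 in hd; exists d^-1 => z Kz zM; rewrite leNgt; apply/negP => dz.
have p0 : 0 < nm (phi z) by apply: lt_trans dz; rewrite invr_gt0.
have [|w wM Aw] := hd (phi z)^-1.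
  by rewrite subr0 nmV -[ltRHS]invrK ltf_pV2 ?posrE ?invr_gt0.
rewrite subr0 in wM.
have w0 : w != 0.
  apply/eqP => w0; move: Aw; rewrite w0 A00 => /esym/eqP.
  by rewrite invr_eq0 -nm_eq0 gt_eqF.
move: Aw; rewrite AE// => /invr_inj /(phi_inj (far w (ltW wM) w0) Kz) wz.
move: zM; rewrite -wz nmV leNgt => /negP; apply.
by rewrite -[ltLHS]invrK ltf_pV2 ?posrE ?invr_gt0 ?nm_gt0.
Qed.

(** Properness. Points tending to z in K with |phi| >= 1 + e would have images clustering at some w
    of modulus > 1. The preimage of w is in the basin, and by [phi_open] the points would cluster
    there, away from z. *)
Lemma phi_to1 z (e : R) : K z -> 0 < e -> exists2 d : R, 0 < d &
  forall y, ~ K y -> nm (y - z) < d -> nm (phi y) < 1 + e.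
Proof.
move=> Kz e0; apply: contrapT => nex.
have /choice[u uP] : forall n : nat, exists y, [/\ ~ K y, nm (y - z) < n.+1%:R^-1 & 1 + e <= nm (phi y)].
  move=> n; apply: contrapT => nn; apply: nex; exists n.+1%:R^-1; first by rewrite invr_gt0.
  by move=> y Ky yz; rewrite ltNge; apply/negP => ye; apply: nn; exists y.
have [L hL] := phi_bounded (nm z + 1).
have uL n : nm (phi (u n)) <= L.
  have [Ku uz _] := uP n; apply: hL => //.
  have n1 : n.+1%:R^-1 <= 1 :> R by rewrite invf_le1// ler1n.
  have := lt_le_trans uz n1; have := nm_lbB (u n) z; lra.
have [w wc] := cluster_seq uL.
have w1 : 1 < nm w.
  have e20 : 0 < e / 2 by rewrite divr_gt0.
  have [n _ nw] := wc (e / 2) e20 0%N.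
  have [_ _ un] := uP n; have := nm_lbB (phi (u n)) w; lra.
have [x Kx xw] := phi_surj w1.
have xz : 0 < nm (x - z) by rewrite nm_gt0 subr_eq0; apply/eqP => xz; apply: Kx; rewrite xz.
have [d d0 hd] := phi_open Kx (divr_gt0 xz (ltr0Sn _ 1)).
pose N := Num.truncn (2 / nm (x - z)).
have [n Nn nw] := wc d d0 N.
have [|y [Ky yx yE]] := hd (phi (u n)); first by rewrite xw.
have [Ku uz _] := uP n; move: yx; rewrite (phi_inj Ky Ku yE) => ux.
have nx : n.+1%:R^-1 <= nm (x - z) / 2.
  rewrite -[leRHS]invrK lef_pV2 ?posrE ?invr_gt0 ?divr_gt0// invf_div.
  apply: le_trans (ltW (truncnS_gt _)) _; by rewrite ler_nat ltnS.
have := lt_le_trans uz nx; have := nmBD x (u n) z; rewrite (nmB x (u n)); lra.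
Qed.

(** The function to be shown equal to 1. Its modulus tends to 1 at K, and its value at infinity is
    the derivative a, which is positive. *)
Let q z : C := phi (f z) / phi z ^+ 2.

Let cdq z : ~ K z -> cdiff q z.
Proof.
move=> Kz; apply: cdiffM.
  by apply: cdiff_comp; [exact: cdiff_quadratic|apply: phi_cdiff; rewrite filled_julia_f].
by apply: cdiffV; [exact/cdiffX/phi_cdiff|rewrite expf_neq0// phi_neq0].
Qed.

Let q_neq0 z : ~ K z -> q z != 0.
Proof.
by move=> Kz; rewrite mulf_neq0 ?invr_eq0 ?expf_neq0 ?phi_neq0 ?filled_julia_f.
Qed.

Let nq z : nm (q z) = nm (phi (f z)) / nm (phi z) ^+ 2.
Proof. by rewrite nmM nmV nmX. Qed.

(* [|q|] tends to [1] at the filled Julia set. *)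
Let q_near z (B : R) : K z -> 1 < B -> exists2 d : R, 0 < d &
  forall y, ~ K y -> nm (y - z) < d -> nm (q y) < B /\ nm (q y)^-1 < B.
Proof.
move=> Kz B1; pose e := Num.min 1 ((B - 1) / 4).
have e0 : 0 < e by rewrite lt_min ltr01 divr_gt0// subr_gt0.
have [e1 eB] : e <= 1 /\ e <= (B - 1) / 4 by rewrite /e !ge_min !lexx orbT.
have [d1 d10 h1] := phi_to1 Kz e0.
have [d2 d20 h2] := @phi_to1 (f z) e ((filled_julia_f c z).2 Kz) e0.
have [d3 d30 h3] := cdiff_cont (cdiff_quadratic c z) d20.
exists (Num.min d1 d3); first by rewrite lt_min d10.
move=> y Ky; rewrite lt_min => /andP[/h1-/(_ Ky) y1 /h3 y3].
have Kfy : ~ K (f y) by rewrite filled_julia_f.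
have {}y3 := h2 _ Kfy y3; have g1 := phi_gt1 Ky; have g2 := phi_gt1 Kfy.
rewrite nmV nq invf_div; set s := nm (phi y) in y1 g1 *; set t := nm (phi (f y)) in y3 g2 *.
have s2 : 0 < s ^+ 2 by rewrite exprn_gt0// (lt_trans ltr01).
rewrite !ltr_pdivrMr//; last exact: lt_trans g2.
have B0 : 0 < B by lra.
have sl : 1 < s ^+ 2 by rewrite expr_gt1// (le_trans ler01 (ltW g1)).
have su : s ^+ 2 < 1 + 3 * e by rewrite expr2; nra.
have h4 : B < B * s ^+ 2 by rewrite ltr_pMr.
have h5 : B < B * t by rewrite ltr_pMr.
split; lra.
Qed.

Let closed_level (p : C -> C) (B : R) : 1 < B -> (forall z, ~ K z -> ccont p z) ->
  (forall z, ~ K z -> nm (p z) = nm (q z) \/ nm (p z) = nm (q z)^-1) ->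
  closed [set z : C | ~ K z /\ B <= nm (p z)].
Proof.
move=> B1 cp pE; apply/closedCP => z zc.
have [Kz|Kz] := pselect (K z).
  have [d d0 hd] := q_near Kz B1; have [y [Ky By] yz] := zc d d0.
  by have [y1 y2] := hd y Ky yz; case: (pE y Ky) => E; rewrite /= E in By; lra.
split => //; apply/ler_addgt0Pr => e e0; have [s s0 hs] := cp z Kz e e0.
have [y [Ky By] yz] := zc s s0; have := hs y yz; have := nm_lbB (p y) (p z); lra.
Qed.

(** With 1 / phi (1/w) = Q(w) w and 1 / f (1/w) = w^2 / u(w), where u(w) = 1 + c w^2, the quotient
    becomes u(w) Q(w)^2 / Q(w^2 / u(w)). It is continuous at 0 with value a^2 / a = a. *)
Let near_infty : exists qt : C -> C, exists s : R, [/\ 0 < s, ccont qt 0, qt 0 = a &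
  forall w, nm w < s -> w != 0 -> ~ K w^-1 /\ qt w = q w^-1].
Proof.
have [Q [cQ Q0 AE]] := at_infinity_quotient; have [a0 _] := a_gt0.
pose u w : C := 1 + c * w ^+ 2.
pose qt w : C := u w * (Q w) ^+ 2 / Q (w ^+ 2 / u w).
have cu : ccont u 0.
  apply: ccontD; first exact: ccont_cst.
  by apply: ccontM; [exact: ccont_cst|exact/cdiff_cont/cdiffX/cdiff_id].
have u0 : u 0 = 1 by rewrite /u expr0n/= mulr0 addr0.
have e0 : 0 = 0 ^+ 2 / u 0 :> C by rewrite expr0n/= mul0r.
have cqt : ccont qt 0.
  apply: ccontM.
    by apply: ccontM => //; rewrite /=; under eq_fun do rewrite expr2; exact: ccontM.
  apply: ccontV; last by rewrite -e0 Q0.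
  apply: (@ccont_comp _ Q (fun w => w ^+ 2 / u w)); last by rewrite -e0.
  apply: ccontM; first exact/cdiff_cont/cdiffX/cdiff_id.
  by apply: ccontV => //; rewrite u0 oner_eq0.
have [s1 s10 h1] := cu 1 ltr01.
have rho0 : 0 < escape_radius c by rewrite /escape_radius; have := nm_ge0 c; lra.
exists qt, (Num.min s1 (escape_radius c)^-1); split => //.
- by rewrite lt_min s10 invr_gt0.
- by rewrite /qt -e0 Q0 u0 mul1r expr2 mulfK.
move=> w; rewrite lt_min => /andP[ws wr] w0.
have Kw : ~ K w^-1.
  move=> /filled_julia_bounded; rewrite nmV leNgt => /negP; apply.
  by rewrite -[ltLHS]invrK ltf_pV2 ?posrE ?invr_gt0 ?nm_gt0.
split => //; have Kfw : ~ K (f w^-1) by rewrite filled_julia_f.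
have uw : u w != 0.
  apply/eqP => uw; have := h1 w; rewrite subr0 => /(_ ws).
  by rewrite uw u0 sub0r nmN nm1 ltxx.
have fE : f w^-1 = (w ^+ 2 / u w)^-1 by rewrite /quadratic /u; field; rewrite w0 uw.
have v0 : w ^+ 2 / u w != 0 by rewrite mulf_neq0 ?invr_eq0 ?expf_neq0.
have A1 : A w = (phi w^-1)^-1 by rewrite /A/at_infinity (negbTE w0).
have A2 : A (w ^+ 2 / u w) = (phi (f w^-1))^-1 by rewrite /A/at_infinity (negbTE v0) -fE.
have p1 : phi w^-1 = (Q w * w)^-1 by rewrite -AE A1 invrK.
have p2 : phi (f w^-1) = (Q (w ^+ 2 / u w) * (w ^+ 2 / u w))^-1 by rewrite -AE A2 invrK.
have := phi_neq0 Kw; have := phi_neq0 Kfw; rewrite p1 p2 !invr_eq0 !mulf_eq0 !negb_or.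
move=> /andP[Q2 _] /andP[Q1 _].
by rewrite /q p1 p2 /qt; field; rewrite Q1 Q2 w0 uw.
Qed.

(** The maximum principle for q and for 1/q gives |q| = 1, so q is locally constant. At infinity its
    value is a, positive of modulus 1, hence 1. The set where q differs from 1 is then bounded and
    open with boundary in K, so it is empty. *)
Lemma phi_f z : ~ K z -> phi (f z) = phi z ^+ 2.
Proof.
have [qt [s [s0 cqt qt0 hqt]]] := near_infty.
have oK := @basin_open R c; have [a0 aE] := a_gt0.
have q1 w : ~ K w -> nm (q w) <= 1.
  apply: (maxmod_ext oK Kalpha cdq s0 hqt cqt) => B B1.
  by apply: closed_level => // y Ky; [exact/cdiff_cont/cdq|left].
have q2 w : ~ K w -> nm (q w)^-1 <= 1.
  apply: (@maxmod_ext _ K alpha (fun w => (q w)^-1) (fun w => (qt w)^-1) s 1 oK Kalpha) => //.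
  - by move=> y Ky; apply: cdiffV; [exact: cdq|exact: q_neq0].
  - by move=> y ys y0; have [? ->] := hqt y ys y0.
  - by apply: ccontV => //; rewrite qt0.
  move=> B B1; apply: closed_level => // y Ky; last by right.
  by apply/cdiff_cont/cdiffV; [exact: cdq|exact: q_neq0].
have qn w : ~ K w -> nm (q w) = 1.
  move=> Kw; apply/eqP; rewrite eq_le q1//=; have := q2 w Kw.
  by rewrite nmV invf_le1// nm_gt0 q_neq0.
have na : nm a = 1.
  apply/eqP; rewrite -subr_eq0 -normr_le0; apply/ler_addgt0Pr => e e0; rewrite add0r.
  have [t t0 ht] := cqt e e0.
  pose r := Num.min s t / 2; have r0 : 0 < r by rewrite divr_gt0// lt_min s0.
  have [rs rt] : r < s /\ r < t.
    by rewrite /r; split; have : Num.min s t <= s /\ Num.min s t <= t by [rewrite !ge_min !lexx orbT]; lra.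
  have nr : nm (r%:C : C) = r by rewrite nmR ger0_norm// ltW.
  have [||Kr qr] := hqt (r%:C : C); first by rewrite nr.
    by rewrite -nm_gt0 nr.
  have := ht (r%:C : C); rewrite subr0 nr qr qt0 => /(_ rt) /ltW.
  apply: le_trans; have := nm_lbB (q (r%:C)^-1) a; have := nm_lbB a (q (r%:C)^-1).
  by rewrite qn// (nmB a) ler_norml => ? ?; apply/andP; split; lra.
have a1 : a = 1 by rewrite aE na.
suff qE w : ~ K w -> q w = 1.
  by move=> Kz; have := qE z Kz; rewrite /q => /divr1_eq.
pose Z := [set w : C | ~ K w /\ q w <> 1].
suff Z0 v : ~ Z v by move=> Kw; apply: contrapT => qw; exact: (Z0 w).
have loc v' : ~ K v' -> q v' = 1 -> exists2 r : R, 0 < r & forall y : C, nm (y - v') < r -> q y = 1.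
  move=> Kv qv; have [r r0 hr] := basin_disc Kv; exists r => // y yr; rewrite -qv.
  apply: (@local_maxmod R q v' r) yr => u ur.
  - exact/cdiff_cont/cdq/hr.
  - by move=> _; exact/cdq/hr.
  by rewrite !qn//; exact: hr.
have qt1 u' : nm u' < s -> qt u' = 1.
  move=> ws; rewrite -a1 -qt0.
  have dqt (y : C) : nm (y - 0) < s -> y != 0 -> cdiff qt y.
    rewrite subr0 => ys y0; have [Ky _] := hqt y ys y0.
    apply: (@cdiff_near _ (fun x => q x^-1)).
      by apply: cdiff_comp; [exact: cdiffV (cdiff_id _) y0|exact: cdq].
    apply/nearCP; exists (Num.min (nm y) (s - nm y)).
      by rewrite lt_min nm_gt0 y0 subr_gt0.
    move=> u; rewrite lt_min => /andP[uy us].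
    have [||_ ->//] := hqt u.
      by have := nm_lbB u y; lra.
    by apply: contraTneq uy => ->; rewrite sub0r nmN ltxx.
  apply: (@local_maxmod R qt 0 s); rewrite ?subr0//.
  - move=> y ys; have [->//|y0] := eqVneq y 0; apply: cdiff_cont; exact: dqt.
  move=> y; rewrite subr0 => ys; have [->//|y0] := eqVneq y 0.
  have [Ky yE] := hqt y ys y0; by rewrite yE qt0 na qn.
apply: (@no_bounded_piece R c Z s^-1).
- apply/openCP => y [Ky qy]; have [r r0 hr] := basin_disc Ky.
  have qy0 : 0 < nm (q y - 1) by rewrite nm_gt0 subr_eq0; apply/eqP.
  have [t t0 ht] := cdiff_cont (cdq Ky) qy0.
  exists (Num.min r t); first by rewrite lt_min r0.
  move=> u; rewrite lt_min => /andP[/hr Ku /ht ut]; split => // qu.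
  by move: ut; rewrite qu nmB ltxx.
- by move=> y [].
- move=> y [Ky qy]; rewrite leNgt; apply/negP => ys; apply: qy.
  have y0 : 0 < nm y by apply: lt_trans ys; rewrite invr_gt0.
  have yi : nm y^-1 < s by rewrite nmV -[ltRHS]invrK ltf_pV2 ?posrE ?invr_gt0.
  have [|_ E] := hqt y^-1 yi; first by rewrite invr_eq0 -nm_gt0.
  by rewrite -(invrK y) -E qt1.
move=> y yc; have [Ky|Ky] := pselect (K y); first by right.
left; split => // qy; have [r r0 hr] := loc y Ky qy.
by have [u [_ qu] /hr uy] := yc r r0.
Qed.

End Bottcher.

(** * External rays *)

Section Angles.
Variable R : realType.
Local Notation C := (Cplx R).
Implicit Types x y t : R.

Lemma expiE x : expi2pi x = cis (2 * pi * x) :> C.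
Proof. by []. Qed.

Lemma expiD x y : expi2pi (x + y) = expi2pi x * expi2pi y :> C.
Proof. by rewrite !expiE mulrDr cisD. Qed.

Lemma expi1 : expi2pi 1 = 1 :> C.
Proof. by rewrite expiE mulr1 -[2 * pi]add0r cis_2pi cis0. Qed.

Lemma expi_half : expi2pi (1 / 2) = -1 :> C.
Proof.
rewrite expiE (_ : 2 * pi * (1 / 2) = pi); last by field.
by rewrite /cis cospi sinpi; apply/eqP; rewrite eq_complex/= oppr0 !eqxx.
Qed.

Lemma expi_nat x (n : nat) : expi2pi (x + n%:R) = expi2pi x :> C.
Proof.
elim: n => [|n IH]; first by rewrite addr0.
by rewrite -natr1 addrA expiD expi1 mulr1.
Qed.

Lemma expi_int x (k : int) : expi2pi (x + k%:~R) = expi2pi x :> C.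
Proof.
case: k => n; first exact: expi_nat.
by rewrite NegzE rmorphN/= -{2}(subrK n.+1%:R x) expi_nat.
Qed.

Lemma nm_expi x : nm (expi2pi x : C) = 1.
Proof. by rewrite expiE nm_cis. Qed.

Lemma expi_eq1 x : 0 < x < 1 -> expi2pi x != 1 :> C.
Proof.
move=> /andP[x0 x1]; apply/eqP => h.
have : cos (2 * pi * x) = 1 by have := congr1 (@complex.Re R) h.
rewrite (_ : 2 * pi * x = (pi * x) *+ 2); last by rewrite mulr2n; ring.
have s0 : 0 < sin (pi * x).
  have pi0 := pi_gt0 R; rewrite sin_gt0_pi//.
  by rewrite mulr_gt0//= gtr_pMr.
by rewrite cos_mulr2n cos2sin2 => h1; have : 0 < sin (pi * x) ^+ 2 by [rewrite exprn_gt0]; lra.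
Qed.

Lemma expi_inj x y : expi2pi x = expi2pi y :> C -> `|x - y| < 1 -> x = y.
Proof.
wlog xy : x y / x <= y.
  move=> h E xy; have [/h|/ltW yx] := leP x y; first exact.
  by symmetry; apply: h => //; rewrite distrC.
move=> E d; apply/eqP; rewrite eq_le xy leNgt; apply/negP => xy'.
have h : 0 < y - x < 1 by move: d; rewrite ltr_norml => /andP[? ?]; apply/andP; split; lra.
have := expi_eq1 h; rewrite -(inj_eq (mulfI (_ : (expi2pi x : C) != 0))).
  by rewrite -expiD mulr1 addrC subrK E eqxx.
by rewrite -nm_gt0 nm_expi.
Qed.

Lemma radial_ex (w : C) : w != 0 -> exists2 x, 0 <= x < 1 & w = radial x (nm w).
Proof.
move=> w0; have [v /andP[v0 v1] wE] := pol_ex w0; have pi0 := pi_gt0 R.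
have p2 : 0 < 2 * pi :> R by rewrite mulr_gt0.
exists (v / (2 * pi)).
  by rewrite divr_ge0 ?(ltW p2)//= ltr_pdivrMr// mul1r.
rewrite {1}wE /pol /radial lnK ?posrE ?nm_gt0// expiE; congr (_ * cis _).
by rewrite mulrC divfK// gt_eqF.
Qed.

End Angles.

Section Rays.
Variable R : realType.
Local Notation C := (Cplx R).
Variables (c : C) (phi : C -> C) (alpha : C).
Local Notation f := (quadratic c).
Local Notation K := (filled_julia f).
Hypothesis ext : exterior_map K phi.
Hypothesis Kalpha : K alpha.
Implicit Types (z w p : C) (t x r : R).

Definition psi : C -> C := exterior_inv K phi.
Definition ray t r : C := psi (radial t r).

Lemma phiK z : ~ K z -> psi (phi z) = z.
Proof.
by move=> Kz; rewrite /psi /exterior_inv pinvKV ?inE//; case: ext => -[].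
Qed.

Lemma psiP w : 1 < nm w -> ~ K (psi w) /\ phi (psi w) = w.
Proof. by move=> /(phi_surj ext)[z Kz <-]; rewrite phiK. Qed.

Lemma psi_inj w w' : 1 < nm w -> 1 < nm w' -> psi w = psi w' -> w = w'.
Proof. by move=> /psiP[_ {2}<-] /psiP[_ {2}<-] ->. Qed.

Lemma psi_cont w : 1 < nm w -> ccont psi w.
Proof.
move=> w1 e e0; have [Kz zw] := psiP w1; have [d d0 hd] := phi_open ext Kz e0.
exists d => // w' w'w; have [|y [Ky yz <-]] := hd w'; first by rewrite zw.
by rewrite phiK.
Qed.

Lemma psi_sqr w : 1 < nm w -> psi (w ^+ 2) = f (psi w).
Proof.
move=> w1; have [Kz zw] := psiP w1; rewrite -{1}zw -(phi_f ext Kalpha Kz) phiK//.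
by rewrite filled_julia_f.
Qed.

(** phi (-z) and phi z have the same square, and injectivity excludes equality because -z differs
    from z. *)
Lemma phiN z : ~ K z -> z != 0 -> phi (- z) = - phi z.
Proof.
move=> Kz z0; have KNz : ~ K (- z) by rewrite filled_juliaN.
have : phi (- z) ^+ 2 = phi z ^+ 2.
  by rewrite -!(phi_f ext Kalpha)// /quadratic sqrrN.
move=> /eqP; rewrite eqf_sqr => /predU1P[/(phi_inj ext KNz Kz) zE|/eqP//].
move: z0; rewrite -subr_eq0 subr0; have : z + z == 0 by rewrite -{1}zE addNr.
by rewrite -mulr2n mulrn_eq0/= => ->.
Qed.

(** If 0 escaped, phi would be odd and continuous near 0, so phi 0 = 0, against |phi| > 1. *)
Lemma filled_julia0 : K 0.
Proof.
apply: contrapT => K0; have [r r0 hr] := basin_disc K0.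
have p0 := phi_neq0 ext K0; have n0 : 0 < nm (phi 0) by rewrite nm_gt0.
have [d d0 hd] := phi_cont ext K0 n0.
pose s := Num.min d r / 2; have m0 : 0 < Num.min d r by rewrite lt_min d0.
have s0 : 0 < s by rewrite divr_gt0.
have [sd sr] : s < d /\ s < r.
  by rewrite /s; split; have : Num.min d r <= d /\ Num.min d r <= r by [rewrite !ge_min !lexx orbT]; lra.
have ns : nm (s%:C : C) = s by rewrite nmR ger0_norm// ltW.
have Ks : ~ K (s%:C : C) by apply: hr; rewrite subr0 ns.
have := hd (s%:C : C); rewrite subr0 ns => /(_ sd).
have := hd (- (s%:C : C)); rewrite subr0 nmN ns => /(_ sd).
rewrite phiN//; last by rewrite -nm_gt0 ns.
move=> h1 h2; have := nmD (- phi (s%:C : C) - phi 0) (phi (s%:C : C) - phi 0).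
have -> : - phi (s%:C : C) - phi 0 + (phi (s%:C : C) - phi 0) = - (2%:R * phi 0) by ring.
by rewrite nmN nmM nmZn; lra.
Qed.

Lemma psiN w : 1 < nm w -> psi (- w) = - psi w.
Proof.
move=> w1; have [Kz zw] := psiP w1.
have z0 : psi w != 0 by apply/eqP => z0; apply: Kz; rewrite z0; exact: filled_julia0.
by rewrite -{1}zw -phiN// phiK// filled_juliaN.
Qed.

Lemma psi_infty (M : R) : exists2 L : R, 1 < L & forall w, L < nm w -> M < nm (psi w).
Proof.
have [L hL] := phi_bounded ext M; exists (Num.max 2 L); first by rewrite lt_max ltr1n.
move=> w; rewrite gt_max => /andP[w2 Lw].
have [Kz zw] := psiP (lt_trans (ltr1n _ 2) w2).
rewrite ltNge; apply/negP => /(hL _ Kz); rewrite zw; lra.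
Qed.

Lemma nm_radial t r : 0 <= r -> nm (radial t r : C) = r.
Proof. by move=> r0; rewrite /radial nmM nm_expi mulr1 nmR ger0_norm. Qed.

Lemma ray_basin t r : 1 < r -> ~ K (ray t r).
Proof. by move=> r1; have [] := @psiP (radial t r); rewrite ?nm_radial//; lra. Qed.

Lemma ray_int t r (k : int) : ray (t + k%:~R) r = ray t r.
Proof. by rewrite /ray /radial expi_int. Qed.

Lemma ray1 t r : ray (t + 1) r = ray t r.
Proof. exact: (ray_int t r 1). Qed.

Lemma ray_half t r : 1 < r -> ray (t + 1 / 2) r = - ray t r.
Proof.
move=> r1; rewrite /ray -psiN ?nm_radial//; last lra.
by rewrite /radial expiD expi_half mulrN1 mulrN.
Qed.

Lemma ray_double t r : 1 < r -> ray (2 * t) (r ^+ 2) = f (ray t r).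
Proof.
move=> r1; rewrite /ray -psi_sqr ?nm_radial//; last lra.
by congr psi; rewrite /radial mulr2n mulrDl mul1r expiD rmorphXn/=; ring.
Qed.

Lemma ray_inj t t' r r' : 1 < r -> 1 < r' -> ray t r = ray t' r' -> `|t - t'| < 1 -> t = t'.
Proof.
move=> r1 r1' /psi_inj E; have {}E := E _ _.
have {}E : radial t r = radial t' r' :> C by apply: E; rewrite nm_radial//; lra.
have rr : r = r' by rewrite -(@nm_radial t r) ?E ?nm_radial//; lra.
apply: expi_inj; move: E; rewrite /radial rr; apply: mulfI.
by rewrite -nm_gt0 nmR gtr0_norm; lra.
Qed.

Lemma ray_ex a z : ~ K z -> exists x r, [/\ a <= x < a + 1, 1 < r & z = ray x r].
Proof.
move=> Kz; have := phi_gt1 ext Kz; set r := nm (phi z) => r1.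
have [x0 _ E] := radial_ex (phi_neq0 ext Kz).
pose k := Num.floor (x0 - a).
exists (x0 - k%:~R), r; split => //.
  have := floor_le (x0 - a); have := floorD1_gt (x0 - a).
  by rewrite -/k rmorphD/= => ? ?; apply/andP; split; lra.
by rewrite -rmorphN/= ray_int /ray -E phiK.
Qed.

Definition lands t p : Prop := K p /\ forall e : R, 0 < e ->
  exists2 d : R, 0 < d & forall r, 1 < r -> r < 1 + d -> nm (ray t r - p) < e.

Lemma lands_int t p (k : int) : lands t p -> lands (t + k%:~R) p.
Proof.
move=> [Kp lp]; split=> // e /lp[d d0 hd]; exists d => // r r1 r2.
by rewrite ray_int; exact: hd.
Qed.

Lemma lands1 t p : lands t p -> lands (t + 1) p.
Proof. exact: (@lands_int t p 1). Qed.

Lemma lands_half t p : lands t p -> lands (t + 1 / 2) (- p).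
Proof.
move=> [Kp lp]; split=> [|e /lp[d d0 hd]]; first by rewrite filled_juliaN.
by exists d => // r r1 r2; rewrite ray_half// -opprD nmN -[- p]opprK opprK; exact: hd.
Qed.

Lemma lands_double t p : lands t p -> lands (2 * t) (f p).
Proof.
move=> [Kp lp]; split=> [|e e0]; first by rewrite filled_julia_f.
have [s s0 hs] := cdiff_cont (cdiff_quadratic c p) e0.
have [d d0 hd] := lp s s0; exists d => // r r1 r2.
have r0 : 0 <= r by lra.
have sr1 : 1 < Num.sqrt r by rewrite -[X in X < _]sqrtr1 ltr_sqrt// (lt_trans ltr01).
rewrite -(sqr_sqrtr r0) ray_double//; apply/hs/hd => //.
by have := sqr_sqrtr r0; nra.
Qed.

Lemma lands_uniq t p p' : lands t p -> lands t p' -> p = p'.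
Proof.
move=> [_ lp] [_ lp']; apply/eqP; rewrite -subr_eq0 -nm_eq0 eq_le nm_ge0 andbT.
apply/ler_addgt0Pr => e e0; rewrite add0r.
have e20 : 0 < e / 2 by rewrite divr_gt0.
have [d d0 hd] := lp _ e20; have [d' d0' hd'] := lp' _ e20.
pose r := 1 + Num.min d d' / 2; have m0 : 0 < Num.min d d' by rewrite lt_min d0.
have [md md'] : Num.min d d' <= d /\ Num.min d d' <= d' by rewrite !ge_min !lexx orbT.
have r1 : 1 < r by rewrite /r; lra.
have h4 : nm (ray t r - p) < e / 2 by apply: hd => //; rewrite /r; lra.
have h5 : nm (ray t r - p') < e / 2 by apply: hd' => //; rewrite /r; lra.
have := nmBD p (ray t r) p'; rewrite (nmB p (ray t r)); lra.
Qed.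

Lemma lands_rays t t' p p' : lands t p -> lands t' p' -> p <> p' -> forall k : int, t' <> t + k%:~R.
Proof.
move=> lt lt' pp' k tt'; apply: pp'; apply: lands_uniq lt' ; rewrite tt'.
exact: lands_int.
Qed.

End Rays.

(** * Square roots off a ray *)

Section PrincipalRoot.
Variable R : realType.
Local Notation C := (Cplx R).
Implicit Types (w v : C).

(** The principal square root, meant for Re w > 0; [s] is its real part. *)
Definition csq w : C := let s := Num.sqrt ((nm w + complex.Re w) / 2) in
  s +i* (complex.Im w / (2 * s)).

Lemma csqP w : 0 < complex.Re w ->
  [/\ csq w * csq w = w, 0 < complex.Re (csq w) & `|complex.Im (csq w)| < complex.Re (csq w)].
Proof.
move=> w0; rewrite /csq; set s := Num.sqrt _.
have n0 := nm_ge0 w; have n2 := nm_sqr w.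
have s2 : s ^+ 2 = (nm w + complex.Re w) / 2 by rewrite sqr_sqrtr//; lra.
have s0 : 0 < s by rewrite sqrtr_gt0; lra.
have sn : s != 0 by rewrite gt_eqF.
set y := complex.Im w / (2 * s).
have ys : y * s = complex.Im w / 2 by rewrite /y; field.
have y2 : y ^+ 2 = (nm w - complex.Re w) / 2.
  apply: (mulIf (expf_neq0 2 sn)); rewrite -exprMn ys s2.
  have -> : (complex.Im w / 2) ^+ 2 = complex.Im w ^+ 2 / 4 by field.
  have -> : complex.Im w ^+ 2 = nm w ^+ 2 - complex.Re w ^+ 2 by rewrite n2; ring.
  by field.
split => //=.
  have -> : w = (s ^+ 2 - y ^+ 2) +i* (2 * (y * s)) :> C.
    rewrite s2 y2 ys; case: (w) => a b; apply/eqP; rewrite eq_complex/=.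
    by apply/andP; split; apply/eqP; field.
  apply/eqP; rewrite eq_complex/= !expr2; apply/andP; split; apply/eqP; ring.
rewrite -ltr_sqr ?nnegrE ?(ltW s0)// real_normK ?num_real// y2 s2; lra.
Qed.

(** The two sides agree up to sign. Both factors on the right have argument less than pi / 4 in
    modulus, so their product has positive real part, as has the left-hand side. *)
Lemma csqM w v : 0 < complex.Re w -> 0 < complex.Re v -> 0 < complex.Re (w * v : C) ->
  csq (w * v) = csq w * csq v.
Proof.
move=> w0 v0 wv0; have [w2 wR wI] := csqP w0; have [v2 vR vI] := csqP v0.
have [p2 pR _] := csqP wv0.
have : csq (w * v) ^+ 2 = (csq w * csq v) ^+ 2 by rewrite !expr2 p2 mulrACA w2 v2.
move/eqP; rewrite eqf_sqr => /predU1P[//|/eqP E].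
have : 0 < complex.Re (csq w * csq v : C).
  rewrite cReM subr_gt0; apply: le_lt_trans (ler_norm _) _; rewrite normrM.
  by apply: ltr_pM.
by move: pR; rewrite E cReN oppr_gt0 => h1 /(lt_trans h1); rewrite ltxx.
Qed.

Lemma csq_cont w : 0 < complex.Re w -> ccont csq w.
Proof.
move=> w0 e e0; have [w2 wR wI] := csqP w0.
have d0 : 0 < Num.min (complex.Re w / 2) (e * complex.Re (csq w)).
  by rewrite lt_min divr_gt0//= mulr_gt0.
exists (Num.min (complex.Re w / 2) (e * complex.Re (csq w))) => // v.
rewrite lt_min => /andP[v1 v2].
have v0 : 0 < complex.Re v.
  have := Re_le_nm (v - w); rewrite cReD cReN ler_norml => /andP[]; lra.
have [vv vR vI] := csqP v0.
(* [sqrt v - sqrt w = (v - w) / (sqrt v + sqrt w)] *)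
have E : v - w = (csq v - csq w) * (csq v + csq w) by rewrite -{1}vv -{1}w2; ring.
have s0 : complex.Re (csq w) < nm (csq v + csq w).
  apply: lt_le_trans (Re_le_nm _); apply: lt_le_trans (ler_norm _).
  by rewrite cReD ltrDr.
rewrite -(ltr_pM2r wR); apply: le_lt_trans v2; rewrite E nmM.
by rewrite ler_wpM2l ?nm_ge0// ltW.
Qed.

Lemma Re_gt0_near1 w : nm (w - 1) < 1 -> 0 < complex.Re w.
Proof.
move=> h; have := Re_le_nm (w - 1); rewrite cReD cReN/= ler_norml => /andP[]; lra.
Qed.

End PrincipalRoot.

(** * Continuous square roots along a path *)

Section PathRoot.
Variable R : realType.
Local Notation C := (Cplx R).
Variable M : R -> C.
Hypothesis cM : continuous M.

(** If M t = 1 / (x_t - w0) and z is measured from w0, this is (x_t - z) / (x_t - w0), which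
    vanishes exactly when the path passes through the point. A path coming from infinity simply has
    M = 0 there. *)
Let P (z : C) (t : R) : C := 1 - z * M t.

Definition path_compl : set C := [set z | forall t : R, 0 <= t <= 1 -> P z t != 0].

Definition fine_steps (n : nat) (z : C) : Prop := path_compl z /\
  forall t t' : R, 0 <= t <= 1 -> 0 <= t' <= 1 -> `|t - t'| <= 2 ^- n ->
    0 < complex.Re (P z t / P z t' : C).

(** The ratio P z 1 / P z 0 telescopes over a dyadic subdivision. For fine steps each factor is in
    the right half-plane and has a principal root; by [csqM] refining the subdivision does not
    change the product. *)
Definition dyadic_root (n : nat) (z : C) : C :=
  \prod_(j < 2 ^ n) csq (P z (j.+1%:R / 2 ^+ n) / P z (j%:R / 2 ^+ n)).

Let frac_itv (j n : nat) : (j <= 2 ^ n)%N -> 0 <= (j%:R / 2 ^+ n : R) <= 1.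
Proof.
move=> jn; rewrite divr_ge0 ?exprn_ge0//= ler_pdivrMr ?exprn_gt0// mul1r.
by rewrite -natrX ler_nat.
Qed.

Lemma fine_stepsS n z : fine_steps n z -> fine_steps n.+1 z.
Proof.
move=> [Pz h]; split=> // t t' t1 t1' tt; apply: h => //; apply: le_trans tt _.
by rewrite lef_pV2 ?posrE ?exprn_gt0// exprS ler_peMl ?exprn_ge0// ler1n.
Qed.

Lemma dyadic_rootS n z : fine_steps n z -> dyadic_root n.+1 z = dyadic_root n z.
Proof.
move=> [Pz h].
pose F (m : nat) (j : nat) := csq (P z (j.+1%:R / 2 ^+ m) / P z (j%:R / 2 ^+ m)).
have pairs (N : nat) (G : nat -> C) : \prod_(j < N * 2) G j = \prod_(j < N) (G (j * 2)%N * G (j * 2).+1).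
  by elim: N => [|N IH]; rewrite ?big_ord0// mulSn !addSn add0n !big_ord_recr/= IH mulrA.
rewrite /dyadic_root expnSr (pairs _ (F n.+1)); apply: eq_bigr => j _.
have q0 : (2 ^+ n : R) != 0 by rewrite expf_neq0.
have e0 : (j * 2)%N%:R / 2 ^+ n.+1 = j%:R / 2 ^+ n :> R by rewrite exprSr natrM; field.
have e2 : (j * 2).+2%:R / 2 ^+ n.+1 = j.+1%:R / 2 ^+ n :> R.
  by rewrite (_ : (j * 2).+2 = j.+1 * 2)%N// exprSr natrM; field.
rewrite /F e0 e2; set t0 := j%:R / 2 ^+ n; set t2 := j.+1%:R / 2 ^+ n.
set t1 := (j * 2).+1%:R / 2 ^+ n.+1.
have t01 : t1 - t0 = 2 ^- n.+1.
  by rewrite /t1 /t0 -e0 -mulrBl -natr1 addrAC subrr add0r mul1r.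
have t12 : t2 - t1 = 2 ^- n.+1.
  by rewrite /t1 /t2 -e2 -mulrBl -natr1 addrAC subrr add0r mul1r.
have u0 : 0 < 2 ^- n.+1 :> R by rewrite invr_gt0 exprn_gt0.
have un : 2 ^- n = 2 * 2 ^- n.+1 :> R by rewrite exprS invfM mulrA divff ?mul1r.
have jn := ltn_ord j.
have i0 : 0 <= t0 <= 1 by apply: frac_itv; exact: ltnW.
have i2 : 0 <= t2 <= 1 by exact: frac_itv.
have i1 : 0 <= t1 <= 1.
  by move: i0 i2 => /andP[? ?] /andP[? ?]; apply/andP; split; lra.
have E : P z t2 / P z t0 = (P z t2 / P z t1) * (P z t1 / P z t0).
  by have := Pz _ i0; have := Pz _ i1 => ? ?; field; apply/andP; split.
rewrite mulrC E (@csqM _ (P z t2 / P z t1) (P z t1 / P z t0))// -?E; apply: h => //; rewrite ger0_norm; lra.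
Qed.

Lemma dyadic_root_stable n m z : (n <= m)%N -> fine_steps n z ->
  fine_steps m z /\ dyadic_root m z = dyadic_root n z.
Proof.
move=> nm0 hn; elim: m nm0 => [|m IH]; first by rewrite leqn0 => /eqP <-.
rewrite leq_eqVlt => /predU1P[<-//|]; rewrite ltnS => /IH[hm <-].
by split; [exact: fine_stepsS|exact: dyadic_rootS].
Qed.

Lemma dyadic_root_sqr n z : fine_steps n z ->
  dyadic_root n z * dyadic_root n z = P z 1 / P z 0.
Proof.
move=> [Pz h]; rewrite /dyadic_root.
have -> : P z 1 / P z 0 = P z ((2 ^ n)%N%:R / 2 ^+ n) / P z 0.
  by rewrite natrX divff// expf_neq0.
pose S N := \prod_(j < N) csq (P z (j.+1%:R / 2 ^+ n) / P z (j%:R / 2 ^+ n)).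
suff key N : (N <= 2 ^ n)%N -> S N * S N = P z (N%:R / 2 ^+ n) / P z 0 by exact: key.
rewrite /S; elim: N => [_|N IH Nn].
  by rewrite big_ord0 mul1r mul0r divff// Pz// lexx ler01.
have i0 : 0 <= (N%:R / 2 ^+ n : R) <= 1 by apply: frac_itv; exact: ltnW.
have i1 : 0 <= (N.+1%:R / 2 ^+ n : R) <= 1 by exact: frac_itv.
rewrite big_ord_recr/= mulrACA IH ?(ltnW Nn)//.
have hR : 0 < complex.Re (P z (N.+1%:R / 2 ^+ n) / P z (N%:R / 2 ^+ n) : C).
  by apply: h => //; rewrite -mulrBl -natr1 addrAC subrr add0r mul1r ger0_norm ?invr_ge0 ?exprn_ge0.
have [-> _ _] := csqP hR.
have := Pz _ i0; have := Pz 0; rewrite lexx ler01 => /(_ isT) ? ?.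
by field; apply/andP; split.
Qed.

Let cP (z : C) (x : R) : ccont (fun z => P z x) z.
Proof.
apply: ccontB; first exact: ccont_cst.
by apply: ccontM; [exact: ccont_id|exact: ccont_cst].
Qed.

Lemma dyadic_root_cont n z : fine_steps n z -> ccont (dyadic_root n) z.
Proof.
move=> [Pz h]; rewrite /dyadic_root.
suff key N : (N <= 2 ^ n)%N -> ccont (fun z =>
    \prod_(j < N) csq (P z (j.+1%:R / 2 ^+ n) / P z (j%:R / 2 ^+ n))) z by exact: key.
elim: N => [_|N IH Nn].
  by under eq_fun do rewrite big_ord0; exact: ccont_cst.
have i0 : 0 <= (N%:R / 2 ^+ n : R) <= 1 by apply: frac_itv; exact: ltnW.
have i1 : 0 <= (N.+1%:R / 2 ^+ n : R) <= 1 by exact: frac_itv.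
under eq_fun do rewrite big_ord_recr/=.
apply: ccontM; first exact/IH/ltnW.
pose g (y : C) : C := P y (N.+1%:R / 2 ^+ n) / P y (N%:R / 2 ^+ n).
have cg : ccont g z by apply: ccontM; [exact: cP|apply: ccontV; [exact: cP|exact: Pz]].
have ccs : ccont (@csq R) (g z).
  apply: csq_cont; apply: h => //.
  by rewrite -mulrBl -natr1 addrAC subrr add0r mul1r ger0_norm ?invr_ge0 ?exprn_ge0.
exact: (ccont_comp cg ccs).
Qed.

Let path_bound : exists2 B : R, 0 < B & forall t : R, 0 <= t <= 1 -> nm (M t) <= B.
Proof.
have [||t0 _ h] := @EVT_max R (fun t => nm (M t)) 0 1; first exact: ler01.
  apply: continuous_subspaceT => x; apply: (@continuous_comp _ _ _ M (@nm R)); [exact: cM|exact: cont_nm].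
exists (nm (M t0) + 1); first by have := nm_ge0 (M t0); lra.
by move=> t t01; have := h t; rewrite in_itv/= => /(_ t01); lra.
Qed.

Let path_unif (e : R) : 0 < e -> exists n, forall t t' : R, 0 <= t <= 1 -> 0 <= t' <= 1 ->
  `|t - t'| <= 2 ^- n -> nm (M t - M t') < e.
Proof.
move=> e0; apply: contrapT => nex.
have /choice[u uP] : forall n, exists tt : R * R, [/\ 0 <= tt.1 <= 1, 0 <= tt.2 <= 1,
    `|tt.1 - tt.2| <= 2 ^- n & e <= nm (M tt.1 - M tt.2)].
  move=> n; apply: contrapT => nn; apply: nex; exists n => t t' t1 t1' tt.
  by rewrite ltNge; apply/negP => h; apply: nn; exists (t, t').
have uB n : nm (((u n).1)%:C : C) <= 1.
  by have [/andP[a b] _ _ _] := uP n; rewrite nmR ger0_norm.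
have [w wc] := cluster_seq uB; set x := complex.Re w.
have e20 : 0 < e / 2 by rewrite divr_gt0.
have [d d0 hd] := (contRCP M x).1 (@cM x) _ e20.
have d20 : 0 < d / 2 by rewrite divr_gt0.
have [n nd nw] := wc (d / 2) d20 (Num.truncn (2 / d)).+1.
have [_ _ ut ue] := uP n.
have h1 : `|(u n).1 - x| < d / 2.
  by apply: le_lt_trans nw; have := Re_le_nm (((u n).1)%:C - w); rewrite cReD cReN.
have h2 : 2 ^- n <= d / 2 :> R.
  rewrite -[leRHS]invrK lef_pV2 ?posrE ?invr_gt0 ?exprn_gt0// invf_div.
  apply: le_trans (ltW (truncnS_gt _)) _; rewrite -natrX ler_nat.
  by apply: leq_trans nd _; apply: ltnW; exact: ltn_expl.
have h3 : `|(u n).2 - x| < d.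
  have -> : (u n).2 - x = ((u n).1 - x) - ((u n).1 - (u n).2) by ring.
  apply: le_lt_trans (ler_normB _ _) _; have := le_trans ut h2; lra.
have h4 := hd (u n).1 _; have h5 := hd _ h3.
have {}h4 : nm (M (u n).1 - M x) < e / 2 by apply: h4; lra.
have := nmBD (M (u n).1) (M x) (M (u n).2); rewrite (nmB (M x) (M (u n).2)); lra.
Qed.

(** |P z0 t| is bounded below on [0, 1] and M is uniformly continuous, so one n works for all z near
    z0: ratios of neighbouring values are within 1 of 1. *)
Lemma fine_steps_near (z0 : C) : path_compl z0 -> exists n, exists2 r : R, 0 < r &
  forall z : C, nm (z - z0) < r -> fine_steps n z.
Proof.
move=> Pz0.
have [||t0 t01 h] := @EVT_max R (fun t => - nm (P z0 t)) 0 1; first exact: ler01.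
  apply: continuous_subspaceT => x; apply/cvgrPdist_lt => e e0.
  have n0 : 0 < nm z0 + 1 by have := nm_ge0 z0; lra.
  have [d d0 hd] := (contRCP M x).1 (@cM x) _ (divr_gt0 e0 n0).
  apply/nearRP; exists d => // y /hd; rewrite ltr_pdivlMr// => yx.
  have E : P z0 x - P z0 y = z0 * (M y - M x) by rewrite /P; ring.
  have h1 := nm_lbB (P z0 x) (P z0 y); have h2 := nm_lbB (P z0 y) (P z0 x).
  move: h1 h2; rewrite (nmB (P z0 y)) E nmM => h1 h2.
  have := nm_ge0 (M y - M x) => h3.
  by rewrite ltr_norml; apply/andP; split; nra.
pose m := nm (P z0 t0).
have m0 : 0 < m by rewrite nm_gt0 Pz0//; move: t01; rewrite in_itv.
have mP (t : R) : 0 <= t <= 1 -> m <= nm (P z0 t).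
  by move=> t1; have := h t; rewrite in_itv/= => /(_ t1); rewrite lerN2.
have [B B0 hB] := path_bound.
have e0 : 0 < m / (2 * (nm z0 + 1)) by rewrite divr_gt0// mulr_gt0// ltr_wpDl// nm_ge0.
have [n hn] := path_unif e0; exists n.
exists (Num.min 1 (m / (2 * B))); first by rewrite lt_min ltr01 divr_gt0// mulr_gt0.
move=> z; rewrite lt_min => /andP[z1 zm].
have zP (t : R) : 0 <= t <= 1 -> m / 2 < nm (P z t).
  move=> t1; have := nm_lbB (P z0 t) (P z t).
  have -> : P z0 t - P z t = (z - z0) * M t by rewrite /P; ring.
  rewrite nmM => h1; have := mP t t1.
  have : nm (z - z0) * nm (M t) < m / 2.
    apply: (@le_lt_trans _ _ (nm (z - z0) * B)); first by rewrite ler_wpM2l ?nm_ge0// hB.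
    have -> : m / 2 = m / (2 * B) * B by field; rewrite gt_eqF.
    by rewrite ltr_pM2r.
  lra.
split=> [t t1|t t' t1 t1' tt].
  by rewrite -nm_gt0; apply: lt_trans (zP t t1); rewrite divr_gt0.
have p0 : 0 < nm (P z t') by apply: lt_trans (zP t' t1'); rewrite divr_gt0.
have p0' : P z t' != 0 by rewrite -nm_gt0.
apply: Re_gt0_near1.
have -> : P z t / P z t' - 1 = z * (M t' - M t) / P z t'.
  by apply: (mulIf p0'); rewrite mulrBl !divfK// /P; ring.
rewrite nmM nmV ltr_pdivrMr// mul1r; apply: lt_trans (zP t' t1').
rewrite nmM; have nz : nm z < nm z0 + 1 by have := nm_lbB z z0; lra.
have := hn t' t t1' t1; rewrite distrC => /(_ tt).
rewrite ltr_pdivlMr; last by rewrite mulr_gt0// ltr_wpDl// nm_ge0.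
have := nm_ge0 (M t' - M t); have := nm_ge0 z => h1 h2 h3; nra.
Qed.

(* Lifting the path [t |-> P z t] through the squaring map gives a root depending continuously
   on [z]. *)
Lemma path_root : open path_compl /\ exists S : C -> C, forall z : C, path_compl z ->
  ccont S z /\ S z * S z = P z 1 / P z 0.
Proof.
split.
  by apply/openCP => z /fine_steps_near[n [r r0 hr]]; exists r => // y /hr[].
(* The depth chosen depends on z, but [dyadic_root_stable] makes the value independent of it, so
   near each point one fixed depth computes [S]. *)
pose S (z : C) : C := if pselect (exists n, fine_steps n z) is left h
  then dyadic_root (projT1 (cid h)) z else 0.
have SE n z : fine_steps n z -> S z = dyadic_root n z.
  move=> hn; rewrite /S; case: pselect => [h|[]]; last by exists n.
  case: cid => /= m hm.
  have [_ <-] := dyadic_root_stable (leq_maxl m n) hm.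
  by have [_ <-] := dyadic_root_stable (leq_maxr m n) hn.
exists S => z /fine_steps_near[n [r r0 hr]].
have hz : fine_steps n z by apply: hr; rewrite subrr nm0.
split; last by rewrite (SE n)// dyadic_root_sqr.
move=> e /(dyadic_root_cont hz)[d d0 hd]; exists (Num.min r d); first by rewrite lt_min r0.
move=> y; rewrite lt_min => /andP[/hr hy /hd]; by rewrite !(SE n).
Qed.

End PathRoot.

Section SignFunctions.
Variable R : realType.
Local Notation C := (Cplx R).

Lemma contRC_comp (F : C -> C) (h : R -> C) (x : R) : {for x, continuous h} -> ccont F (h x) ->
  {for x, continuous (fun t => F (h t))}.
Proof.
move=> /contRCP ch cF; apply/contRCP => e /cF[d d0 hd].
by have [s s0 hs] := ch d d0; exists s => // y /hs /hd.
Qed.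

Lemma cont_cis (h : R -> R) (x : R) : {for x, continuous h} ->
  {for x, continuous (fun t => cis (h t))}.
Proof.
by move=> ch; apply: cont_cplx2; apply: (continuous_comp ch);
  [exact: continuous_cos|exact: continuous_sin].
Qed.

Lemma pm1_const (g : R -> C) (x y : R) : x <= y ->
  (forall t : R, x <= t <= y -> {for t, continuous g} /\ (g t = 1 \/ g t = -1)) -> g x = g y.
Proof.
move=> xy h; apply: contrapT => gxy.
have [||t tI] := @IVT R (fun s => complex.Re (g s)) x y 0 xy.
- apply: continuous_in_subspaceT => s /set_mem/=; rewrite in_itv/= => /h[cs _].
  by apply: (continuous_comp cs); exact: cont_Re.
- have hx : x <= x <= y by rewrite lexx.
  have hy : x <= y <= y by rewrite lexx andbT.
  case: (h x hx).2 gxy => ->; case: (h y hy).2 => -> //= _;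
  by rewrite ge_min le_max ?oppr_le0 ?ler01 ?orbT.
move: tI; rewrite in_itv/= => /h[_ [] ->] /= /eqP; rewrite ?oppr_eq0 oner_eq0//.
Qed.

(** Around the unit circle about p, the ratio of S to s e^(iv/2) is continuous with values 1 and -1,
    starts at 1 and ends at -1. This winding argument is what distinguishes the two sides of a ray
    pair. *)
Lemma no_root (p k : C) (S : C -> C) : k != 0 ->
  (forall z : C, z != p -> ccont S z /\ S z * S z = k * (z - p)) -> False.
Proof.
move=> k0 hS; have pi0 := pi_gt0 R.
have circ v : p + cis v != p.
  by rewrite -subr_eq0 addrAC subrr add0r -nm_gt0 nm_cis.
have c0 v : cis v != 0 :> C by rewrite -nm_gt0 nm_cis.
pose s := S (p + cis 0).
have s2 : s * s = k by rewrite (hS _ (circ 0)).2 cis0 addrAC subrr add0r mulr1.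
have s0 : s != 0 by apply: contraNneq k0 => s0; rewrite -s2 s0 mul0r.
pose g v := S (p + cis v) / (s * cis (v / 2)).
have g0 : g 0 = 1 by rewrite /g mul0r cis0 mulr1 -{1}cis0 divff.
have g2 : g (2 * pi) = -1.
  have -> : g (2 * pi) = s / (s * cis pi).
    rewrite /g -{1}[2 * pi]add0r cis_2pi; congr (_ / (_ * cis _)).
    by field.
  rewrite invfM mulrA divff// mul1r.
  have -> : cis pi = -1 :> C by rewrite /cis cospi sinpi; apply/eqP; rewrite eq_complex/= oppr0 !eqxx.
  by rewrite invrN1.
have g02 : g 0 = g (2 * pi).
  apply: pm1_const; first by rewrite mulr_ge0// ltW.
  move=> v _; split.
    have cS : {for v, continuous (fun v => S (p + cis v))}.
      apply: (@contRC_comp (fun w => S (p + w)) (fun v => cis v)).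
        by apply: (@cont_cis id); exact: cvg_id.
      apply: (@ccont_comp R S (fun w => p + w)).
        by apply: ccontD; [exact: ccont_cst|exact: ccont_id].
      exact: (hS _ (circ v)).1.
    have cd : {for v, continuous (fun v : R => (s * cis (v / 2))^-1)}.
      apply: (@contRC_comp (fun w => (s * w)^-1) (fun v => cis (v / 2))).
        by apply: cont_cis; apply: cvgM; [exact: cvg_id|exact: cvg_cst].
      apply: ccontV; last by rewrite mulf_neq0.
      by apply: ccontM; [exact: ccont_cst|exact: ccont_id].
    exact: (cvgM cS cd).
  have : g v ^+ 2 = 1.
    rewrite /g expr2 mulrACA (hS _ (circ v)).2 addrAC subrr add0r -invfM.
    have -> : s * cis (v / 2) * (s * cis (v / 2)) = k * cis v.
      by rewrite mulrACA s2 -cisD -splitr.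
    by rewrite divff// mulf_neq0.
  by move=> /eqP; rewrite sqrf_eq1 => /orP[] /eqP; [left|right].
move: g02; rewrite g0 g2 => /eqP; rewrite -subr_eq0 opprK -nm_eq0.
by rewrite -[1 + 1]/(2%:R : C) nmZn pnatr_eq0.
Qed.

End SignFunctions.

(** * The square root attached to a landing ray *)

Section Sides.
Variable R : realType.
Local Notation C := (Cplx R).
Variables (c : C) (phi : C -> C) (alpha : C).
Local Notation f := (quadratic c).
Local Notation K := (filled_julia f).
Hypothesis ext : exterior_map K phi.
Hypothesis Kalpha : K alpha.
Local Notation ray := (ray c phi).
Local Notation lands := (lands c phi).

Lemma ray_continuous (g h : R -> R) (x : R) : {for x, continuous g} -> {for x, continuous h} ->
  1 < h x -> {for x, continuous (fun s => ray (g s) (h s))}.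
Proof.
move=> cg ch hx; have cr : {for x, continuous (fun s => radial (g s) (h s) : C)}.
  have -> : (fun s => radial (g s) (h s) : C) =
      fun s => (h s * cos (2 * pi * g s)) +i* (h s * sin (2 * pi * g s)).
    apply/funext => s; rewrite /radial expiE /cis; apply/eqP.
    by rewrite eq_complex/= !mul0r subr0 addr0 !eqxx.
  have c2 : {for x, continuous (fun s => 2 * pi * g s)}.
    by apply: cvgM => //; exact: cvg_cst.
  apply: cont_cplx2; apply: cvgM => //.
    by apply: (continuous_comp c2); exact: continuous_cos.
  by apply: (continuous_comp c2); exact: continuous_sin.
have n1 : 1 < nm (radial (g x) (h x) : C) by rewrite nm_radial//; lra.
apply/contRCP => e /(psi_cont ext n1)[d d0 hd].
by have [s s0 hs] := (contRCP _ _).1 cr d d0; exists s => // y /hs /hd.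
Qed.

Definition ray_set (t : R) : set C := [set z | exists2 r : R, 1 < r & z = ray t r].

Section RayRoot.
Variables (t : R) (p w0 : C).
Hypothesis tp : lands t p.
Hypothesis w0p : w0 != p.
Hypothesis w0t : ~ ray_set t w0.

(* The ray with its two ends, read in the coordinate [1 / (z - w0)]. *)
Definition ray_path (s : R) : C :=
  if s <= 0 then 0 else if 1 <= s then (p - w0)^-1 else (ray t s^-1 - w0)^-1.

(** The ends carry the content: s = 0 uses that the ray goes to infinity, s = 1 that it lands at
    p. *)
Lemma ray_path_continuous : continuous ray_path.
Proof.
have pw : p - w0 != 0 by rewrite subr_eq0 eq_sym.
move=> s; apply/contRCP => e e0.
have [s0|s0|s0] := ltgtP s 0.
- exists (- s); first by rewrite oppr_gt0.
  move=> y; rewrite ltr_norml => /andP[_ ys]; rewrite /ray_path (ltW s0).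
  have -> : y <= 0 by lra.
  by rewrite subrr nm0.
- have [s1|s1|s1] := ltgtP s 1.
  + have si : 1 < s^-1 by rewrite invf_gt1.
    have rw : ray t s^-1 - w0 != 0.
      by rewrite subr_eq0; apply/eqP => rw; apply: w0t; exists s^-1.
    have cv : ccont (fun z => (z - w0)^-1) (ray t s^-1).
      by apply: ccontV => //; apply: ccontB; [exact: ccont_id|exact: ccont_cst].
    have [d d0 hd] := cv e e0.
    have cr : {for s, continuous (fun y : R => ray t y^-1)}.
      apply: (@ray_continuous (fun=> t) (fun y : R => y^-1)) => //; first exact: cvg_cst.
      by apply: cvgV; [rewrite gt_eqF|exact: cvg_id].
    have [u u0 hu] := (contRCP _ _).1 cr d d0.
    exists (Num.min u (Num.min s (1 - s))); first by rewrite !lt_min u0 s0 subr_gt0.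
    move=> y; rewrite !lt_min => /and3P[/hu yu]; rewrite !ltr_norml => /andP[y1 _] /andP[_ y2].
    have y0 : (y <= 0) = false by apply/negbTE; rewrite -ltNge; lra.
    have y1' : (1 <= y) = false by apply/negbTE; rewrite -ltNge; lra.
    have s0' : (s <= 0) = false by apply/negbTE; rewrite -ltNge.
    have s1' : (1 <= s) = false by apply/negbTE; rewrite -ltNge.
    by rewrite /ray_path y0 y1' s0' s1'; exact: hd.
  + exists (s - 1); first by rewrite subr_gt0.
    move=> y; rewrite ltr_norml => /andP[ys _]; rewrite /ray_path.
    have -> : (y <= 0) = false by apply/negbTE; rewrite -ltNge; lra.
    have -> : 1 <= y by lra.
    have -> : (s <= 0) = false by apply/negbTE; rewrite -ltNge.
    by rewrite (ltW s1) subrr nm0.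
  + rewrite s1.
    have cv : ccont (fun z => (z - w0)^-1) p.
      by apply: ccontV => //; apply: ccontB; [exact: ccont_id|exact: ccont_cst].
    have [d d0 hd] := cv e e0; have [u u0 hu] := tp.2 d d0.
    have u1 : 0 < u / (1 + u) by rewrite divr_gt0// addr_gt0.
    exists (Num.min (1 / 2) (u / (1 + u))); first by rewrite lt_min u1 divr_gt0.
    move=> y; rewrite lt_min !ltr_norml => /andP[/andP[y2 _] /andP[y1 _]].
    rewrite /ray_path.
    have -> : (y <= 0) = false by apply/negbTE; rewrite -ltNge; lra.
    have -> : ((1 : R) <= 0) = false by rewrite ler10.
    rewrite lexx; case: (leP 1 y) => /= y3; first by rewrite subrr nm0.
    have y0 : 0 < y by lra.
    apply: hd; apply: hu; first by rewrite invf_gt1.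
    have E : (1 + u)^-1 = 1 - u / (1 + u) by field; rewrite gt_eqF// addr_gt0.
    by rewrite -[ltRHS]invrK ltf_pV2 ?posrE ?invr_gt0 ?addr_gt0// E; lra.
- have [L L1 hL] := psi_infty ext (nm w0 + e^-1).
  exists (Num.min (1 / 2) L^-1); first by rewrite lt_min divr_gt0// invr_gt0; lra.
  move=> y; rewrite s0 subr0 lt_min !ltr_norml => /andP[/andP[_ y2] /andP[_ y1]].
  rewrite /ray_path lexx; case: (leP y 0) => /= y0; first by rewrite subrr nm0.
  have -> : (1 <= y) = false by apply/negbTE; rewrite -ltNge; lra.
  have Ly : L < y^-1 by rewrite -[ltLHS]invrK ltf_pV2 ?posrE ?invr_gt0//; lra.
  rewrite subr0 nmV.
  have := hL (radial t y^-1); rewrite nm_radial ?invr_ge0 ?(ltW y0)// => /(_ Ly) h.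
  have h1 : e^-1 < nm (ray t y^-1 - w0).
    by have := nm_lbB (ray t y^-1) w0; rewrite /ray; move: h; lra.
  rewrite -[ltRHS]invrK ltf_pV2 ?posrE ?invr_gt0//.
  by apply: lt_trans h1; rewrite invr_gt0.
Qed.

(** The square of the root involves p and w0 but not the ray, so two rays landing at p yield roots
    that differ by a sign. *)
Lemma ray_root : open [set z : C | ~ ray_set t z /\ z != p] /\
  exists S : C -> C, forall z : C, ~ ray_set t z -> z != p ->
    ccont S z /\ S z * S z = (p - z) / (p - w0).
Proof.
have pw : p - w0 != 0 by rewrite subr_eq0 eq_sym.
have [oP [S hS]] := path_root ray_path_continuous.
have PE z : path_compl ray_path (z - w0) <-> ~ ray_set t z /\ z != p.
  split=> [h|[zt zp] s /andP[s0 s1]].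
    split=> [[r r1 zr]|].
      have ri : 0 <= r^-1 <= 1.
        by rewrite invr_ge0 invf_le1 ?(ltW r1)//= ?andbT; lra.
      have := h _ ri; rewrite /ray_path.
      have -> : (r^-1 <= 0) = false by apply/negbTE; rewrite -ltNge invr_gt0; lra.
      have -> : (1 <= r^-1) = false by apply/negbTE; rewrite -ltNge invf_lt1//; lra.
      rewrite invrK -zr divff ?subrr ?eqxx// subr_eq0; apply/eqP => zw.
      by apply: w0t; exists r => //; rewrite -zw.
    apply/eqP => zp; have := h 1; rewrite ler01 lexx => /(_ isT); rewrite /ray_path ler10 lexx.
    by rewrite zp divff// subrr eqxx.
  rewrite /ray_path; case: (leP s 0) => /= [_|s0']; first by rewrite mulr0 subr0 oner_eq0.
  case: (leP 1 s) => /= s1'.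
    rewrite subr_eq0 eq_sym; apply/eqP => /divr1_eq /addIr zp'.
    by rewrite zp' eqxx in zp.
  have rw : ray t s^-1 - w0 != 0.
    by rewrite subr_eq0; apply/eqP => rw; apply: w0t; exists s^-1; rewrite ?invf_gt1.
  rewrite subr_eq0 eq_sym; apply/eqP => /divr1_eq /addIr zs.
  by apply: zt; exists s^-1; rewrite ?invf_gt1.
split.
  apply/openCP => z /PE /((openCP _).1 oP)[r r0 hr]; exists r => // y yz.
  by apply/PE; apply: hr; rewrite opprB addrA subrK.
exists (fun z => S (z - w0)) => z zt zp.
have /hS[cS SE] : path_compl ray_path (z - w0) by apply/PE.
split.
  apply: (@ccont_comp R S (fun z => z - w0)) cS.
  by apply: ccontB; [exact: ccont_id|exact: ccont_cst].
rewrite SE /ray_path lexx ler10 lexx mulr0 subr0 divr1.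
by field.
Qed.

End RayRoot.

End Sides.

(** * The two sides of a ray pair *)

Section SidesOfRayPair.
Variable R : realType.
Local Notation C := (Cplx R).
Variables (c : C) (phi : C -> C) (alpha : C).
Local Notation f := (quadratic c).
Local Notation K := (filled_julia f).
Hypothesis ext : exterior_map K phi.
Hypothesis Kalpha : K alpha.
Local Notation ray := (ray c phi).
Local Notation lands := (lands c phi).
Local Notation ray_set := (ray_set c phi).
Implicit Types (a b x r : R) (p z : C) (I O : set C).

Definition ray_pair a b p : set C := [set z | ray_set a z \/ ray_set b z \/ z = p].

(** Connectedness of I and O is not part of the notion: the open partition off the ray pair and the
    position of all other rays are what the later arguments use. *)
Record sides a b p I O : Prop := Sides {
  sides_openI : open I;
  sides_openO : open O;
  sides_disj : forall z, I z -> O z -> False;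
  sides_cover : forall z, I z \/ O z \/ ray_pair a b p z;
  sides_IG : forall z, I z -> ~ ray_pair a b p z;
  sides_OG : forall z, O z -> ~ ray_pair a b p z;
  sides_I : forall x r, a < x < b -> 1 < r -> I (ray x r);
  sides_O : forall x r, b < x < a + 1 -> 1 < r -> O (ray x r) }.

Lemma sector_const (lo hi : R) (g : C -> C) :
  (forall x r, lo < x < hi -> 1 < r -> ccont g (ray x r) /\ (g (ray x r) = 1 \/ g (ray x r) = -1)) ->
  forall x r x' r', lo < x < hi -> lo < x' < hi -> 1 < r -> 1 < r' -> g (ray x r) = g (ray x' r').
Proof.
move=> hg.
have cst (u v : R -> R) (s t : R) : s <= t -> continuous u -> continuous v ->
    (forall y, s <= y <= t -> lo < u y < hi /\ 1 < v y) ->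
    g (ray (u s) (v s)) = g (ray (u t) (v t)).
  move=> st cu cv huv; apply: (@pm1_const R (fun y => g (ray (u y) (v y)))) => // y /huv[uy vy].
  have [cg ?] := hg _ _ uy vy; split => //.
  by apply: (contRC_comp (ray_continuous ext (cu y) (cv y) vy)).
have cstx x x' r : x <= x' -> lo < x < hi -> lo < x' < hi -> 1 < r -> g (ray x r) = g (ray x' r).
  move=> xx /andP[x1 x2] /andP[x1' x2'] r1.
  apply: (cst id (fun=> r)) => //; [by move=> ?; exact: cvg_id|by move=> ?; exact: cvg_cst|].
  by move=> y /andP[? ?]; split=> //; apply/andP; split; lra.
have cstr x r r' : r <= r' -> lo < x < hi -> 1 < r -> g (ray x r) = g (ray x r').
  move=> rr xx r1; apply: (cst (fun=> x) id) => //.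
  - by move=> ?; exact: cvg_cst.
  - by move=> ?; exact: cvg_id.
  by move=> y /andP[? ?]; split=> //=; lra.
move=> x r x' r' xl xl' r1 r1'.
transitivity (g (ray x r')).
  by have [h|/ltW h] := leP r r'; [exact: cstr|symmetry; exact: cstr].
by have [h|/ltW h] := leP x x'; [exact: cstx|symmetry; exact: cstx].
Qed.

Lemma ray_set_basin t z : ray_set t z -> ~ K z.
Proof. by move=> [r r1 ->]; exact: ray_basin. Qed.

Lemma ray_setP t x r : 1 < r -> ray_set t (ray x r) -> `|x - t| < 1 -> x = t.
Proof. by move=> r1 [r' r1' E]; exact: (ray_inj ext r1 r1' E). Qed.

Lemma basin_angle a b z : a < b < a + 1 -> ~ K z -> [\/ ray_set a z, ray_set b z,
  exists x r, [/\ a < x < b, 1 < r & z = ray x r] |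
  exists x r, [/\ b < x < a + 1, 1 < r & z = ray x r]].
Proof.
move=> /andP[ab ba] Kz; have [x [r [/andP[ax xa] r1 zE]]] := ray_ex ext a Kz.
have [x0|x0|x0] := ltgtP x a; first lra.
- have [x1|x1|x1] := ltgtP x b.
  + by constructor 3; exists x, r; split => //; apply/andP.
  + by constructor 4; exists x, r; split => //; apply/andP.
  + by constructor 2; exists r; rewrite -?x1.
- by constructor 1; exists r; rewrite -?x0.
Qed.

(** The quotient g of the two roots is continuous with values 1 and -1 off the ray pair, and I is
    the set where it has the sign taken between a and b. It is constant on each of the two angular
    sectors; equal signs would let the roots be glued to a root of a multiple of z - p around p,
    against [no_root]. *)
Lemma sides_ex a b p : a < b < a + 1 -> lands a p -> lands b p -> exists I O, sides a b p I O.
Proof.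
move=> abI la lb; have /andP[ab ba] := abI; have Kp := la.1.
pose m := (a + b) / 2; have mab : a < m < b by apply/andP; rewrite /m; split; lra.
have r2 : (1 : R) < 2 by rewrite ltr1n.
pose w0 := ray m 2.
have nab x r t : 1 < r -> t < x < t + 1 -> ~ ray_set t (ray x r).
  move=> r1 /andP[tx xt] /(ray_setP r1) => h.
  by have : x = t by [apply: h; rewrite gtr0_norm; lra]; lra.
have nba x r t : 1 < r -> t - 1 < x < t -> ~ ray_set t (ray x r).
  move=> r1 /andP[tx xt] /(ray_setP r1) => h.
  by have : x = t by [apply: h; rewrite ltr0_norm; lra]; lra.
have w0a : ~ ray_set a w0 by apply: nab => //; apply/andP; rewrite /m; split; lra.
have w0b : ~ ray_set b w0 by apply: nba => //; apply/andP; rewrite /m; split; lra.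
have w0p : w0 != p by apply/eqP => w0p; apply: (ray_basin (t:=m) ext r2); rewrite -/w0 w0p.
have [oa [Sa hSa]] := ray_root ext la w0p w0a.
have [ob [Sb hSb]] := ray_root ext lb w0p w0b.
have pw : p - w0 != 0 by rewrite subr_eq0 eq_sym.
have nG z : ~ ray_pair a b p z -> [/\ ~ ray_set a z, ~ ray_set b z & z != p].
  by move=> nz; split; [| |apply/eqP]; move=> h; apply: nz; [left|right; left|right; right].
have k0 z : z != p -> (p - z) / (p - w0) != 0.
  by move=> zp; rewrite mulf_neq0 ?invr_eq0// subr_eq0 eq_sym.
have Sb0 z : ~ ray_set b z -> z != p -> Sb z != 0.
  move=> zb zp; apply: contraNneq (k0 z zp) => S0.
  by rewrite -(hSb z zb zp).2 S0 mul0r.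
pose g z : C := Sa z / Sb z.
have g2 z : ~ ray_pair a b p z -> g z = 1 \/ g z = -1.
  move=> /nG[za zb zp]; have : g z ^+ 2 = 1.
    rewrite /g expr_div_n !expr2 (hSa z za zp).2 (hSb z zb zp).2 divff//; exact: k0.
  by move/eqP; rewrite sqrf_eq1 => /orP[] /eqP; [left|right].
have cg z : ~ ray_pair a b p z -> ccont g z.
  move=> /nG[za zb zp]; apply: ccontM; first exact: (hSa z za zp).1.
  by apply: ccontV; [exact: (hSb z zb zp).1|exact: Sb0].
have gnear z : ~ ray_pair a b p z -> exists2 s : R, 0 < s & forall y : C, nm (y - z) < s ->
    ~ ray_pair a b p y /\ g y = g z.
  move=> nz; have [za zb zp] := nG z nz.
  have [s1 s10 h1] := (openCP _).1 oa z (conj za zp).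
  have [s2 s20 h2] := (openCP _).1 ob z (conj zb zp).
  have [s3 s30 h3] := cg z nz _ ltr01.
  exists (Num.min s1 (Num.min s2 s3)); first by rewrite !lt_min s10 s20.
  move=> y; rewrite !lt_min => /and3P[/h1[ya yp] /h2[yb _] /h3 gy].
  have ny : ~ ray_pair a b p y by move=> [|[|/eqP]]//; exact/negP.
  split=> //; move: gy; case: (g2 y ny) => ->; case: (g2 z nz) => -> //.
    by rewrite opprK (_ : 1 + 1 = 2%:R :> C)// nmZn ltNge ler1n.
  by rewrite -opprD nmN (_ : 1 + 1 = 2%:R :> C)// nmZn ltNge ler1n.
have Gx x r : a < x < b -> 1 < r -> ~ ray_pair a b p (ray x r).
  move=> /andP[ax xb] r1 [|[|xp]].
  - by apply: nab => //; apply/andP; split; lra.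
  - by apply: nba => //; apply/andP; split; lra.
  - by apply: (ray_basin (t:=x) ext r1); rewrite xp.
have Gx' x r : b < x < a + 1 -> 1 < r -> ~ ray_pair a b p (ray x r).
  move=> /andP[ax xb] r1 [|[|xp]].
  - by apply: nab => //; apply/andP; split; lra.
  - by apply: nab => //; apply/andP; split; lra.
  - by apply: (ray_basin (t:=x) ext r1); rewrite xp.
have cI x r : a < x < b -> 1 < r -> g (ray x r) = g w0.
  move=> xI r1; apply: (@sector_const a b g) => //.
  by move=> y s yI s1; split; [exact/cg/Gx|exact/g2/Gx].
have cO x r x' r' : b < x < a + 1 -> b < x' < a + 1 -> 1 < r -> 1 < r' ->
    g (ray x r) = g (ray x' r').
  apply: sector_const => y s yI s1.
  by split; [exact/cg/Gx'|exact/g2/Gx'].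
have gO x r : b < x < a + 1 -> 1 < r -> g (ray x r) <> g w0.
  move=> xO r1 gx.
  have all_eq z : ~ K z -> ~ ray_set a z -> ~ ray_set b z -> g z = g w0.
    move=> Kz za zb; case: (basin_angle abI Kz) => // -[y [s [yI s1 ->]]]; first exact: cI.
    by rewrite -gx; exact: cO.
  have e2 : g w0 * g w0 = 1.
    have nw0 : ~ ray_pair a b p w0 by exact: Gx.
    by case: (g2 w0 nw0) => ->; rewrite ?mulrNN mulr1.
  have zab z : ray_set a z -> ~ ray_set b z.
    by move=> [s s1 ->]; apply: nba => //; apply/andP; split; lra.
  have SaE z : ~ ray_set b z -> z != p -> Sa z = g z * Sb z.
    by move=> zb zp; rewrite /g divfK// Sb0.
  (* Across the ray of angle a the other root, with the common sign, continues [Sa]. *)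
  pose S z : C := if pselect (ray_set a z) then g w0 * Sb z else Sa z.
  apply: (@no_root R p (- (p - w0)^-1) S); first by rewrite oppr_eq0 invr_eq0.
  move=> z zp; have [za|za] := pselect (ray_set a z); last first.
    split; last first.
      by rewrite /S; case: pselect => //= _; rewrite (hSa z za zp).2 -[p - z]opprB; ring.
    have [s1 s10 h1] := (openCP _).1 oa z (conj za zp).
    move=> e e0; have [d d0 hd] := (hSa z za zp).1 e e0.
    exists (Num.min s1 d); first by rewrite lt_min s10.
    move=> y; rewrite lt_min => /andP[/h1[ya _] /hd]; rewrite /S.
    by case: pselect => //= _; case: pselect.
  have zb := zab z za; have Kz := ray_set_basin za.
  split; last first.
    rewrite /S; case: pselect => //= _; rewrite mulrACA e2 mul1r (hSb z zb zp).2 -[p - z]opprB; ring.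
  have [s1 s10 h1] := (openCP _).1 ob z (conj zb zp).
  have [s2 s20 h2] := basin_disc Kz.
  move=> e e0; have cS : ccont (fun y => g w0 * Sb y) z.
    by apply: ccontM; [exact: ccont_cst|exact: (hSb z zb zp).1].
  have [d d0 hd] := cS e e0.
  exists (Num.min (Num.min s1 s2) d); first by rewrite !lt_min s10 s20.
  move=> y; rewrite !lt_min => /andP[/andP[/h1[yb yp] /h2 Ky] /hd]; rewrite /S.
  case: (pselect (ray_set a z)) => //= _; case: (pselect (ray_set a y)) => //= ya.
  by rewrite (SaE y yb yp) (all_eq y Ky ya yb).
exists [set z | ~ ray_pair a b p z /\ g z = g w0], [set z | ~ ray_pair a b p z /\ g z <> g w0].
split.
- apply/openCP => z [nz gz]; have [s s0 hs] := gnear z nz; exists s => // y /hs[ny gy].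
  by split => //; rewrite gy.
- apply/openCP => z [nz gz]; have [s s0 hs] := gnear z nz; exists s => // y /hs[ny gy].
  by split => //; rewrite gy.
- by move=> z [_ gz] [_]; exact.
- move=> z; have [|nz] := pselect (ray_pair a b p z); first by right; right.
  by have [gz|gz] := pselect (g z = g w0); [left|right; left].
- by move=> z [].
- by move=> z [].
- by move=> x r xI r1; split; [exact: Gx|exact: cI].
- by move=> x r xI r1; split; [exact: Gx'|exact: gO].
Qed.

End SidesOfRayPair.

(** * Comparing sides of different ray pairs through their angles *)

Section SideRelations.
Variable R : realType.
Local Notation C := (Cplx R).
Variables (c : C) (phi : C -> C) (alpha : C).
Local Notation f := (quadratic c).
Local Notation K := (filled_julia f).
Hypothesis ext : exterior_map K phi.
Hypothesis Kalpha : K alpha.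
Local Notation ray := (ray c phi).
Local Notation lands := (lands c phi).
Local Notation ray_set := (ray_set c phi).
Local Notation ray_pair := (ray_pair c phi).
Local Notation sides := (sides c phi).
Implicit Types (a b x r t : R) (p z : C) (I O U V G : set C).

(** U is closed relative to the complement of G. For open U this means clopen off G. *)
Definition relcl U G : Prop :=
  forall z, (forall e : R, 0 < e -> exists2 y, U y & nm (y - z) < e) -> U z \/ G z.

Lemma relclI U V G : relcl U G -> relcl V G -> relcl (U `&` V) G.
Proof.
move=> hU hV z hz; have [|Uz|] := hU z; last by right.
  by move=> e /hz[y [Uy _] yz]; exists y.
have [|Vz|] := hV z; last by right.
  by move=> e /hz[y [_ Vy] yz]; exists y.
by left.
Qed.

Lemma relcl_mono U G G' : G `<=` G' -> relcl U G -> relcl U G'.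
Proof. by move=> GG hU z /hU[Uz|/GG Gz]; [left|right]. Qed.

Lemma relcl_preimage U G : relcl U G -> relcl (f @^-1` U) (f @^-1` G).
Proof.
move=> hU z hz; apply: hU => e e0.
have [d d0 hd] := cdiff_cont (cdiff_quadratic c z) e0.
by have [y Uy yz] := hz d d0; exists (f y) => //; exact: hd.
Qed.

Lemma open_preimage U : open U -> open (f @^-1` U).
Proof.
move=> /openCP oU; apply/openCP => z Uz; have [r r0 hr] := oU _ Uz.
have [d d0 hd] := cdiff_cont (cdiff_quadratic c z) r0.
by exists d => // y /hd /hr.
Qed.

Lemma avoid_seq (s : seq R) (x r : R) : 0 < r -> exists2 t, 0 < t < r & x + t \notin s.
Proof.
elim: s r => [|y s IH] r r0.
  by exists (r / 2) => //; apply/andP; split; lra.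
pose r' := if x < y then Num.min r (y - x) else r.
have r'0 : 0 < r' by rewrite /r'; case: ifP => xy //; rewrite lt_min r0 subr_gt0.
have [t /andP[t0 tr] ts] := IH r' r'0; exists t.
  rewrite t0 /=; apply: lt_le_trans tr _; rewrite /r'; case: ifP => // _.
  by rewrite ge_min lexx.
rewrite inE negb_or ts andbT; apply/eqP => xty; move: tr; rewrite /r' -xty.
by rewrite ltrDl t0 addrAC subrr add0r lt_min ltxx andbF.
Qed.

(* Two sets that are clopen off a set meeting [K] in finitely many points are disjoint as soon
   as they are disjoint in the basin: no bounded open set has a finite boundary, as one sees on
   a vertical line avoiding that boundary. *)
Lemma disjoint_ext U V G (F : seq C) : open U -> open V -> relcl U G -> relcl V G ->
  (forall z, G z -> K z -> z \in F) ->
  (forall z, ~ K z -> U z -> V z -> False) -> forall z, U z -> V z -> False.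
Proof.
move=> /openCP oU /openCP oV cU cV GF UV z0 Uz0 Vz0.
have ZK z : U z -> V z -> K z by move=> Uz Vz; apply: contrapT => /UV; exact.
have oZ z : U z -> V z -> exists2 r : R, 0 < r & forall y, nm (y - z) < r -> U y /\ V y.
  move=> /oU[r r0 hr] /oV[s s0 hs]; exists (Num.min r s); first by rewrite lt_min r0.
  by move=> y; rewrite lt_min => /andP[/hr ? /hs].
have [r r0 hr] := oZ z0 Uz0 Vz0.
have [t /andP[t0 tr] tF] := avoid_seq (map (@complex.Re R) F) (complex.Re z0) r0.
pose L y : C := (complex.Re z0 + t) +i* y.
pose S := [set y : R | U (L y) /\ V (L y)].
have S0 : S !=set0.
  exists (complex.Im z0); apply: hr; rewrite /L.
  rewrite (_ : _ - z0 = (t%:C : C)) ?nmR ?gtr0_norm//.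
  case: (z0) => u v; apply/eqP; rewrite eq_complex/= addrAC subrr add0r.
  by rewrite subrr !eqxx.
have Sub : ubound S (escape_radius c).
  move=> y [Uy Vy]; have := filled_julia_bounded (ZK _ Uy Vy).
  by apply: le_trans; apply: le_trans (Im_le_nm _); rewrite /= ler_norm.
have hS : has_sup S by split => //; exists (escape_radius c).
pose s := sup S.
have Ldist y y' : nm (L y - L y') = `|y - y'|.
  by rewrite nmE/= subrr expr0n/= add0r sqrtr_sqr.
have lim (e : R) : 0 < e -> exists2 y, S y & nm (L y - L s) < e.
  move=> e0; have [y Sy ys] := sup_adherent e0 hS; exists y => //.
  rewrite Ldist ler0_norm; first by rewrite opprB -/s; rewrite -/s in ys; lra.
  by rewrite subr_le0 /s; apply: ub_le_sup => //; exists (escape_radius c).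
have KL : K (L s).
  have /closedCP cK := @filled_julia_closed R c; apply: cK => e /lim[y [Uy Vy] ys].
  by exists (L y) => //; exact: ZK.
have NG : ~ G (L s).
  move=> /GF /(_ KL) sF; move/negP : tF; apply; apply/mapP; by exists (L s).
have [|Us|/NG//] := cU (L s).
  by move=> e /lim[y [Uy _] ys]; exists (L y).
have [|Vs|/NG//] := cV (L s).
  by move=> e /lim[y [_ Vy] ys]; exists (L y).
have [d d0 hd] := oZ _ Us Vs.
have : S (s + d / 2).
  by apply: hd; rewrite Ldist addrAC subrr add0r gtr0_norm; lra.
move=> /(ub_le_sup (ex_intro _ _ Sub)); rewrite -/s; lra.
Qed.

Lemma sides_relclI a b p I O : sides a b p I O -> relcl I (ray_pair a b p).
Proof.
move=> h z hz; case: (sides_cover h z) => [|[Oz|]]; [by left| |by right].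
have [r r0 hr] := (openCP _).1 (sides_openO h) z Oz.
by have [y Iy /hr Oy] := hz r r0; case: (sides_disj h Iy Oy).
Qed.

Lemma ray_pairC a b p : ray_pair b (a + 1) p = ray_pair a b p.
Proof.
apply/funext => z; apply/propext; rewrite /ray_pair/=.
have E : ray_set (a + 1) z <-> ray_set a z.
  by split=> -[r r1 ->]; exists r; rewrite ?ray1.
by rewrite E; split=> -[|[]]; auto.
Qed.

Lemma ray_pair_int a b p (k : int) : ray_pair (a + k%:~R) (b + k%:~R) p = ray_pair a b p.
Proof.
apply/funext => z; apply/propext; rewrite /ray_pair/=.
have E t : ray_set (t + k%:~R) z <-> ray_set t z.
  by split=> -[r r1 ->]; exists r; rewrite ?ray_int.
by rewrite !E.
Qed.

Lemma sides_compl a b p I O : sides a b p I O -> sides b (a + 1) p O I.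
Proof.
move=> h; split; rewrite ?ray_pairC; case: h => // oI oO d cov IG OG hI hO.
- by move=> z Oz Iz; exact: d Iz Oz.
- by move=> z; case: (cov z) => [|[]]; auto.
- move=> x r /andP[x1 x2] r1; rewrite -[x](subrK 1) ray1; apply: hI => //.
  by apply/andP; split; lra.
Qed.

Lemma sides_relclO a b p I O : sides a b p I O -> relcl O (ray_pair a b p).
Proof. by move=> /sides_compl/sides_relclI; rewrite ray_pairC. Qed.

Lemma sides_shift a b p I O (k : int) : sides a b p I O ->
  sides (a + k%:~R) (b + k%:~R) p I O.
Proof.
move=> h; split; rewrite ?ray_pair_int; case: h => // oI oO d cov IG OG hI hO.
- move=> x r /andP[x1 x2] r1; rewrite -[x](subrK k%:~R) ray_int; apply: hI => //.
  by apply/andP; split; lra.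
- move=> x r /andP[x1 x2] r1; rewrite -[x](subrK k%:~R) ray_int; apply: hO => //.
  by apply/andP; split; lra.
Qed.

Lemma ray_congr x x' r r' : 1 < r -> 1 < r' -> ray x r = ray x' r' ->
  exists k : int, x' = x + k%:~R.
Proof.
move=> r1 r1' E; pose k := Num.floor (x' - x); exists k.
have := floor_le (x' - x); have := floorD1_gt (x' - x); rewrite -/k rmorphD/= => h1 h2.
apply: (ray_inj ext r1' r1); first by rewrite ray_int.
by rewrite ger0_norm; lra.
Qed.

Lemma int_gap (k k' : int) : (k%:~R : R) < k'%:~R -> (k'%:~R : R) < k%:~R + 1 -> False.
Proof.
rewrite ltr_int => h1; rewrite -[X in _ + X]/(1%:~R) -rmorphD/= ltr_int ltzD1.
by rewrite leNgt h1.
Qed.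

Lemma sides_Iray a b p I O x r : a < b < a + 1 -> sides a b p I O -> 1 < r -> I (ray x r) ->
  exists k : int, a < x + k%:~R < b.
Proof.
move=> ab h r1 Ix; have Kx := ray_basin (t := x) ext r1.
case: (basin_angle ext ab Kx) => [ra|rb|[y [s [yI s1 E]]]|[y [s [yO s1 E]]]].
- by case: (sides_IG h Ix); left.
- by case: (sides_IG h Ix); right; left.
- by have [k yE] := ray_congr r1 s1 E; exists k; rewrite -yE.
- by have := sides_O h yO s1; rewrite -E => /(sides_disj h Ix).
Qed.

Lemma sides_Oray a b p I O x r : a < b < a + 1 -> sides a b p I O -> 1 < r -> O (ray x r) ->
  exists k : int, b < x + k%:~R < a + 1.
Proof.
move=> /andP[ab ba] /sides_compl h; apply: sides_Iray h.
by apply/andP; split; lra.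
Qed.

Lemma ray_pair_basin a b p z : ray_pair a b p z -> K z -> z = p.
Proof.
by move=> [/(ray_set_basin ext)//|[/(ray_set_basin ext)//|]].
Qed.

Lemma lands_in_open t p U : lands t p -> open U -> U p -> exists2 r, 1 < r & U (ray t r).
Proof.
move=> [_ lp] /openCP oU /oU[e e0 he]; have [d d0 hd] := lp e e0.
by exists (1 + d / 2); [lra|apply/he/hd; lra].
Qed.

(** I' and O have disjoint angles in the basin, so they are disjoint by [disjoint_ext]. The vertex
    p' falls in I because a ray landing there runs in I and p' is not p. *)
Lemma sides_sub a b p I O a' b' p' I' O' : sides a b p I O -> sides a' b' p' I' O' ->
  lands a p -> lands a' p' -> a < a' -> a' < b' -> b' < b -> b < a + 1 -> p' <> p ->
  (forall z, I' z -> I z) /\ (forall z, ray_pair a' b' p' z -> I z).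
Proof.
move=> h h' la la' aa ab' bb ba pp.
have ab : a < b < a + 1 by apply/andP; split; lra.
have ab1 : a' < b' < a' + 1 by apply/andP; split; lra.
have G'I z : ray_pair a' b' p' z -> I z.
  move=> [[r r1 ->]|[[r r1 ->]|->]].
  - by apply: (sides_I h) => //; apply/andP; split; lra.
  - by apply: (sides_I h) => //; apply/andP; split; lra.
  case: (sides_cover h p') => [//|[Op|/ray_pair_basin/(_ la'.1)//]].
  have [r r1 Or] := lands_in_open la' (sides_openO h) Op.
  case: (sides_disj h _ Or); apply: (sides_I h) => //; apply/andP; split; lra.
split=> // z Iz; case: (sides_cover h z) => [//|[Oz|Gz]].
  exfalso; apply: (@disjoint_ext I' O (ray_pair a b p `|` ray_pair a' b' p') [:: p; p']) Iz Oz.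
  - exact: sides_openI h'.
  - exact: sides_openO h.
  - by apply: relcl_mono (sides_relclI h') => ? ?; right.
  - by apply: relcl_mono (sides_relclO h) => ? ?; left.
  - by move=> y [] /ray_pair_basin yp /yp ->; rewrite !inE eqxx ?orbT.
  move=> y Ky Iy Oy; have [x [r [_ r1 yE]]] := ray_ex ext 0 Ky.
  move: Iy Oy; rewrite yE => /(sides_Iray ab1 h' r1)[k /andP[k1 k2]].
  move=> /(sides_Oray ab h r1)[k' /andP[k3 k4]].
  by apply: (@int_gap k k'); lra.
exfalso.
have aI r : 1 < r -> ~ I' (ray a r).
  move=> r1 /(sides_Iray ab1 h' r1)[k /andP[k1 k2]].
  by apply: (@int_gap 0 k); rewrite ?mulr0z; lra.
case: Gz => [[r r1 zE]|[[r r1 zE]|zE]]; move: Iz; rewrite zE.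
- exact: aI.
- move=> /(sides_Iray ab1 h' r1)[k /andP[k1 k2]].
  by apply: (@int_gap k 0); rewrite ?mulr0z; lra.
by move=> /(lands_in_open la (sides_openI h'))[r r1]; exact: aI.
Qed.

Lemma sides_neg a b p I O : sides a b p I O ->
  sides (a + 1 / 2) (b + 1 / 2) (- p) [set z | I (- z)] [set z | O (- z)].
Proof.
move=> h.
have rs t z : ray_set (t + 1 / 2) z <-> ray_set t (- z).
  split=> -[r r1 zE]; exists r => //; first by rewrite zE (ray_half ext Kalpha)// opprK.
  by rewrite (ray_half ext Kalpha)// -zE opprK.
have GE z : ray_pair (a + 1 / 2) (b + 1 / 2) (- p) z <-> ray_pair a b p (- z).
  rewrite /ray_pair/= !rs; split=> -[|[|E]]; auto; right; right.
    by rewrite E opprK.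
  by rewrite -E opprK.
have oN U : open U -> open [set z | U (- z)].
  move=> /openCP oU; apply/openCP => z /oU[r r0 hr]; exists r => // y yz.
  by apply: hr; rewrite -opprD nmN.
have rN x r : 1 < r -> - ray x r = ray (x - 1 / 2) r.
  by move=> r1; rewrite -{1}[x](subrK (1 / 2)) (ray_half ext Kalpha)// opprK.
case: h => oI oO d cov IG OG hI hO; split.
- exact: oN.
- exact: oN.
- by move=> z; exact: d.
- by move=> z; case: (cov (- z)) => [|[|/GE]]; auto.
- by move=> z Iz /GE; exact: IG.
- by move=> z Oz /GE; exact: OG.
- by move=> x r /andP[x1 x2] r1 /=; rewrite rN//; apply: hI => //; apply/andP; split; lra.
- by move=> x r /andP[x1 x2] r1 /=; rewrite rN//; apply: hO => //; apply/andP; split; lra.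
Qed.

Lemma ray_set_double t z : ray_set t z -> ray_set (2 * t) (f z).
Proof.
move=> [r r1 ->]; exists (r ^+ 2); first by rewrite exprn_egt1.
by rewrite (ray_double ext Kalpha).
Qed.

Lemma quadratic_fiber z w : f z = f w -> z = w \/ z = - w.
Proof. by move=> /addIr /eqP; rewrite eqf_sqr => /orP[] /eqP; [left|right]. Qed.

Lemma ray_pair_double a b p z : ray_pair (2 * a) (2 * b) (f p) (f z) <->
  ray_pair a b p z \/ ray_pair (a + 1 / 2) (b + 1 / 2) (- p) z.
Proof.
have rs t : ray_set (2 * t) (f z) <-> ray_set t z \/ ray_set (t + 1 / 2) z.
  split=> [[r r1 E]|[|/ray_set_double]]; last 2 first.
  - exact: ray_set_double.
  - rewrite mulrDr (_ : 2 * (1 / 2) = 1); last by field.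
    by case=> r r1 E; exists r => //; rewrite E ray1.
  have sr1 : 1 < Num.sqrt r by rewrite -[X in X < _]sqrtr1 ltr_sqrt// (lt_trans ltr01).
  move: E; rewrite -(@sqr_sqrtr _ r); last lra.
  rewrite (ray_double ext Kalpha)// => /quadratic_fiber[->|->]; [left|right].
    by exists (Num.sqrt r).
  by exists (Num.sqrt r) => //; rewrite (ray_half ext Kalpha).
rewrite /ray_pair/= !rs; split.
  by move=> [[]|[[]|/quadratic_fiber[]]]; auto.
by move=> [[|[|->]]|[|[|->]]]; auto; right; right; rewrite /quadratic ?sqrrN.
Qed.

(** * Doubling a sector narrower than half a turn *)

Section Doubling.
Variables (a b : R) (p : C) (I O I1 O1 I2 O2 : set C).
Hypothesis ab : a < b.
Hypothesis ba : b - a < 1 / 2.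
Hypothesis la : lands a p.
Hypothesis h : sides a b p I O.
Hypothesis h1 : sides (a + 1 / 2) (b + 1 / 2) (- p) I1 O1.
Hypothesis h2 : sides (2 * a) (2 * b) (f p) I2 O2.

Let A : a < b < a + 1. Proof. by have := ab; have := ba => ? ?; apply/andP; split; lra. Qed.
Let A1 : a + 1 / 2 < b + 1 / 2 < a + 1 / 2 + 1. Proof. by have := ab; have := ba => ? ?; apply/andP; split; lra. Qed.
Let A2 : 2 * a < 2 * b < 2 * a + 1. Proof. by have := ab; have := ba => ? ?; apply/andP; split; lra. Qed.
Let G := ray_pair (2 * a) (2 * b) (f p).

Let GF z : (f @^-1` G) z -> K z -> z \in [:: p; - p].
Proof.
by rewrite /= => /ray_pair_double[] /ray_pair_basin zp /zp ->; rewrite !inE eqxx ?orbT.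
Qed.

Let sub : ray_pair a b p `<=` f @^-1` G.
Proof. by move=> z Gz; apply/ray_pair_double; left. Qed.
Let sub1 : ray_pair (a + 1 / 2) (b + 1 / 2) (- p) `<=` f @^-1` G.
Proof. by move=> z Gz; apply/ray_pair_double; right. Qed.

Lemma doubling_disj z : I z -> I1 z -> False.
Proof.
have ab' := ab; have ba' := ba.
apply: (disjoint_ext (sides_openI h) (sides_openI h1) (relcl_mono sub (sides_relclI h))
  (relcl_mono sub1 (sides_relclI h1)) GF) => y Ky; have [x [r [_ r1 ->]]] := ray_ex ext 0 Ky.
move=> /(sides_Iray A h r1)[k /andP[k1 k2]] /(sides_Iray A1 h1 r1)[k' /andP[k3 k4]].
by apply: (@int_gap k k'); lra.
Qed.

(** In the basin this is angle doubling, and [disjoint_ext] carries it over to K. If f z were on the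
    doubled pair, z would be on the opposite pair, whose rays avoid I. *)
Lemma doubling_in z : I z -> I2 (f z).
Proof.
have ab' := ab; have ba' := ba.
move=> Iz; have [//|[w2|Gz]] := sides_cover h2 (f z).
  exfalso; apply: (disjoint_ext (sides_openI h) (open_preimage (sides_openO h2))
    (relcl_mono sub (sides_relclI h)) (relcl_preimage (sides_relclO h2)) GF _ Iz w2) => y Ky.
  have [x [r [_ r1 ->]]] := ray_ex ext 0 Ky.
  move=> /(sides_Iray A h r1)[k /andP[k1 k2]] /=.
  rewrite -(ray_double ext Kalpha)// => O2y; apply: (sides_disj h2 _ O2y).
  rewrite -(ray_int _ _ _ _ (k * 2)); apply: (sides_I h2); last by rewrite exprn_egt1.
  by rewrite rmorphM/=; apply/andP; split; lra.
move: Gz => /ray_pair_double[Gz|]; first by case: (sides_IG h Iz).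
have aI r : 1 < r -> ~ I (ray (a + 1 / 2) r).
  move=> r1 /(sides_Iray A h r1)[k /andP[k1 k2]].
  have [k0|k0] := lerP 0 k.
    have : (0 : R) <= k%:~R by rewrite ler0z.
    lra.
  have : (k%:~R : R) <= -1 by rewrite -[X in _ <= X]/((-1)%:~R) ler_int -ltzD1 addNr.
  lra.
have bI r : 1 < r -> ~ I (ray (b + 1 / 2) r).
  move=> r1 /(sides_Iray A h r1)[k /andP[k1 k2]].
  have [k0|k0] := lerP 0 k.
    have : (0 : R) <= k%:~R by rewrite ler0z.
    lra.
  have : (k%:~R : R) <= -1 by rewrite -[X in _ <= X]/((-1)%:~R) ler_int -ltzD1 addNr.
  lra.
move=> [[r r1 zE]|[[r r1 zE]|zE]]; move: Iz; rewrite zE => Iz.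
- by case: (aI r).
- by case: (bI r).
have := lands_in_open (lands_half ext Kalpha la) (sides_openI h) Iz.
by case=> r /aI.
Qed.

Lemma doubling_out z : I2 (f z) -> I z \/ I1 z.
Proof.
have ab' := ab; have ba' := ba.
move=> I2z; case: (sides_cover h z) => [|[Oz|Gz]]; [by left| |]; last first.
  by case: (sides_IG h2 I2z); apply/ray_pair_double; left.
case: (sides_cover h1 z) => [|[w1|Gz]]; [by right| |]; last first.
  by case: (sides_IG h2 I2z); apply/ray_pair_double; right.
exfalso; apply: (disjoint_ext (openI (sides_openO h) (sides_openO h1))
  (open_preimage (sides_openI h2)) (relclI (relcl_mono sub (sides_relclO h))
  (relcl_mono sub1 (sides_relclO h1))) (relcl_preimage (sides_relclI h2)) GF _ (conj Oz w1) I2z).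
move=> y Ky [Oy O1y] /=; move: Oy O1y; have [x [r [_ r1 ->]]] := ray_ex ext 0 Ky.
rewrite -(ray_double ext Kalpha)// => Oy O1y.
have r2 : 1 < r ^+ 2 by rewrite exprn_egt1.
move=> /(sides_Iray A2 h2 r2)[k /andP[k1 k2]].
(* An even number of turns of the doubled angle is a number of whole turns of the angle and leads to
   I; an odd number leaves half a turn and leads to I1. *)
have [j kj] : exists j : int, k = j * 2 \/ k = j * 2 + 1.
  by exists (k %/ 2)%Z; have := divz_eq k 2; have := modz_ge0 k (isT : 2 != 0 :> int);
     have := ltz_pmod k (isT : 0 < 2 :> int); lia.
case: kj => kE; move: k1 k2; rewrite kE ?rmorphD rmorphM/= => k1 k2.
  apply: (sides_disj h _ Oy); rewrite -(ray_int _ _ _ _ j); apply: (sides_I h) => //.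
  by apply/andP; split; lra.
apply: (sides_disj h1 _ O1y); rewrite -(ray_int _ _ _ _ (j + 1)); apply: (sides_I h1) => //.
by rewrite rmorphD/=; apply/andP; split; lra.
Qed.

End Doubling.

End SideRelations.

(** * Contraction of an invariant inverse branch *)

Section AnnulusBound.
Variable R : realType.
Local Notation C := (Cplx R).

(** Three-circles estimate: the maximum principle for D(z) / (z - y)^m on the annulus. A large m
    makes the outer contribution small, after which a small eta does the same for the inner one. *)
Lemma annulus_bound (D : C -> C) (y : C) (e1 r1 eta M : R) (m : nat) : 0 < e1 -> e1 < r1 ->
  (forall z : C, nm (z - y) <= r1 -> cdiff D z) ->
  (forall z : C, nm (z - y) <= e1 -> nm (D z) <= eta) ->
  (forall z : C, nm (z - y) <= r1 -> nm (D z) <= M) ->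
  forall z : C, e1 < nm (z - y) -> nm (z - y) < r1 ->
    nm (D z) <= Num.max (eta / e1 ^+ m) (M / r1 ^+ m) * nm (z - y) ^+ m.
Proof.
move=> e0 er dD De DM z ez zr; set B := Num.max _ _.
have r0 : 0 < r1 by apply: lt_trans er.
pose q (z : C) := D z * ((z - y) ^+ m)^-1.
have dq (w : C) : w != y -> nm (w - y) <= r1 -> cdiff q w.
  move=> wy wr; apply: cdiffM; first exact: dD.
  apply: cdiffV; last by rewrite expf_neq0// subr_eq0.
  by apply: cdiffX; apply: cdiffB; [exact: cdiff_id|exact: cdiff_cst].
have ny (w : C) : e1 <= nm (w - y) -> w != y.
  by move=> ew; rewrite -subr_eq0 -nm_gt0 (lt_le_trans e0).
pose Om := [set w : C | e1 < nm (w - y) /\ nm (w - y) < r1].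
have Oy (w : C) : Om w -> w != y by move=> [/ltW/ny].
have nq (w : C) : nm (q w) = nm (D w) / nm (w - y) ^+ m by rewrite nmM nmV nmX.
suff H : nm (q z) <= B.
  have zy : 0 < nm (z - y) ^+ m by rewrite exprn_gt0// (lt_trans e0).
  by rewrite -ler_pdivrMr// -nq.
apply: (@maxmod R Om q y B) => //.
- have oo : open [set w : C | nm (w - y) < r1] by exact: disc_open.
  apply/openCP => w [w1 w2]; have [s s0 hs] := (openCP _).1 oo w w2.
  exists (Num.min s (nm (w - y) - e1)); first by rewrite lt_min s0 subr_gt0.
  move=> u; rewrite lt_min => /andP[/hs u2 u1]; split => //.
  by have := nmBD w u y; rewrite (nmB w u); lra.
- by move=> w Ow; apply: cdiff_cont; apply: dq; [exact: Oy|case: Ow => _ /ltW].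
- by move=> w Ow _; apply: dq; [exact: Oy|case: Ow => _ /ltW].
- move=> B' BB'; apply/closedCP => w wc.
  have w1 : e1 <= nm (w - y).
    apply/ler_addgt0Pr => e /wc[u [[u1 _] _] uw].
    by have := nmBD u w y; lra.
  have w2 : nm (w - y) <= r1.
    apply/ler_addgt0Pr => e /wc[u [[_ u2] _] uw].
    by have := nmBD w u y; rewrite (nmB w u); lra.
  have Bw : B' <= nm (q w).
    apply/ler_addgt0Pr => e e0'; have [s s0 hs] := cdiff_cont (dq w (ny w w1) w2) e0'.
    have [u [_ uB] uw] := wc s s0; have := hs u uw; have := nm_lbB (q u) (q w); lra.
  have Bq := lt_le_trans BB' Bw.
  have [B1 B2] : eta / e1 ^+ m <= B /\ M / r1 ^+ m <= B by rewrite !le_max !lexx orbT.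
  split=> //; split; rewrite lt_neqAle ?w1 ?w2 andbT; apply/eqP => E.
    suff : nm (q w) <= B by rewrite leNgt Bq.
    apply: le_trans B1; rewrite nq -E; apply: ler_wpM2r; first by rewrite invr_ge0 exprn_ge0// ltW.
    by apply: De; rewrite -E.
  suff : nm (q w) <= B by rewrite leNgt Bq.
  apply: le_trans B2; rewrite nq E; apply: ler_wpM2r; first by rewrite invr_ge0 exprn_ge0// ltW.
  by apply: DM; rewrite E.
exists (nm y + r1) => w [_ w2] _; have := nm_lbB w y; lra.
Qed.

Lemma expr_geD1 (t : R) (n : nat) : 0 <= t -> 1 + n%:R * t <= (1 + t) ^+ n.
Proof.
move=> t0; elim: n => [|n IH]; first by rewrite mul0r addr0 expr0.
rewrite exprS -natr1; have : 0 <= n%:R * t by rewrite mulr_ge0.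
nra.
Qed.

Lemma expr_small (x M d : R) : 0 <= x -> x < 1 -> 0 < d -> exists m, M * x ^+ m <= d.
Proof.
move=> x0 x1 d0; have [->|xn] := eqVneq x 0.
  by exists 1%N; rewrite expr1 mulr0 ltW.
have xp : 0 < x by rewrite lt_def xn.
pose t := x^-1 - 1; have t0 : 0 < t by rewrite subr_gt0 invf_gt1.
pose m := (Num.truncn (M / (d * t))).+1; exists m.
have h := @expr_geD1 t m (ltW t0).
have E : (1 + t) ^+ m = (x ^+ m)^-1 by rewrite /t addrC subrK exprVn.
have xm : 0 < x ^+ m by rewrite exprn_gt0.
rewrite -ler_pdivlMr// -E; apply: (@le_trans _ _ (d * (m%:R * t))).
  rewrite mulrCA -ler_pdivrMr ?mulr_gt0//; exact/ltW/truncnS_gt.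
rewrite ler_pM2l//; lra.
Qed.

End AnnulusBound.

(** * Derivatives of the iterates of an inverse branch *)

Section InverseBranch.
Variable R : realType.
Local Notation C := (Cplx R).
Variables (c : C) (phi : C -> C) (alpha : C).
Local Notation f := (quadratic c).
Local Notation K := (filled_julia f).
Hypothesis ext : exterior_map K phi.
Hypothesis falpha : f alpha = alpha.
Hypothesis alpha1 : nm (2%:R * alpha) = 1.
Implicit Types z w x y : C.

Lemma fixed_in_K : K alpha.
Proof.
apply/filled_juliaP => n.
have -> : iter n f alpha = alpha by elim: n => [//|n IH]; rewrite iterS IH falpha.
move: alpha1; rewrite nmM nmZn /escape_radius; have := nm_ge0 c; lra.
Qed.

Variables (V G : set C) (F : seq C) (g : C -> C).
Hypothesis oV : open V.
Hypothesis cV : relcl V G.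
Hypothesis GF : forall z, G z -> K z -> z \in F.
Hypothesis Valpha : V alpha.
Hypothesis VN : forall z, V z -> V (- z) -> False.
Hypothesis gV : forall z, V z -> V (g z).
Hypothesis fg : forall z, V z -> f (g z) = z.

Let gal : g alpha = alpha.
Proof.
have [//|E] : g alpha = alpha \/ g alpha = - alpha.
  by apply: (@quadratic_fiber R c); rewrite fg// falpha.
by case: (VN Valpha); rewrite -E; exact: gV.
Qed.

Let sum_neq0 y z : V y -> V z -> g z + g y != 0.
Proof.
move=> Vy Vz; rewrite addr_eq0; apply/eqP => E; apply: (VN (gV Vz)).
by rewrite E opprK; exact: gV.
Qed.

(** A difference of two squares. Continuity, differentiability and the product formula for the
    divided differences of the iterates all come from this identity. *)
Let g_diff y z : V y -> V z -> (g z - g y) * (g z + g y) = z - y.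
Proof.
move=> Vy Vz; rewrite -[in RHS](fg Vz) -[in RHS](fg Vy) /quadratic; ring.
Qed.

(** If z - y is small, then g y - g z or g y + g z is small; the latter would put -g y in V near g
    z, against [VN]. *)
Let g_cont z : V z -> ccont g z.
Proof.
move=> Vz e e0; have [r r0 hr] := (openCP _).1 oV z Vz.
have [s s0 hs] := (openCP _).1 oV _ (gV Vz).
pose d := Num.min e s; have d0 : 0 < d by rewrite lt_min e0.
exists (Num.min r (d ^+ 2)); first by rewrite lt_min r0 exprn_gt0.
move=> y; rewrite lt_min => /andP[/hr Vy yd].
have [H|H] : nm (g y - g z) < d \/ nm (g y + g z) < d.
  have [|h1] := ltP (nm (g y - g z)) d; first by left.
  have [|h2] := ltP (nm (g y + g z)) d; first by right.
  exfalso; move: yd; rewrite -(g_diff Vz Vy) nmM ltNge expr2.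
  by move/negP; apply; apply: ler_pM => //; exact: ltW.
- by apply: lt_le_trans H _; rewrite ge_min lexx.
exfalso; apply: (VN (gV Vy)); apply: hs.
rewrite -opprD nmN; apply: lt_le_trans H _; by rewrite ge_min lexx orbT.
Qed.

Let g_cdiff z : V z -> cdiff g z.
Proof.
move=> Vz; pose q w : C := (g w + g z)^-1.
have cq : ccont q z.
  apply: ccontV; last exact: sum_neq0.
  by apply: ccontD; [exact: g_cont|exact: ccont_cst].
apply: (@cdiff_near _ (fun w => g z + q w * (w - z))).
  exists (q z); apply/is_cdiffP; exists q; split => // w.
  by rewrite subrr mulr0 addr0 addrAC subrr add0r.
have [r r0 hr] := (openCP _).1 oV z Vz.
apply/nearCP; exists r => // w /hr Vw.
by rewrite -(g_diff Vz Vw) mulrC /q mulfK ?sum_neq0// addrC subrK.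
Qed.

Let G_ k := iter k g.

Let GV k z : V z -> V (G_ k z).
Proof. by move=> Vz; elim: k => [//|k IH]; rewrite /G_ iterS; exact: gV. Qed.

Let fG k z : V z -> iter k f (G_ k z) = z.
Proof.
move=> Vz; elim: k => [//|k IH].
by rewrite iterSr /G_ iterS fg ?IH//; exact: GV.
Qed.

Let G_cdiff k z : V z -> cdiff (G_ k) z.
Proof.
move=> Vz; elim: k => [|k IH]; first exact: cdiff_id.
by apply: (cdiff_comp (f := g) (g := G_ k)) => //; apply: g_cdiff; exact: GV.
Qed.

Let G_bound k z : V z -> nm (G_ k z) <= Num.max (escape_radius c) (nm z).
Proof.
move=> Vz; elim: k => [|k IH]; first by rewrite le_max lexx orbT.
rewrite /G_ iterS -/(G_ k z); have VG := GV k Vz.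
have [h|h] := leP (nm (g (G_ k z))) (escape_radius c); first by rewrite le_max h.
apply: le_trans IH; have := escape_step h; rewrite fg//.
by have := nm_ge0 (g (G_ k z)); lra.
Qed.

(* The divided difference of [G_ k], which extends holomorphically to the diagonal. *)
Let Q k y z : C := \prod_(j < k) (G_ j.+1 z + G_ j.+1 y)^-1.

Let QE k y z : V y -> V z -> G_ k z - G_ k y = Q k y z * (z - y).
Proof.
move=> Vy Vz; elim: k => [|k IH]; first by rewrite /Q big_ord0 mul1r.
rewrite /Q big_ord_recr/= -/(Q k y z) mulrAC -IH -(g_diff (GV k Vy) (GV k Vz)).
by rewrite mulfK// sum_neq0//; exact: GV.
Qed.

Let Q_cdiff k y z : V y -> V z -> cdiff (Q k y) z.
Proof.
move=> Vy Vz; elim: k => [|k IH].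
  by apply: (cdiff_near (cdiff_cst 1 z)); apply/nearCP; exists 1 => // w _; rewrite /Q big_ord0.
apply: (@cdiff_near _ (fun z => Q k y z * (G_ k.+1 z + G_ k.+1 y)^-1)).
  apply: cdiffM => //; apply: cdiffV; last by apply: sum_neq0; exact: GV.
  by apply: cdiffD; [exact: G_cdiff|exact: cdiff_cst].
by apply/nearCP; exists 1 => // w _; rewrite /Q big_ord_recr.
Qed.

(** The derivative of [G_ k], as the value of the divided difference on the diagonal. *)
Let D k z : C := Q k z z.

Let D_cdiff k z : V z -> cdiff (D k) z.
Proof.
move=> Vz; elim: k => [|k IH].
  by apply: (cdiff_near (cdiff_cst 1 z)); apply/nearCP; exists 1 => // w _; rewrite /D/Q big_ord0.
apply: (@cdiff_near _ (fun z => D k z * (G_ k.+1 z + G_ k.+1 z)^-1)).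
  apply: cdiffM => //; apply: cdiffV; last by apply: sum_neq0; exact: GV.
  by apply: cdiffD; exact: G_cdiff.
by apply/nearCP; exists 1 => // w _; rewrite /D/Q big_ord_recr.
Qed.

Let D_alpha k : nm (D k alpha) = 1.
Proof.
have Ga j : G_ j alpha = alpha by elim: j => [//|j IH]; rewrite /G_ iterS -/(G_ j alpha) IH gal.
have E : alpha + alpha = 2%:R * alpha by ring.
rewrite /D /Q; under eq_bigr do rewrite !Ga E.
by rewrite prodr_const nmX nmV alpha1 invr1 expr1n.
Qed.

(** Schwarz's lemma for [G_ k w - G_ k y], of modulus at most 2 B; the diagonal value follows by
    continuity. The bound does not depend on k. *)
Let Q_bound (r B : R) k y z : 0 < r -> (forall w, nm (w - y) < r -> V w) ->
  (forall w, nm (w - y) < r -> nm w <= B) -> escape_radius c <= B -> nm (z - y) < r ->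
  nm (Q k y z) <= 2 * B / r.
Proof.
move=> r0 hr hB rB zr.
have y_in : nm (y - y) < r by rewrite subrr nm0.
have Vy : V y by exact: hr.
have GB w : nm (w - y) < r -> nm (G_ k w) <= B.
  move=> wr; apply: le_trans (G_bound k (hr w wr)) _.
  by rewrite ge_max rB hB.
have ne w : nm (w - y) < r -> w != y -> nm (Q k y w) <= 2 * B / r.
  move=> wr wy; have wy0 : 0 < nm (w - y) by rewrite nm_gt0 subr_eq0.
  rewrite -(ler_pM2r wy0) -nmM -QE//; last exact: hr.
  apply: (@schwarz R (fun w => G_ k w - G_ k y) y r (2 * B)) => //.
  - by rewrite subrr.
  - by move=> u ur; apply: cdiffB; [apply: G_cdiff; exact: hr|exact: cdiff_cst].
  - move=> u ur; apply: le_trans (nmD _ _) _; rewrite nmN.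
    by have := GB u ur; have := GB y y_in; lra.
have [->|] := eqVneq z y; last exact: ne.
apply/ler_addgt0Pr => e e0; have [s s0 hs] := cdiff_cont (Q_cdiff k Vy Vy) e0.
pose u : C := y + (((Num.min s r / 2)%:C) : C).
have m0 : 0 < Num.min s r by rewrite lt_min s0.
have uy : nm (u - y) = Num.min s r / 2.
  by rewrite /u addrAC subrr add0r nmR gtr0_norm// divr_gt0.
have [ms mr] : Num.min s r <= s /\ Num.min s r <= r by rewrite !ge_min !lexx orbT.
have := hs u; rewrite uy => /(_ _) hs1.
have {}hs1 : nm (Q k y u - Q k y y) < e by apply: hs1; lra.
have : nm (Q k y u) <= 2 * B / r.
  by apply: ne; [rewrite uy; lra|rewrite -subr_eq0 -nm_gt0 uy divr_gt0].
by have := nm_lbB (Q k y y) (Q k y u); rewrite (nmB (Q k y y)); lra.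
Qed.

(** By Schwarz, [Q k y] stays within L |z - y| of [D k y]. On the circle of radius s <= d / (2 L)
    this leaves |G_k z - G_k y| >= d s / 2, and [open_image] covers a disc whose radius depends on
    neither k nor y. *)
Let bloch (r B d : R) : 0 < r -> 0 < B -> escape_radius c <= B -> 0 < d ->
  exists2 eta : R, 0 < eta & forall k y, (forall w, nm (w - y) < r -> V w /\ nm w <= B) ->
    d < nm (D k y) -> forall x, nm (x - G_ k y) < eta -> exists2 u, nm (u - y) < r & G_ k u = x.
Proof.
move=> r0 B0 rB d0.
pose L := 2 * (2 * B / r) / r; have L0 : 0 < L by rewrite !divr_gt0// mulr_gt0// divr_gt0// mulr_gt0.
pose s := Num.min (r / 2) (d / (2 * L)).
have s0 : 0 < s by rewrite lt_min !divr_gt0// mulr_gt0.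
have [sr sd] : s <= r / 2 /\ s <= d / (2 * L) by rewrite /s !ge_min !lexx orbT.
exists (d / 2 * s / 2); first by rewrite !divr_gt0// mulr_gt0// divr_gt0.
move=> k y hV dy x xe.
have y_in : nm (y - y) < r by rewrite subrr nm0.
have Vy : V y by case: (hV y y_in).
have sub z : nm (z - y) <= s -> nm (z - y) < r by lra.
have dG z : nm (z - y) <= s -> cdiff (G_ k) z.
  by move=> /sub /hV[Vz _]; exact: G_cdiff.
suff mG z : nm (z - y) = s -> d / 2 * s <= nm (G_ k z - G_ k y).
  by have [u us ux] := open_image s0 dG mG xe; exists u => //; lra.
move=> zs; have zr : nm (z - y) < r by apply: sub; rewrite zs.
have [Vz _] := hV z zr; rewrite QE// nmM zs ler_pM2r//.
have h : nm (Q k y z - Q k y y) <= L * nm (z - y).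
  apply: (@schwarz R (fun z => Q k y z - Q k y y) y r (2 * (2 * B / r))) => //.
  - by rewrite subrr.
  - by move=> w /hV[Vw _]; apply: cdiffB; [exact: Q_cdiff|exact: cdiff_cst].
  move=> w wr; apply: le_trans (nmD _ _) _; rewrite nmN.
  have q1 := @Q_bound r B k y w r0 (fun w wr => (hV w wr).1) (fun w wr => (hV w wr).2) rB wr.
  have q2 := @Q_bound r B k y y r0 (fun w wr => (hV w wr).1) (fun w wr => (hV w wr).2) rB y_in.
  lra.
have h2 : L * s <= d / 2.
  apply: le_trans (ler_wpM2l (ltW L0) sd) _.
  by rewrite le_eqVlt; apply/orP; left; apply/eqP; field; rewrite gt_eqF.
have := nm_lbB (Q k y y) (Q k y z); rewrite (nmB (Q k y y)); rewrite zs in h.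
by rewrite /D in dy; lra.
Qed.

Let phi_iter k z : ~ K z -> phi (iter k f z) = phi z ^+ (2 ^ k).
Proof.
move=> Kz; elim: k => [|k IH]; first by rewrite expn0 expr1.
rewrite iterS (phi_f ext fixed_in_K); last by rewrite filled_julia_iter.
by rewrite IH -exprM expnSr.
Qed.

Definition vanishing (x : C) : Prop := V x /\ exists2 r : R, 0 < r & forall d : R, 0 < d ->
  exists N, forall k z, (N <= k)%N -> nm (z - x) < r -> nm (D k z) <= d.

(** If derivatives above d recurred near z0, discs of a fixed radius about the images would share a
    cluster point zeta = G_k w, with w near z0, for arbitrarily large k. Then phi zeta ^ (2^k) = phi
    w stays bounded although |phi zeta| > 1. *)
Let vanishing_basin z0 : V z0 -> ~ K z0 -> vanishing z0.
Proof.
move=> Vz0 Kz0; split => //.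
have [r1 r10 h1] := (openCP _).1 oV z0 Vz0.
have [r2 r20 h2] := basin_disc Kz0.
have [r3 r30 h3] := phi_cont ext Kz0 ltr01.
pose r := Num.min r1 (Num.min r2 r3) / 3.
have m0 : 0 < Num.min r1 (Num.min r2 r3) by rewrite !lt_min r10 r20.
have r0 : 0 < r by rewrite divr_gt0.
have [rr1 rr2 rr3] : [/\ 3 * r <= r1, 3 * r <= r2 & 3 * r <= r3].
  have E : 3 * r = Num.min r1 (Num.min r2 r3) by rewrite /r; field.
  by rewrite E !ge_min !lexx !orbT.
pose b := nm (phi z0) + 1.
have hw w : nm (w - z0) < 3 * r -> [/\ V w, ~ K w & nm (phi w) <= b].
  move=> wr; split; [apply: h1; lra|apply: h2; lra|].
  have := h3 w; rewrite /b; have := nm_lbB (phi w) (phi z0) => A1 A2.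
  have {}A2 : nm (phi w - phi z0) < 1 by apply: A2; lra.
  lra.
exists r => // d d0; apply: contrapT => nex.
pose B := Num.max (escape_radius c) (nm z0 + 3 * r).
have [B1 B2] : escape_radius c <= B /\ nm z0 + 3 * r <= B by rewrite !le_max !lexx orbT.
have B0 : 0 < B by have := nm_ge0 z0; lra.
have [eta eta0 heta] := bloch r0 B0 B1 d0.
have /choice[u uP] : forall N : nat, exists ky : nat * C,
    [/\ (N <= ky.1)%N, nm (ky.2 - z0) < r & d < nm (D ky.1 ky.2)].
  move=> N; apply: contrapT => nn; apply: nex; exists N => k z Nk zr.
  by rewrite leNgt; apply/negP => h; apply: nn; exists (k, z).
have uV n w : nm (w - (u n).2) < r -> V w /\ nm w <= B.
  move=> wr; have [_ ur _] := uP n.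
  have w0 : nm (w - z0) < 2 * r by have := nmBD w (u n).2 z0; lra.
  have w3 : nm (w - z0) < 3 * r by lra.
  have [Vw _ _] := hw w w3.
  by split => //; have := nm_lbB w z0; lra.
have uB n : nm (G_ (u n).1 (u n).2) <= B.
  have [Vu nu] : V (u n).2 /\ nm (u n).2 <= B by apply: (uV n); rewrite subrr nm0.
  by apply: le_trans (G_bound _ Vu) _; rewrite ge_max B1.
have [zeta zc] := cluster_seq uB.
have key N : exists k, [/\ (N <= k)%N, ~ K zeta & nm (phi zeta) ^+ (2 ^ k) <= b].
  have [n Nn nz] := zc eta eta0 N; have [nk ur dn] := uP n.
  rewrite nmB in nz; have [w wr wE] := heta _ _ (uV n) dn zeta nz.
  have w0 : nm (w - z0) < 3 * r by have := nmBD w (u n).2 z0; lra.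
  have [Vw Kw pw] := hw w w0.
  have Kz : ~ K zeta by move=> Kz; apply: Kw; rewrite -(fG (u n).1 Vw) wE filled_julia_iter.
  exists (u n).1; split => //; first exact: leq_trans nk.
  by rewrite -nmX -phi_iter// -wE fG.
have [_ [_ Kz _]] := key 0%N.
have p1 := phi_gt1 ext Kz; pose t := nm (phi zeta) - 1.
have t0 : 0 < t by rewrite subr_gt0.
have [k [Nk _ kb]] := key (Num.truncn (b / t)).+1.
move: kb; apply/negP; rewrite -ltNge.
have -> : nm (phi zeta) = 1 + t by rewrite /t addrC subrK.
apply: lt_le_trans (expr_geD1 _ (ltW t0)).
have h4 : b / t < k%:R by apply: lt_le_trans (truncnS_gt _) _; rewrite ler_nat.
have h5 : (k%:R : R) <= (2 ^ k)%N%:R by rewrite ler_nat ltnW// ltn_expl.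
have h6 : b < (2 ^ k)%N%:R * t by rewrite -ltr_pdivrMr//; exact: lt_le_trans h5.
lra.
Qed.

(* Vitali's theorem for the locally bounded sequence [D]. *)
Let vanishing_spread (x y : C) (r : R) : 0 < r -> (forall w, nm (w - x) < 8 * r -> V w) ->
  nm (y - x) < r -> vanishing y -> vanishing x.
Proof.
move=> r0 hV yx [Vy [e0 e00 hy]].
have Vx : V x by apply: hV; rewrite subrr nm0 mulr_gt0.
split => //; exists r => // d d0.
pose e1 := Num.min e0 r / 2.
have m0 : 0 < Num.min e0 r by rewrite lt_min e00.
have [me mr] : Num.min e0 r <= e0 /\ Num.min e0 r <= r by rewrite !ge_min !lexx orbT.
have e10 : 0 < e1 by rewrite divr_gt0.
have e1e : e1 < e0 by rewrite /e1; lra.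
have e1r : e1 < 3 * r by rewrite /e1; lra.
pose B := Num.max (escape_radius c) (nm x + 8 * r).
have [B1 B2] : escape_radius c <= B /\ nm x + 8 * r <= B by rewrite !le_max !lexx orbT.
pose M := 2 * B / (4 * r).
(* Discs of radius 4 r about points within 3 r of y stay within 8 r of x, since y is within r of
   x. *)
have DM k w : nm (w - y) <= 3 * r -> nm (D k w) <= M.
  move=> wr; have sub u : nm (u - w) < 4 * r -> nm (u - x) < 8 * r.
    by move=> uw; have := nmBD u w x; have := nmBD w y x; lra.
  apply: Q_bound; rewrite ?subrr ?nm0 ?mulr_gt0//.
    by move=> u /sub /hV.
  by move=> u /sub; have := nm_lbB u x; lra.
(* On |z - y| < 2 r inside the circle of radius 3 r the outer term is at most M (2/3)^m; m is fixed
   by it before [eta] is adapted to the inner radius. *)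
have [m hm] : exists m, M * (2 / 3) ^+ m <= d by apply: expr_small; lra.
pose eta := Num.min d (d * e1 ^+ m / (2 * r) ^+ m).
have p1 : 0 < e1 ^+ m by rewrite exprn_gt0.
have p2 : 0 < (2 * r) ^+ m by rewrite exprn_gt0// mulr_gt0.
have p3 : 0 < (3 * r) ^+ m by rewrite exprn_gt0// mulr_gt0.
have eta0 : 0 < eta by rewrite lt_min d0 divr_gt0// mulr_gt0.
have [eta1 eta2] : eta <= d /\ eta <= d * e1 ^+ m / (2 * r) ^+ m.
  by rewrite /eta !ge_min !lexx orbT.
have [N hN] := hy eta eta0; exists N => k z Nk zx.
have zy : nm (z - y) < 2 * r by have := nmBD z x y; rewrite (nmB x y); lra.
have [ze|ze] := leP (nm (z - y)) e1.
  by apply: le_trans eta1; apply: hN => //; lra.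
have zr : nm (z - y) < 3 * r by lra.
have Vd w : nm (w - y) <= 3 * r -> V w.
  by move=> wr; apply: hV; have := nmBD w y x; lra.
apply: le_trans (annulus_bound m e10 e1r (fun w wr => D_cdiff k (Vd w wr)) _ (DM k) ze zr) _.
  by move=> w we; apply: hN => //; exact: le_lt_trans e1e.
have zm : nm (z - y) ^+ m <= (2 * r) ^+ m by rewrite lerXn2r ?nnegrE ?nm_ge0 ?mulr_ge0 ?ltW.
have z0 : 0 <= nm (z - y) ^+ m by rewrite exprn_ge0// nm_ge0.
have q1 : eta / e1 ^+ m * (2 * r) ^+ m <= d.
  rewrite mulrAC ler_pdivrMr//; move: eta2; rewrite ler_pdivlMr//.
have q2 : M / (3 * r) ^+ m * (2 * r) ^+ m <= d.
  apply: le_trans hm; rewrite -mulrA le_eqVlt; apply/orP; left; apply/eqP; congr (_ * _).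
  rewrite -exprVn -exprMn; congr (_ ^+ _); field; by rewrite gt_eqF.
have M0 : 0 <= M by apply: le_trans (DM 0%N y _); rewrite ?nm_ge0// subrr nm0 mulr_ge0// ltW.
case: (leP (eta / e1 ^+ m) (M / (3 * r) ^+ m)) => _.
  by apply: le_trans q2; rewrite ler_wpM2l// divr_ge0// ltW.
by apply: le_trans q1; rewrite ler_wpM2l// divr_ge0// ltW.
Qed.

(** The non-vanishing points of V form a set Z that is open by spreading, relatively closed because
    vanishing is an open condition, and disjoint from the basin. So Z is empty by [disjoint_ext],
    and the derivatives tend to 0 at alpha, where their modulus is 1. *)
Theorem no_invariant_branch : False.
Proof.
pose Z := V `&` [set z | ~ vanishing z].
have vopen z : vanishing z -> exists2 r : R, 0 < r & forall y, nm (y - z) < r -> vanishing y.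
  move=> [Vz [r r0 hr]]; have [s s0 hs] := (openCP _).1 oV z Vz.
  exists (Num.min s (r / 2)); first by rewrite lt_min s0 divr_gt0.
  move=> y; rewrite lt_min => /andP[/hs Vy yr]; split => //.
  exists (r / 2); first by rewrite divr_gt0.
  move=> d /hr[N hN]; exists N => k w Nk wy; apply: hN => //.
  by have := nmBD w y z; lra.
have oZ : open Z.
  apply/openCP => z [Vz nz]; have [s s0 hs] := (openCP _).1 oV z Vz.
  pose r := s / 8; have r0 : 0 < r by rewrite divr_gt0.
  have E : 8 * r = s by rewrite /r; field.
  exists r => // y yz; split; first by apply: hs; lra.
  move=> /= vy; apply: nz; apply: (vanishing_spread r0 _ yz vy) => w.
  by rewrite E; exact: hs.
have cZ : relcl Z G.
  move=> z hz; have [|Vz|] := @cV z; [|left|by right].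
    by move=> e /hz[y [Vy _] yz]; exists y.
  split=> // /vopen[r r0 hr]; have [y [_ ny] yz] := hz r r0.
  by apply: ny; exact: hr.
have Zempty z : ~ Z z.
  move=> Zz; have Vz : V z by case: Zz.
  apply: (@disjoint_ext R c Z V G F) Zz Vz => //.
  by move=> y Ky [Vy ny] _; apply: ny; exact: vanishing_basin.
have [_ [r r0 hr]] : vanishing alpha.
  by apply: contrapT => na; exact: (Zempty alpha).
have [N hN] := hr (1 / 2) (divr_gt0 ltr01 (ltr0Sn _ 1)).
have := hN N alpha (leqnn N); rewrite subrr nm0 D_alpha => /(_ r0).
lra.
Qed.

End InverseBranch.

(** * Sectors under angle doubling *)

Section Sectors.
Variable R : realType.
Local Notation C := (Cplx R).
Variables (c : C) (phi : C -> C) (alpha : C).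
Local Notation f := (quadratic c).
Local Notation K := (filled_julia f).
Hypothesis ext : exterior_map K phi.
Hypothesis falpha : f alpha = alpha.
Hypothesis alpha1 : nm (2%:R * alpha) = 1.
Local Notation ray := (ray c phi).
Local Notation lands := (lands c phi).
Local Notation ray_pair := (ray_pair c phi).
Local Notation sides := (sides c phi).
Implicit Types (a b x r t : R) (p z : C) (I O : set C).

Let Kalpha : K alpha := fixed_in_K falpha alpha1.

Definition good_orbit p : Prop := (forall k, iter k f p != 0) /\
  (forall i j, iter i f p = iter j f p -> i = j).

Lemma good_f p : good_orbit p -> good_orbit (f p).
Proof.
move=> [p0 pi]; split=> [k|i j]; rewrite -!iterSr//.
by move=> /pi [].
Qed.

Lemma good_iter p n : good_orbit p -> good_orbit (iter n f p).
Proof. by move=> gp; elim: n => [//|n IH]; rewrite iterS; exact: good_f. Qed.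

Let iterN k p : iter k.+1 f (- p) = iter k.+1 f p.
Proof. by rewrite !iterSr /quadratic sqrrN. Qed.

Lemma good_opp p : good_orbit p -> good_orbit (- p).
Proof.
move=> [p0 pi].
have N i : - p <> iter i.+1 f p.
  move=> E; have := congr1 f E; rewrite -[f (- p)]/(iter 1 f (- p)) iterN.
  by rewrite -iterS => /pi.
split=> [[|k]|[|i] [|j]].
- by rewrite /= oppr_eq0; exact: (p0 0%N).
- by rewrite iterN; exact: p0.
- by [].
- by rewrite iterN => /N.
- by rewrite iterN => /esym/N.
- by rewrite !iterN => /pi.
Qed.

Lemma good_neq_alpha p : good_orbit p -> p <> alpha.
Proof. by move=> [_ pi] pa; have := pi 0%N 1%N; rewrite /= pa falpha => /(_ erefl). Qed.

(* [(a, b)] is the angular sector cut off by the two rays on the side not containing [alpha]. *)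
Definition sector a b p : Prop := [/\ a < b < a + 1, lands a p, lands b p &
  exists I O, sides a b p I O /\ O alpha].

Lemma alpha_side a b p : a < b < a + 1 -> lands a p -> lands b p -> p <> alpha ->
  exists I O, sides a b p I O /\ (I alpha \/ O alpha).
Proof.
move=> ab la lb pa; have [I [ O h]] := sides_ex ext ab la lb.
exists I, O; split => //; case: (sides_cover h alpha) => [|[|]]; [by left|by right|].
by move=> /(ray_pair_basin ext)/(_ Kalpha)/esym.
Qed.

Lemma sector_of_pair a b p : a < b < a + 1 -> lands a p -> lands b p -> p <> alpha ->
  exists a' b', sector a' b' p.
Proof.
move=> ab la lb pa; have [I [ O [h [Ia| Oa]]]] := alpha_side ab la lb pa; last first.
  by exists a, b; split => //; exists I, O.
exists b, (a + 1); split => //.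
- by move: ab => /andP[? ?]; apply/andP; split; lra.
- exact: lands1.
by exists O, I; split => //; exact: sides_compl.
Qed.

(** Rays half a turn apart land at opposite points, so p would equal -p. *)
Lemma sector_half a b p : p != 0 -> lands a p -> lands b p -> b - a <> 1 / 2.
Proof.
move=> p0 la lb E; have bE : b = a + 1 / 2 by lra.
have := lands_uniq lb; rewrite bE => /(_ _ (lands_half ext Kalpha la)) pN.
move: p0; have : 2%:R * p == 0 by rewrite mulrDl mul1r {1}pN addNr.
rewrite mulf_eq0 => /orP[|/eqP->]; last by rewrite eqxx.
by have : nm (2%:R : C) != 0; [rewrite nmZn pnatr_eq0|rewrite nm_eq0 => /negPf->].
Qed.

(** The fibre of f over alpha is alpha and -alpha. Were alpha inside the doubled sector, one of the
    two would be in I by [doubling_out]. *)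
Lemma sector_double a b p I O : b - a < 1 / 2 -> a < b < a + 1 -> lands a p -> lands b p ->
  sides a b p I O -> O alpha -> ~ I (- alpha) -> f p <> alpha -> sector (2 * a) (2 * b) (f p).
Proof.
move=> ba /andP[ab _] la lb h Oa NIa pa.
have ab2 : 2 * a < 2 * b < 2 * a + 1 by apply/andP; split; lra.
have la2 := lands_double ext Kalpha la; have lb2 := lands_double ext Kalpha lb.
have [I2 [ O2 [h2 I2O2]]] := alpha_side ab2 la2 lb2 pa.
split => //; exists I2, O2; split => //; case: I2O2 => // I2a.
have h1 := sides_neg ext Kalpha h.
have := doubling_out ext Kalpha ab ba h h1 h2 (z := alpha).
by rewrite falpha => /(_ I2a)[/(sides_disj h)/(_ Oa)|].
Qed.

(** A sector below 1/2 is doubled as long as it misses -alpha. If it contains -alpha, the opposite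
    of its complement misses alpha and has opening 1 - (b - a) > 1/2. The integer n bounds the
    number of doublings. *)
Lemma large_sector n a b p : good_orbit p -> sector a b p -> 1 / 2 <= 2 ^+ n * (b - a) ->
  exists a' b' p', [/\ good_orbit p', sector a' b' p' & 1 / 2 < b' - a'].
Proof.
elim: n a b p => [|n IH] a b p gp sp len.
  exists a, b, p; split => //; have {}len : 1 / 2 <= b - a by rewrite expr0 in len; lra.
  rewrite lt_neqAle len andbT; apply/eqP => /esym.
  by case: sp => _ la lb _; exact: sector_half (gp.1 0%N) la lb.
have [h|h] := ltP (1 / 2) (b - a); first by exists a, b, p.
have [ab la lb [I [ O [hs Oa]]]] := sp.
have ba : b - a < 1 / 2.
  by rewrite lt_neqAle h andbT; apply/eqP; exact: sector_half (gp.1 0%N) la lb.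
have [Ia|NIa] := pselect (I (- alpha)).
  exists (b + 1 / 2), (a + 1 / 2 + 1), (- p); split; first exact: good_opp.
    split; [by move: ab => /andP[? ?]; apply/andP; split; lra|exact: (lands_half ext Kalpha)| |].
      by apply: lands1; exact: (lands_half ext Kalpha).
    exists [set z | O (- z)], [set z | I (- z)]; split => //.
    exact: sides_compl (sides_neg ext Kalpha hs).
  lra.
apply: (IH (2 * a) (2 * b) (f p)); first exact: good_f.
  by apply: (sector_double ba ab la lb hs Oa NIa); exact/good_neq_alpha/good_f.
by move: len; rewrite exprSr -mulrA mulrBr.
Qed.

(** * The first return of a large sector *)

Section Return.
Variables (a b : R) (p : C).
Hypothesis gp : good_orbit p.
Hypothesis sp : sector a b p.
Hypothesis ab_large : 1 / 2 < b - a.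

(** W_1 is the complement of the doubled complement of W. It runs from 2a + 1 to 2b, one turn less
    than the doubled interval, and the later sectors are plain doubles of it. *)
Let wA i := if i is j.+1 then 2 ^+ j * (2 * a + 1) else a.
Let wB i := if i is j.+1 then 2 ^+ j * (2 * b) else b.
Let p_ i := iter i f p.

Let wAS i : wA i.+2 = 2 * wA i.+1.
Proof. by rewrite /wA exprS mulrA. Qed.
Let wBS i : wB i.+2 = 2 * wB i.+1.
Proof. by rewrite /wB exprS -!mulrA. Qed.

Let abI : a < b < a + 1. Proof. by case: sp. Qed.

Let p_neq i j : i <> j -> p_ i <> p_ j.
Proof. by move=> ij /gp.2. Qed.

Let p_alpha i : p_ i <> alpha.
Proof. exact/good_neq_alpha/good_iter. Qed.

(** Up to whole turns, W_i lies in the angular complement (b, a + 1) of W. *)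
Let inU i := exists k : int, b < wA i + k%:~R /\ wB i + k%:~R < a + 1.

Let sector1 : sector (wA 1) (wB 1) (p_ 1).
Proof.
have [/andP[ab ba] la lb [I [ O [h Oa]]]] := sp.
have h' := sides_compl h; have la1 := lands1 la; have abl := ab_large.
have lb2 := lands_double ext Kalpha lb; have la2 := lands_double ext Kalpha la1.
have b1 : b < a + 1 by [].
have b2 : a + 1 - b < 1 / 2 by lra.
have bI : 2 * b < 2 * (a + 1) < 2 * b + 1 by apply/andP; split; lra.
have [I2 [ O2 h2]] := sides_ex ext bI lb2 la2.
have := doubling_in ext Kalpha b1 b2 lb h' h2 Oa; rewrite falpha => I2a.
have h3 := sides_shift (-1) (sides_compl h2).
have E1 : 2 * (a + 1) + (-1)%:~R = wA 1 by rewrite /wA expr0 rmorphN1; ring.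
have E2 : 2 * b + 1 + (-1)%:~R = wB 1 by rewrite /wB expr0 rmorphN1; ring.
rewrite E1 E2 in h3; split.
- by rewrite -E1 -E2 rmorphN1; apply/andP; split; lra.
- by rewrite -E1; exact: lands_int.
- by rewrite /wB expr0 mul1r.
by exists O2, I2.
Qed.

(** The complement of W is narrower than 1/2, so W_i turned by half a turn lies in W. Hence -alpha
    in the inner side of W_i would put alpha inside W, and [sector_double] applies. *)
Let sectorS i : sector (wA i.+1) (wB i.+1) (p_ i.+1) -> inU i.+1 ->
  sector (wA i.+2) (wB i.+2) (p_ i.+2).
Proof.
move=> [wI lA lB [I [ O [h Oa]]]] [k [k1 k2]].
have [/andP[ab ba] la lb [I0 [ O0 [h0 O0a]]]] := sp; have abl := ab_large.
have /andP[w1 w2] := wI.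
rewrite wAS wBS.
have wl : wB i.+1 - wA i.+1 < 1 / 2 by lra.
suff NI : ~ I (- alpha) by exact: (sector_double wl wI lA lB h Oa NI (@p_alpha i.+2)).
move=> Ia.
have h1 := sides_shift (k - 1) (sides_neg ext Kalpha h).
have l1 := lands_int (k - 1) (lands_half ext Kalpha lA).
have kE : ((k - 1)%:~R : R) = k%:~R - 1 by rewrite rmorphB.
rewrite kE in h1 l1.
have pp : - p_ i.+1 <> p_ 0.
  move=> E; have := good_opp gp => -[_ inj]; have := congr1 f E.
  rewrite -[f (- _)]/(iter 1 f (- p_ i.+1)) iterN -[iter 1 f (p_ i.+1)]/(p_ i.+2) -[f (p_ 0)]/(p_ 1).
  by move=> /gp.2.
have [sub _] := sides_sub ext h0 h1 la l1 ltac:(lra) ltac:(lra) ltac:(lra) ltac:(lra) pp.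
by have := sub alpha Ia => /(sides_disj h0)/(_ O0a).
Qed.

Let sector_up n : (forall i, (0 < i)%N -> (i < n)%N -> inU i) ->
  forall i, (i <= n)%N -> sector (wA i) (wB i) (p_ i).
Proof.
move=> hU [_|i]; first exact: sp.
elim: i => [_|i IH i_n]; first exact: sector1.
by apply: sectorS; [exact/IH/ltnW|exact: hU].
Qed.

(** The openings double at each step, so the sectors cannot all fit in an arc shorter than 1/2. *)
Lemma first_return : exists n, [/\ (0 < n)%N, ~ inU n & forall i, (0 < i)%N -> (i < n)%N -> inU i].
Proof.
have ex : exists n, `[< ~ inU n.+1 >].
  apply: contrapT => nex.
  have hU i : inU i.+1 by apply: contrapT => ni; apply: nex; exists i; apply/asboolP.
  have abl := ab_large.
  pose w := wB 1 - wA 1; have w0 : 0 < w by case: sector1 => /andP[w1 _] _ _ _; rewrite subr_gt0.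
  have len i : 2 ^+ i * w < 1.
    have [k [k1 k2]] := hU i.
    have -> : 2 ^+ i * w = wB i.+1 - wA i.+1 by rewrite /w /wB /wA expr0; ring.
    lra.
  pose n := (Num.truncn w^-1).+1.
  have := len n; apply/negP; rewrite -leNgt -ler_pdivrMr// mul1r.
  apply: le_trans (ltW (truncnS_gt _)) _.
  by rewrite -natrX ler_nat ltnW// ltn_expl.
have := ex_minnP ex; case=> n /asboolP nU nmin; exists n.+1; split => // -[//|i] _ i_n.
apply: contrapT => ni; have := nmin i; rewrite asboolE => /(_ ni).
by rewrite leqNgt -ltnS i_n.
Qed.

(** Both rays land at p_n, which differs from p and so belongs to one of the two open sides; a
    landing ray ends up on the side of its landing point. *)
Lemma same_side n : p_ n <> p -> lands (wA n) (p_ n) -> lands (wB n) (p_ n) ->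
  (exists k k' : int, a < wA n + k%:~R < b /\ a < wB n + k'%:~R < b) \/
  (exists k k' : int, b < wA n + k%:~R < a + 1 /\ b < wB n + k'%:~R < a + 1).
Proof.
move=> pn lA lB; have [/andP[ab ba] la lb [I [ O [h Oa]]]] := sp.
have place t : lands t (p_ n) -> exists k : int, a < t + k%:~R < b \/ b < t + k%:~R < a + 1.
  move=> lt; pose k := - Num.floor (t - a); exists k.
  have := floor_le (t - a); have := floorD1_gt (t - a).
  rewrite /k rmorphN rmorphD/= => h1 h2; set j := (Num.floor (t - a)) in h1 h2 *.
  have na : a <> t + (- j)%:~R by exact: (lands_rays lt la pn).
  have nb : b <> t + (- j)%:~R by exact: (lands_rays lt lb pn).
  rewrite rmorphN/= in na nb.
  have [h3|h3|h3] := ltgtP (t - j%:~R) b.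
  - by left; rewrite andbT lt_neqAle; apply/andP; split; [exact/eqP|lra].
  - by right; apply/andP; split => //; lra.
  - by case: nb.
have onI t k : a < t + k%:~R < b -> forall r, 1 < r -> I (ray t r).
  by move=> tk r r1; rewrite -(ray_int _ _ _ _ k); exact: (sides_I h).
have onO t k : b < t + k%:~R < a + 1 -> forall r, 1 < r -> O (ray t r).
  by move=> tk r r1; rewrite -(ray_int _ _ _ _ k); exact: (sides_O h).
have mixed t t' k k' : lands t (p_ n) -> lands t' (p_ n) -> a < t + k%:~R < b ->
    b < t' + k'%:~R < a + 1 -> False.
  move=> lt lt' tk tk'; case: (sides_cover h (p_ n)) => [Ip|[ Op|]].
  - have [r r1 Ir] := lands_in_open lt' (sides_openI h) Ip.
    exact: (sides_disj h Ir (onO _ _ tk' r r1)).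
  - have [r r1 Or] := lands_in_open lt (sides_openO h) Op.
    exact: (sides_disj h (onI _ _ tk r r1) Or).
  - by move=> /(ray_pair_basin ext)/(_ lA.1).
have [k hk] := place _ lA; have [k' hk'] := place _ lB.
case: hk hk' => [hk|hk] [hk'|hk'].
- by left; exists k, k'.
- by case: (mixed _ _ _ _ lA lB hk hk').
- by case: (mixed _ _ _ _ lB lA hk' hk).
- by right; exists k, k'.
Qed.

(* If the returning sector contained the first one, the complement of the sectors would be
   invariant under angle doubling, which is impossible for a set containing an interval. *)
Lemma no_expanding_return n : (0 < n)%N -> (forall i, (0 < i)%N -> (i < n)%N -> inU i) ->
  forall m : int, wA n + m%:~R < a -> b < wB n + m%:~R -> False.
Proof.
move=> n0 hU m m1 m2; have /andP[ab ba] := abI; have abl := ab_large.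
pose AV x := forall i (k : int), (i < n)%N -> wA i <= x + k%:~R -> x + k%:~R <= wB i -> False.
have parity (j : int) : exists l : int, j = l * 2 \/ j = l * 2 + 1.
  by exists (j %/ 2)%Z; have := divz_eq j 2; have := modz_ge0 j (isT : 2 != 0 :> int);
     have := ltz_pmod j (isT : 0 < 2 :> int); lia.
(* Halving an angle of W_(i+1) gives an angle of W_i or, for an odd number of turns, one half a turn
   away, hence in W. For i = 1 both halves lie in W. *)
have half i x (j : int) : (0 < i)%N -> (i <= n)%N -> AV x -> wA i <= 2 * x + j%:~R ->
    2 * x + j%:~R <= wB i -> False.
  case: i => [//|[|i]] _ i_n Ax; have [l jl] := parity j.
    rewrite /wA /wB expr0 !mul1r => h1 h2.
    case: jl h1 h2 => ->; rewrite ?intrD intrM ?mulr1z => h1 h2.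
      by apply: (Ax 0%N l n0); rewrite /wA /wB; lra.
    by apply: (Ax 0%N l n0); rewrite /wA /wB; lra.
  rewrite wAS wBS => h1 h2; case: jl h1 h2 => ->; rewrite ?intrD intrM ?mulr1z => h1 h2.
    by apply: (Ax i.+1 l i_n); lra.
  have [k [k1 k2]] := hU i.+1 isT i_n.
  by apply: (Ax 0%N (l + k) n0); rewrite /wA /wB intrD; lra.
(* For W itself the assumption enters that a translate of W_n covers W, so the case n of the
   previous step applies. *)
have AV2 x : AV x -> AV (2 * x).
  move=> Ax [|i] k i_n h1 h2; last exact: (half i.+1 x k isT (ltnW i_n) Ax h1 h2).
  by apply: (half n x (k - m) n0 (leqnn n) Ax); rewrite intrB; rewrite /wA /wB in h1 h2; lra.
(* Finitely many sectors end strictly before a + 1, so a common gap remains to the left of a modulo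
   one turn. *)
have [e e0 he] : exists2 e : R, 0 < e & forall i, (0 < i)%N -> (i < n)%N ->
    exists k : int, b < wA i + k%:~R /\ wB i + k%:~R <= a + 1 - e.
  elim: n hU {n0 m1 m2 AV half AV2} => [_|n IH hU]; first by exists 1.
  have [|e e0 he] := IH; first by move=> i i0 i_n; apply: hU => //; exact: ltnW.
  case: n hU he {IH} => [hU he|n hU he]; first by exists e => // -[|i].
  have [k [k1 k2]] := hU n.+1 isT (ltnSn _).
  exists (Num.min e (a + 1 - (wB n.+1 + k%:~R))); first by rewrite lt_min e0 subr_gt0.
  have [me mk] : Num.min e (a + 1 - (wB n.+1 + k%:~R)) <= e /\
     Num.min e (a + 1 - (wB n.+1 + k%:~R)) <= a + 1 - (wB n.+1 + k%:~R).
    by rewrite !ge_min !lexx orbT.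
  move=> i i0; rewrite ltnS leq_eqVlt => /predU1P[->|i_n]; first by exists k; split => //; lra.
  by have [k' [k1' k2']] := he i i0 i_n; exists k'; split => //; lra.
pose e' := Num.min e (a + 1 - b) / 2.
have me0 : 0 < Num.min e (a + 1 - b) by rewrite lt_min e0; lra.
have [me1 me2] : Num.min e (a + 1 - b) <= e /\ Num.min e (a + 1 - b) <= a + 1 - b.
  by rewrite !ge_min !lexx orbT.
have e'0 : 0 < e' by rewrite divr_gt0.
have int1 (k : int) : (k%:~R : R) < 1 -> (k%:~R : R) <= 0.
  by rewrite -[X in _ < X]/(1%:~R) ltr_int -[X in _ <= X]/(0%:~R) ler_int; lia.
have start x : a - e' < x -> x < a -> AV x.
  move=> x1 x2 [|i] k i_n; rewrite /e' in x1.
    rewrite /wA /wB => h1 h2.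
    have [k0|k0] := ltP (k%:~R : R) 1; first by have := int1 k k0; lra.
    lra.
  have [j [j1 j2]] := he i.+1 isT i_n => h1 h2.
  have [k0|k0] := ltP ((k + j)%:~R : R) 1.
    by have := int1 _ k0; rewrite intrD; lra.
  have [k3|k3] := ltP ((k + j - 1)%:~R : R) 1.
    by have := int1 _ k3; rewrite intrB intrD ?mulr1z in k0 k3 *; lra.
  by rewrite intrB intrD ?mulr1z in k0 k3; lra.
have all_m q x : a - e' < x -> x < a -> AV (2 ^+ q * x).
  move=> x1 x2; elim: q => [|q IH]; first by rewrite expr0 mul1r; exact: start.
  by rewrite exprS -mulrA; exact: AV2.
(* Enough doublings stretch the interval below a to length more than 2, so that it contains a
   translate of the endpoint a of W. *)
pose q := (Num.truncn (2 / e')).+1.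
have q1 : 2 < 2 ^+ q * e'.
  rewrite -ltr_pdivrMr//; apply: lt_le_trans (truncnS_gt _) _.
  by rewrite -natrX ler_nat ltnW// ltn_expl.
set s : R := 2 ^+ q in q1; have s0 : 0 < s by rewrite /s exprn_gt0.
pose l := Num.floor (s * a - a) - 1.
have l1 := floor_le (s * a - a); have l2 := floorD1_gt (s * a - a).
have lE : (l%:~R : R) = (Num.floor (s * a - a))%:~R - 1 by rewrite /l rmorphB.
rewrite rmorphD/= in l2.
pose x := (a + l%:~R) / s.
have sx : s * x = a + l%:~R by rewrite /x mulrC divfK// gt_eqF.
have x1 : a - e' < x by rewrite ltr_pdivlMr//; lra.
have x2 : x < a by rewrite ltr_pdivrMr//; lra.
have := all_m q x x1 x2 0%N (- l) n0; rewrite -/s sx rmorphN/= addrK /wA /wB lexx.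
by move=> /(_ isT (ltW ab)).
Qed.

(** V is the intersection of the outer sides. It lies outside W, whose opening exceeds 1/2, so it
    never contains both z and -z. A point w of V has a square root z outside W; if z were in or on
    W_i, then w would be in or on W_(i+1). *)
Lemma no_contracting_return n : (0 < n)%N -> (forall i, (0 < i)%N -> (i < n)%N -> inU i) ->
  forall k : int, a < wA n + k%:~R -> wB n + k%:~R < b -> False.
Proof.
move=> n0 hU k k1 k2; have /andP[ab ba] := abI; have abl := ab_large.
have hsec := sector_up hU.
have /choice[S hS] : forall i, exists IO : set C * set C, (i <= n)%N ->
    sides (wA i) (wB i) (p_ i) IO.1 IO.2 /\ IO.2 alpha.
  move=> i; have [i_n|i_n] := leqP i n; last by exists (set0, set0).
  by have [_ _ _ [I [ O h]]] := hsec i i_n; exists (I, O).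
pose I_ i := (S i).1; pose O_ i := (S i).2.
have hs i : (i <= n)%N -> sides (wA i) (wB i) (p_ i) (I_ i) (O_ i) by move=> /hS[].
have Oal i : (i <= n)%N -> O_ i alpha by move=> /hS[].
pose V := [set z : C | forall i, (i < n)%N -> O_ i z].
pose G := [set z : C | exists2 i, (i < n)%N & ray_pair (wA i) (wB i) (p_ i) z].
have h0 := hs 0%N (leq0n n).
have lA i : (i <= n)%N -> lands (wA i) (p_ i) by move=> /hsec[].
have lB i : (i <= n)%N -> lands (wB i) (p_ i) by move=> /hsec[].
have h0c := sides_compl h0.
have b2 : a + 1 - b < 1 / 2 by lra.
have V0 z : V z -> O_ 0%N z by move=> Vz; exact: Vz.
have VN z : V z -> V (- z) -> False.
  move=> /V0 O1 /V0 O2.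
  exact: (doubling_disj ext Kalpha ba b2 h0c (sides_neg ext Kalpha h0c) O1 O2).
have root w : V w -> exists z, V z /\ f z = w.
  move=> Vw.
  (* The last sector W_n lies in W, so V avoids it too; this closes the induction at i = n - 1. *)
  have On : O_ n w.
    have hn := sides_shift k (hs n (leqnn n)).
    have ln := lands_int k (lA n (leqnn n)).
    have [/andP[w1 w2] _ _ _] := hsec n (leqnn n).
    have pn : p_ n <> p_ 0 by apply: p_neq; case: (n) n0.
    have [s1 s2] := sides_sub ext h0 hn (lA 0%N (leq0n n)) ln k1 ltac:(lra) k2 ba pn.
    case: (sides_cover hn w) => [/s1 Iw|[//|/s2 Iw]].
      by case: (sides_disj h0 Iw (V0 _ Vw)).
    by case: (sides_disj h0 Iw (V0 _ Vw)).
  have Oj j : (j <= n)%N -> O_ j w.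
    by rewrite leq_eqVlt => /predU1P[->//|]; exact: Vw.
  have [z0 z0w] : exists z0 : C, f z0 = w.
    by exists (sqrtc (w - c)); rewrite /quadratic sqr_sqrtc subrK.
  have h1 : sides (2 * b) (2 * (a + 1)) (f p) (O_ 1%N) (I_ 1%N).
    have := sides_compl (hs 1%N n0).
    have -> : wB 1 = 2 * b by rewrite /wB expr0 mul1r.
    by have -> : wA 1 + 1 = 2 * (a + 1) by rewrite /wA expr0; ring.
  have [z Oz zw] : exists2 z, O_ 0%N z & f z = w.
    have := doubling_out ext Kalpha ba b2 h0c (sides_neg ext Kalpha h0c) h1 (z := z0).
    rewrite z0w => /(_ (Oj 1%N n0))[ Oz| Oz]; first by exists z0.
    by exists (- z0) => //; rewrite /quadratic sqrrN.
  exists z; split => // -[//|i] i_n.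
  have hi := hs i.+1 (ltnW i_n); have hi1 := hs i.+2 i_n; rewrite wAS wBS in hi1.
  have [/andP[w1 w2] _ _ _] := hsec i.+1 (ltnW i_n).
  have [j [j1 j2]] := hU i.+1 isT i_n.
  have w3 : wB i.+1 - wA i.+1 < 1 / 2 by lra.
  case: (sides_cover hi z) => [Iz|[//|Gz]].
    have := doubling_in ext Kalpha w1 w3 (lA _ (ltnW i_n)) hi hi1 Iz.
    by rewrite zw => /(sides_disj hi1)/(_ (Oj i.+2 i_n)).
  have : ray_pair (2 * wA i.+1) (2 * wB i.+1) (f (p_ i.+1)) (f z).
    by apply/(ray_pair_double ext Kalpha); left.
  by rewrite zw => /(sides_OG hi1 (Oj i.+2 i_n)).
have /choice[g hg] : forall w, exists z, V w -> V z /\ f z = w.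
  move=> w; have [/root[z ?]|nV] := pselect (V w); first by exists z.
  by exists 0.
have oVm m : (m <= n)%N -> open [set z : C | forall i, (i < m)%N -> O_ i z].
  elim: m => [_|m IH m_n].
    have -> : [set z : C | forall i, (i < 0)%N -> O_ i z] = setT by apply/seteqP; split.
    exact: openT.
  have -> : [set z : C | forall i, (i < m.+1)%N -> O_ i z] =
      [set z : C | forall i, (i < m)%N -> O_ i z] `&` O_ m.
    apply/seteqP; split=> [z Oz|z [ Oz Om] i].
      by split=> [i i_m|]; apply: Oz; rewrite // ltnS ltnW.
    by rewrite ltnS leq_eqVlt => /predU1P[->//|]; exact: Oz.
  by apply: openI; [exact/IH/ltnW|exact: sides_openO (hs m (ltnW m_n))].
apply: (@no_invariant_branch R c phi alpha ext falpha alpha1 V G (map p_ (iota 0 n)) g).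
- exact: oVm.
- move=> z hz; have [Gz|NG] := pselect (G z); first by right.
  left=> i i_n; have [|//|Gi] := @sides_relclO _ _ _ _ _ _ _ _ (hs i (ltnW i_n)) z.
    by move=> e /hz[y Vy yz]; exists y => //; exact: Vy.
  by case: NG; exists i.
- move=> z [i i_n /(ray_pair_basin ext) zp] /zp ->; apply: map_f.
  by rewrite mem_iota.
- by move=> i i_n; apply: Oal; exact: ltnW.
- exact: VN.
- by move=> z /hg[].
- by move=> z /hg[].
Qed.

(** The ends of W_n lie both in W or both in its complement, with equal turns or one turn apart. In
    W: equal turns mean contraction, otherwise W_n covers the complement of W and contains alpha. In
    the complement: equal turns contradict the choice of n, otherwise W_n covers W. *)
Lemma sector_contradiction : False.
Proof.
have [n [n0 nU hU]] := first_return.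
have hsec := sector_up hU; have [/andP[w1 w2] lA lB [I [ O [h Oa]]]] := hsec n (leqnn n).
have [/andP[ab ba] la lb [I0 [ O0 [h0 O0a]]]] := sp; have abl := ab_large.
have pn : p_ n <> p by have := @p_neq n 0%N; apply; case: (n) n0.
have lei (u v : int) : (u%:~R : R) < v%:~R + 1 -> (u%:~R : R) <= v%:~R.
  by rewrite -[X in _ + X]/(1%:~R) -rmorphD/= ltr_int ler_int; lia.
case: (same_side pn lA lB) => -[k [k' [/andP[x1 x2] /andP[y1 y2]]]].
  have kk : (k'%:~R : R) <= k%:~R by apply: lei; lra.
  have kk' : (k%:~R : R) <= (k' + 1)%:~R by apply: lei; rewrite rmorphD/=; lra.
  rewrite rmorphD/= in kk'.
  have [E|E] : (k'%:~R : R) = k%:~R \/ (k'%:~R : R) = k%:~R - 1.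
  - have [E|E] := eqVneq k' k; first by left; rewrite E.
    right; have : (k'%:~R : R) < k%:~R by rewrite lt_neqAle kk andbT (inj_eq (@intr_inj R)).
    move=> lt; have : (k'%:~R + 1 : R) <= k%:~R.
      by move: lt; rewrite -[X in _ + X]/(1%:~R) -rmorphD/= ltr_int ler_int; lia.
    lra.
  - by apply: (no_contracting_return n0 hU x1); rewrite -E.
  have hk := sides_shift k h; have la' := lands_int k lA.
  have [s1 _] := sides_sub ext hk (sides_compl h0) la' lb x2 ba ltac:(lra) ltac:(lra) (nesym pn).
  exact: (sides_disj h (s1 alpha O0a) Oa).
have kk : (k'%:~R : R) <= k%:~R by apply: lei; lra.
have kk' : (k%:~R : R) <= (k' + 1)%:~R by apply: lei; rewrite rmorphD/=; lra.
rewrite rmorphD/= in kk'.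
have [E|E] : (k'%:~R : R) = k%:~R \/ (k'%:~R : R) = k%:~R - 1.
- have [E|E] := eqVneq k' k; first by left; rewrite E.
  right; have : (k'%:~R : R) < k%:~R by rewrite lt_neqAle kk andbT (inj_eq (@intr_inj R)).
  move=> lt; have : (k'%:~R + 1 : R) <= k%:~R.
    by move: lt; rewrite -[X in _ + X]/(1%:~R) -rmorphD/= ltr_int ler_int; lia.
  lra.
- by apply: nU; exists k; split => //; rewrite -E.
by apply: (no_expanding_return n0 hU (m := k')); lra.
Qed.

End Return.

Theorem biaccessible_orbit s t p : lands s p -> lands t p -> (forall k : int, t <> s + k%:~R) ->
  ~ good_orbit p.
Proof.
move=> ls lt st gp.
pose k := - Num.floor (t - s).
have := floor_le (t - s); have := floorD1_gt (t - s).
have kE : (k%:~R : R) = - (Num.floor (t - s))%:~R by rewrite rmorphN.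
rewrite rmorphD/= => h1 h2.
have t1 : s < t + k%:~R < s + 1.
  rewrite kE; apply/andP; split; last lra.
  rewrite lt_neqAle; apply/andP; split; last lra.
  by apply/eqP => E; apply: (st (Num.floor (t - s))); lra.
have [a [b sp]] := sector_of_pair t1 ls (lands_int k lt) (good_neq_alpha gp).
have [/andP[ab _] _ _ _] := sp.
have ba0 : 0 < b - a by rewrite subr_gt0.
pose n := (Num.truncn (b - a)^-1).+1.
have [|a' [b' [p' [gp' sp' l']]]] := @large_sector n a b p gp sp.
  apply: (@le_trans _ _ 1); first lra.
  rewrite -ler_pdivrMr// mul1r; apply: le_trans (ltW (truncnS_gt _)) _.
  by rewrite -natrX ler_nat ltnW// ltn_expl.
exact: (sector_contradiction gp' sp' l').
Qed.

End Sectors.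

(** * Measures of maximal entropy have no atoms *)

Section Shannon.
Variable R : realType.
Implicit Types x y : R.

Definition eta x : R := - (x * ln x).

Lemma eta0 : eta 0 = 0. Proof. by rewrite /eta mul0r oppr0. Qed.

Lemma eta_bound x : 0 <= x <= 1 -> 0 <= eta x <= 1.
Proof.
move=> /andP[]; rewrite le_eqVlt => /predU1P[<- _|x0 x1]; first by rewrite eta0 lexx ler01.
rewrite /eta -mulrN -lnV ?posrE//; apply/andP; split.
  by apply: mulr_ge0; [exact: ltW|rewrite ln_ge0// invf_ge1].
by rewrite mulrC -ler_pdivlMr// mul1r ltW// ln_sublinear// invr_gt0.
Qed.

Lemma etaM x y : 0 <= x -> 0 <= y -> eta (x * y) = x * eta y + y * eta x.
Proof.
rewrite le_eqVlt => /predU1P[<-|x0]; first by rewrite mul0r eta0 mul0r mulr0 addr0.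
rewrite le_eqVlt => /predU1P[<-|y0]; first by rewrite mulr0 eta0 mul0r mulr0 addr0.
by rewrite /eta lnM ?posrE//; ring.
Qed.

(** A divergent sequence has the default limit 0, so a positive [limn] certifies convergence. This
    supplies convergence for partitions of positive entropy. *)
Lemma limn_gt0_cvg (u : nat -> R) : 0 < limn u -> u @ \oo --> limn u.
Proof. by move=> h; apply: cvgNpoint; rewrite gt_eqF. Qed.

Lemma cvg_bounded_div (u : nat -> R) (M : R) : (forall n, `|u n| <= M) ->
  (fun n => u n / n%:R) @ \oo --> 0.
Proof.
move=> uM; apply/cvgrPdist_lt => e e0; near=> n.
rewrite sub0r normrN normrM normfV normr_nat.
have n0 : 0 < n%:R :> R by near: n; exists 1%N => // n /=; rewrite ltr0n.
rewrite ltr_pdivrMr//; apply: le_lt_trans (uM n) _.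
rewrite mulrC -ltr_pdivrMr//.
near: n; exists (Num.truncn (M / e)).+1 => // n /= hn.
by apply: lt_le_trans (truncnS_gt _) _; rewrite ler_nat.
Unshelve. all: by end_near. Qed.

End Shannon.

Section Atoms.
Context {d : measure_display} {T : measurableType d} {R : realType}.
Variable g : T -> T.
Hypothesis mg : measurable_fun setT g.
Implicit Types (mu : probability T R) (A B : set T).

Definition mass mu A : R := fine (mu A).

Lemma massE mu A : measurable A -> mu A = (mass mu A)%:E.
Proof.
move=> mA; rewrite /mass fineK// ge0_fin_numE//.
by apply: le_lt_trans (probability_le1 mu mA) _; rewrite ltry.
Qed.

Lemma mass_bound mu A : measurable A -> 0 <= mass mu A <= 1.
Proof.
move=> mA; rewrite -!lee_fin -massE// measure_ge0/=; exact: probability_le1.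
Qed.

Lemma massT mu : mass mu setT = 1.
Proof. by rewrite /mass probability_setT. Qed.

Lemma massU mu A B : measurable A -> measurable B -> A `&` B = set0 ->
  mass mu (A `|` B) = mass mu A + mass mu B.
Proof.
move=> mA mB AB; apply: EFin_inj.
by rewrite EFinD -!massE ?measureU//; exact: measurableU.
Qed.

Lemma mass_le mu A B : measurable A -> measurable B -> A `<=` B -> mass mu A <= mass mu B.
Proof. by move=> mA mB AB; rewrite -lee_fin -!massE// le_measure ?inE. Qed.

Lemma massDI mu A B : measurable A -> measurable B ->
  mass mu A = mass mu (A `\` B) + mass mu (A `&` B).
Proof.
move=> mA mB; apply: EFin_inj; rewrite EFinD -!massE; last 3 first.
- exact: measurableI.
- exact: measurableD.
- exact: mA.
exact: measureDI.
Qed.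

Lemma measurable_preim A : measurable A -> measurable (g @^-1` A).
Proof. by move=> mA; rewrite -[X in measurable X]setTI; exact: mg. Qed.

Definition cell k (xi : T -> 'I_k) n (w : {ffun 'I_n -> 'I_k}) : set T :=
  [set x | forall i : 'I_n, xi (iter i g x) = w i].

Section Cells.
Variables (k : nat) (xi : T -> 'I_k).
Hypothesis mxi : measurable_partition xi.

Lemma measurable_cell n (w : {ffun 'I_n -> 'I_k}) : measurable (cell xi w).
Proof.
have -> : cell xi w = \bigcap_(i in [set: 'I_n]) ((iter i g) @^-1` (xi @^-1` [set w i])).
  by apply/seteqP; split=> x h i => [_|]; exact: h.
apply: fin_bigcap_measurable; first exact: finite_finset.
move=> i _; elim: (nat_of_ord i) => [|m IH]; first exact: mxi.
by rewrite (_ : iter m.+1 g = iter m g \o g); [exact: (measurable_preim IH)|apply/funext => x; rewrite iterSr].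
Qed.

Lemma sum_mass mu n A : measurable A ->
  \sum_(w : {ffun 'I_n -> 'I_k}) mass mu (cell xi w `&` A) = mass mu A.
Proof.
move=> mA; apply: EFin_inj; rewrite -sumEFin.
rewrite (eq_bigr (fun w => mu (cell xi w `&` A))); last first.
  by move=> w _; rewrite massE//; apply: measurableI => //; exact: measurable_cell.
rewrite fsbig_seq ?index_enum_uniq// -massE//.
rewrite -measure_fin_bigcup.
- congr (mu _); apply/seteqP; split=> [x [w _ []]//|x Ax].
  exists [ffun i : 'I_n => xi (iter i g x)]; first by rewrite /= mem_index_enum.
  by split => // i; rewrite ffunE.
- exact: finite_seq.
- move=> w w' _ _ [x [[wx _] [wx' _]]]; apply/ffunP => i.
  by rewrite -wx -wx'.
- by move=> w _; apply: measurableI => //; exact: measurable_cell.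
Qed.

Lemma join_entropyE mu n : join_entropy mu g xi n = \sum_w eta (mass mu (@cell k xi n w)).
Proof. by []. Qed.

End Cells.

(** * Removing an invariant finite set from a measure *)

Section InvariantSet.
Variables (mu : probability T R) (O : seq T).
Hypothesis inv : invariant_measure mu g.
Hypothesis mO : measurable [set` O].
Hypothesis gO : forall x, x \in O -> g x \in O.

Let a := mass mu (~` [set` O]).

Let mC : measurable (~` [set` O]). Proof. exact: measurableC. Qed.

Let aE : a = 1 - mass mu [set` O].
Proof.
have := massU mu mO mC (setICr _); rewrite setUCr [LHS]massT => ->.
by rewrite /a addrC addKr.
Qed.

Let a01 : 0 <= a <= 1. Proof. exact: mass_bound. Qed.

(* At most [size O] words have a cell that meets [O]. *)
Lemma entropy_off_invariant k (xi : T -> 'I_k) n : measurable_partition xi ->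
  `|join_entropy mu g xi n - \sum_w eta (mass mu (@cell k xi n w `\` [set` O]))| <= (size O)%:R.
Proof.
move=> mxi; rewrite join_entropyE -sumrB.
pose word x := [ffun i : 'I_n => xi (iter i g x)].
pose W := [set w in map word O]%SET.
have off w : w \notin W -> cell xi w `\` [set` O] = cell xi w.
  move=> wW; apply/seteqP; split=> [x []//|x wx]; split => // /= xO.
  move: wW; rewrite inE => /negP; apply; apply/mapP; exists x => //.
  by apply/ffunP => i; rewrite ffunE wx.
rewrite (bigID (mem W))/= [X in _ + X]big1 ?addr0; last by move=> w /off ->; rewrite subrr.
apply: le_trans (ler_norm_sum _ _ _) _.
have mcell w := @measurable_cell _ _ mxi n w.
apply: (@le_trans _ _ (\sum_(w in W) 1)); last first.
  by rewrite sumr_const ler_nat cardsE (leq_trans (card_size _))// size_map.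
apply: ler_sum => w _.
have /andP[h1 h2] := eta_bound (mass_bound mu (mcell w)).
have /andP[h3 h4] := eta_bound (mass_bound mu (measurableD (mcell w) mO)).
by rewrite ler_norml; apply/andP; split; lra.
Qed.

(** The last argument [mu] is only the default used when the complement of O has mass 0. *)
Let nu := mnormalize (mrestr mu mC) mu.

Let nuE : 0 < a -> forall A, measurable A -> mass nu A = mass mu (A `\` [set` O]) / a.
Proof.
move=> a0 A mA.
have E0 : mu (setT `&` ~` [set` O]) = a%:E by rewrite setTI massE.
rewrite {1}/mass /nu /= /mnormalize /= /mrestr E0 /= eqe gt_eqF//= -setDE.
by rewrite (massE mu (measurableD mA mO)).
Qed.

(** O is only forward invariant, but g^-1 O contains O and has the same mass, so they differ by a
    null set. *)
Let nu_inv : 0 < a -> invariant_measure nu g.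
Proof.
move=> a0 A mA; have mgA := measurable_preim mA; rewrite (massE _ mgA) (massE _ mA) !nuE//.
congr (_ / _)%:E.
have mO' := measurable_preim mO; have mCA := measurable_preim (measurableD mA mO).
have inv' B : measurable B -> mass mu (g @^-1` B) = mass mu B.
  by move=> mB; rewrite /mass inv.
have null : mass mu (g @^-1` [set` O] `\` [set` O]) = 0.
  have := massDI mu mO' mO; rewrite inv'//.
  rewrite (_ : _ `&` _ = [set` O]); first by move/eqP; rewrite -subr_eq subrr => /eqP.
  by apply/seteqP; split=> [x []//|x xO]; split => //; exact: gO.
rewrite -[RHS]inv'; last exact: measurableD.
have E : g @^-1` A `\` [set` O] = g @^-1` (A `\` [set` O]) `|`
    ((g @^-1` A `\` [set` O]) `&` (g @^-1` [set` O] `\` [set` O])).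
  apply/seteqP; split=> [x [Ax xO]|x [[Ax gxO]|[]//]].
    by have [h|h] := pselect (g x \in O); [right|left].
  by split => // /gO.
have mD := measurableD mO' mO; have mA' := measurableD mgA mO.
rewrite {1}E massU//; last 2 first.
- exact: measurableI.
- by apply/seteqP; split=> [x [[_ gx] [_ [gx' _]]]|//].
rewrite [X in _ + X](_ : _ = 0) ?addr0//; apply/eqP; rewrite eq_le.
have /andP[-> _] := mass_bound mu (measurableI _ _ mA' mD).
rewrite andbT -null; by apply: mass_le; [exact: (measurableI _ _ mA' mD)|exact: mD|move=> x []].
Qed.

(** The identity eta (a x) = a eta x + x eta a, summed over the cells; the masses under nu add up to
    1. *)
Let entropy_nu k (xi : T -> 'I_k) n : 0 < a -> measurable_partition xi ->
  \sum_w eta (mass mu (@cell k xi n w `\` [set` O])) = a * join_entropy nu g xi n + eta a.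
Proof.
move=> a0 mxi; have mcell w := @measurable_cell _ _ mxi n w.
rewrite join_entropyE mulr_sumr -[X in _ + X]mul1r.
have <- : \sum_w mass nu (@cell k xi n w) = 1.
  have := @sum_mass _ _ mxi nu n setT measurableT; rewrite massT => <-.
  by apply: eq_bigr => w _; rewrite setIT.
rewrite mulr_suml -big_split/=; apply: eq_bigr => w _.
have E : mass mu (cell xi w `\` [set` O]) = a * mass nu (cell xi w).
  by rewrite nuE// mulrC divfK// gt_eqF.
have /andP[m0 _] := mass_bound nu (mcell w).
by rewrite E (etaM (ltW a0) m0).
Qed.

Theorem invariant_finite_null h : maximal_entropy_measure mu g -> measure_entropy mu g = h%:E ->
  0 < h -> mass mu [set` O] = 0.
Proof.
move=> [_ maxi] muh h0.
have /andP[m0 m1] := mass_bound mu mO.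
apply/eqP; rewrite eq_le m0 andbT leNgt; apply/negP => m_gt0.
have a1 : a < 1 by rewrite aE gtrBl.
have /andP[a_ge0 _] := a01.
(* The supremum need not be attained; a partition of entropy L > a h is enough, since nu then has
   entropy at least L / a > h. *)
have : ((a * h)%:E < measure_entropy mu g)%E by rewrite muh lte_fin gtr_pMl.
move=> /ereal_sup_gt[_ [k [xi [mxi ->]]]]; rewrite lte_fin => ah.
set L := partition_entropy mu g xi in ah *.
have L0 : 0 < L by apply: le_lt_trans ah; rewrite mulr_ge0// ltW.
have Lcvg : (fun n => join_entropy mu g xi n / n%:R) @ \oo --> L by exact: limn_gt0_cvg.
have [a0|a_neq0] := eqVneq a 0.
  have off_null n w : mass mu (@cell k xi n w `\` [set` O]) = 0.
    apply/eqP; rewrite eq_le -{1}a0.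
    have mw := measurableD (@measurable_cell _ _ mxi n w) mO.
    have /andP[-> _] := mass_bound mu mw.
    by rewrite andbT; apply: mass_le => // x [].
  have : (fun n => join_entropy mu g xi n / n%:R) @ \oo --> 0.
    apply: (@cvg_bounded_div _ _ (size O)%:R) => n.
    have := entropy_off_invariant n mxi.
    by rewrite [X in _ - X]big1 ?subr0// => w _; rewrite off_null eta0.
  by move=> /(cvg_unique _ Lcvg) E; move: L0; rewrite E// ltxx.
have a0 : 0 < a by rewrite lt_neqAle eq_sym a_neq0.
have nucvg : (fun n => join_entropy nu g xi n / n%:R) @ \oo --> L / a.
  pose D n := join_entropy mu g xi n - a * join_entropy nu g xi n.
  have D0 : (fun n => D n / n%:R) @ \oo --> 0.
    apply: (@cvg_bounded_div _ _ ((size O)%:R + 1)) => n.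
    have := entropy_off_invariant n mxi; rewrite entropy_nu//.
    have /andP[e0 e1] := eta_bound a01.
    rewrite opprD addrA => d1; rewrite -[D n](subrK (eta a)).
    by apply: le_trans (ler_normD _ _) (lerD d1 _); rewrite ger0_norm.
  rewrite -[L]subr0 (_ : (fun n => _) =
      (fun n => (join_entropy mu g xi n / n%:R - D n / n%:R) / a)); last first.
    by apply/funext => n; rewrite /D -mulrBl opprB addrC subrK mulrAC [a * _]mulrC mulfK.
  by apply: cvgMl; exact: cvgB.
have : ((L / a)%:E <= measure_entropy nu g)%E.
  apply: ereal_sup_ubound; exists k, xi; split => //; congr (_%:E).
  by apply/esym/cvg_lim.
have := maxi nu (nu_inv a0); rewrite muh => le1 le2.
have := le_trans le2 le1; rewrite lee_fin leNgt => /negP; apply.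
by rewrite ltr_pdivlMr// mulrC.
Qed.

End InvariantSet.

(** Mass does not decrease along an orbit, because {y} lies in g^-1 {g y}. Distinct iterates of an
    atom would exceed total mass 1; otherwise the cycle finally reached carries at least the mass of
    the atom. *)
Theorem maximal_entropy_atomless mu h : maximal_entropy_measure mu g ->
  measure_entropy mu g = h%:E -> 0 < h -> (forall x : T, measurable [set x]) ->
  forall x, mu [set x] = 0%E.
Proof.
move=> maxi muh h0 m1 x; have inv := maxi.1.
rewrite massE//; congr (_%:E); apply/eqP; rewrite eq_le.
have /andP[x0 _] := mass_bound mu (m1 x); rewrite x0 andbT leNgt; apply/negP => xpos.
have mseq (s : seq T) : measurable [set` s].
  elim: s => [|y s IH]; first by rewrite set_nil.
  rewrite (_ : [set` _] = [set y] `|` [set` s]); first exact: measurableU.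
  apply/seteqP; split=> z /=; rewrite inE; first by move=> /predU1P[->|]; [left|right].
  by move=> [->|->]; rewrite ?eqxx ?orbT.
have grow n : mass mu [set x] <= mass mu [set iter n g x].
  elim: n => [//|n /le_trans]; apply.
  have -> : mass mu [set iter n.+1 g x] = mass mu (g @^-1` [set iter n.+1 g x]).
    by rewrite /mass inv.
  by apply: mass_le => //; [exact: measurable_preim|move=> _ ->].
have [uq|] := pselect (forall n, uniq (traject g x n)).
  have big n : n%:R * mass mu [set x] <= mass mu [set` traject g x n].
    elim: n => [|n IH]; first by rewrite mul0r; case/andP: (mass_bound mu (mseq (traject g x 0))).
    have := uq n.+1; rewrite trajectSr rcons_uniq => /andP[xn _].
    have -> : [set` rcons (traject g x n) (iter n g x)] = [set` traject g x n] `|` [set iter n g x].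
      apply/seteqP; split=> y /=.
        by rewrite mem_rcons inE => /predU1P[->|]; [right|left].
      by rewrite mem_rcons inE => -[->|->]; rewrite ?orbT ?eqxx.
    rewrite massU//; last first.
      by apply/seteqP; split=> [y [/= yn ye]|//]; move: xn; rewrite -ye yn.
    by rewrite -addn1 natrD mulrDl mul1r lerD.
  pose n := (Num.truncn (mass mu [set x])^-1).+1.
  have /andP[_] := mass_bound mu (mseq (traject g x n)); apply/negP; rewrite -ltNge.
  apply: lt_le_trans (big n); rewrite -ltr_pdivrMr// mul1r; exact: truncnS_gt.
move=> /existsNP[[//|n]] nuq.
have /trajectP[i i_n E] : looping g x n by apply: negbNE; rewrite -looping_uniq; exact/negP.
pose O := traject g (iter i g x) (n - i).
have itO m : iter m g (iter i g x) \in O.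
  apply/loopingP/trajectP; exists 0%N; first by rewrite subn_gt0.
  by rewrite -iterD subnK// ltnW.
have gO y : y \in O -> g y \in O by move=> /trajectP[m _ ->]; exact: (itO m.+1).
have := invariant_finite_null inv (mseq O) gO maxi muh h0.
apply/eqP; rewrite gt_eqF//; apply: lt_le_trans xpos (le_trans (grow i) _).
by apply: mass_le => // y ->; exact: (itO 0%N).
Qed.

End Atoms.

(** * Nullity of the biaccessible set *)

Section Periodic.
Variables (R : realType) (c : Cplx R).
Local Notation C := (Cplx R).
Local Notation f := (quadratic c).

Let iterate_poly m : {poly R[i]} := iter m (fun q => q ^+ 2 + (c : R[i])%:P) 'X.

Let iterate_polyE m (z : C) : (iterate_poly m).[z : R[i]] = iter m f z.
Proof.
elim: m => [|m IH]; first by rewrite /iterate_poly /= hornerX.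
by rewrite /iterate_poly iterS hornerD hornerC horner_exp -/(iterate_poly m) IH.
Qed.

Let size_iterate_poly m : size (iterate_poly m) = (2 ^ m).+1.
Proof.
elim: m => [|m IH]; first by rewrite /iterate_poly /= size_polyX.
have sq : size (iterate_poly m ^+ 2) = (2 ^ m.+1).+1.
  rewrite expr2 size_mul -?size_poly_eq0 ?IH//= expnS mul2n -addnn; lia.
rewrite /iterate_poly iterS -/(iterate_poly m) size_polyDl ?sq//.
by rewrite (leq_ltn_trans (size_polyC_leq1 _))// ltnS expn_gt0.
Qed.

(** The points are roots of a polynomial of degree 2^(m+1) > 1, which is not zero. *)
Lemma finite_periodic m : exists s : seq C, forall z, iter m.+1 f z = z -> z \in s.
Proof.
pose q := iterate_poly m.+1 - 'X.
have q0 : q != 0.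
  rewrite -size_poly_eq0 size_polyDl; first by rewrite size_iterate_poly.
  by rewrite size_polyN size_polyX size_iterate_poly expnS; have := expn_gt0 2 m; lia.
have [s qs] := closed_field_poly_normal q; exists s => z zz.
have : root q (z : R[i]) by rewrite rootE hornerD hornerN hornerX iterate_polyE zz subrr.
by rewrite qs rootZ ?lead_coef_eq0// root_prod_XsubC.
Qed.

End Periodic.

Section Multiplier.
Variables (R : realType) (c : Cplx R).
Local Notation C := (Cplx R).
Local Notation f := (quadratic c).

(** [derive1] is a limit with default value 0, so a non-zero value certifies differentiability; the
    value is then compared with the expansion of f. *)
Lemma multiplier (alpha : C) : derive1 f alpha != 0 -> derive1 f alpha = 2%:R * alpha.
Proof.
move=> d0; have df : derivable f alpha 1.
  by move: d0; rewrite derive1E /derive => /cvgNpoint.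
have := derivable_is_cdiff df; set d := derive1 f alpha => hd.
apply/eqP; rewrite eq_sym -subr_eq0 -nm_eq0 eq_le nm_ge0 andbT.
apply/ler_addgt0Pr => e e0; rewrite add0r.
have e2 : 0 < e / 2 by rewrite divr_gt0.
have [r r0 hr] := hd _ e2.
pose h := Num.min r e / 2.
have m0 : 0 < Num.min r e by rewrite lt_min r0.
have [mr me] : Num.min r e <= r /\ Num.min r e <= e by rewrite !ge_min !lexx orbT.
have h0 : 0 < h by rewrite divr_gt0.
have nh : nm (h%:C : C) = h by rewrite nmR gtr0_norm.
have := hr (alpha + h%:C); rewrite [_ - alpha]addrC addKr nh.
have -> : f (alpha + h%:C) - f alpha - d * h%:C = (h%:C + (2%:R * alpha - d)) * h%:C.
  by rewrite /quadratic; ring.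
rewrite nmM nh ler_pM2r// => /(_ ltac:(rewrite /h; lra)) le1.
have := nmD (h%:C + (2%:R * alpha - d)) (- h%:C).
rewrite [_ - h%:C]addrC addKr nmN nh => le2.
by rewrite /h in le1 le2 *; lra.
Qed.

End Multiplier.

Section Borel.
Variable R : realType.
Local Notation C := (Cplx R).

Lemma borelC_open (A : set C) : open A -> measurable (A : set (borelC R)).
Proof. by move=> oA; exact: sub_sigma_algebra. Qed.

Lemma borelC_set1 (z : C) : measurable ([set z] : set (borelC R)).
Proof.
rewrite -[X in measurable X]setCK; apply: measurableC; apply: borelC_open.
apply/openCP => w /eqP wz; exists (nm (w - z)); first by rewrite nm_gt0 subr_eq0.
by move=> y yw /= yz; move: yw; rewrite yz nmB ltxx.
Qed.

Lemma ccont_measurable (f : C -> C) : (forall z, ccont f z) ->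
  measurable_fun setT (f : borelC R -> borelC R).
Proof.
move=> fc; apply: (@measurability _ _ (borelC R) (borelC R) setT f (@open C)) => // _ [A oA <-].
rewrite setTI; apply: borelC_open; apply/openCP => z Afz.
have [r r0 hr] := (openCP A).1 oA _ Afz; have [s s0 hs] := fc z r r0.
by exists s => // y yz; apply: hr; exact: hs.
Qed.

End Borel.

Lemma mass_iter_preim (d : measure_display) (T : measurableType d) (R : realType)
    (g : T -> T) (mu : probability T R) (A : set T) n : measurable_fun setT g ->
  invariant_measure mu g -> measurable A ->
  measurable (iter n g @^-1` A) /\ mu (iter n g @^-1` A) = mu A.
Proof.
move=> mg inv mA; elim: n => [//|n [IH1 IH2]].
have -> : iter n.+1 g @^-1` A = g @^-1` (iter n g @^-1` A).
  by apply/seteqP; split=> x; rewrite /preimage /= -iterSr.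
by split; [exact: measurable_preim|rewrite inv].
Qed.

Theorem mainTheorem2 (R : realType) (c : Cplx R) (phi : Cplx R -> Cplx R)
    (mu : probability (borelC R) R) :
  siegel c \/ cremer c ->
  exterior_map (filled_julia (quadratic c)) phi ->
  brolin_measure (quadratic c) mu ->
  mu.-negligible (biaccessible (quadratic c) phi).
Proof.
move=> sc ext [maxi muh _].
have [alpha [falpha [theta _ dalpha]]] : exists alpha, irrationally_indifferent (quadratic c) alpha.
  by case: sc => -[alpha ia _]; exists alpha.
have alpha1 : nm (2%:R * alpha) = 1.
  have nd : nm (derive1 (quadratic c) alpha) = 1 by rewrite dalpha nm_expi.
  by rewrite -(@multiplier R c)// -nm_eq0 nd oner_eq0.
pose f : borelC R -> borelC R := quadratic c.
have mf : measurable_fun setT f by apply: ccont_measurable => z; exact/cdiff_cont/cdiff_quadratic.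
have null x : mu [set x] = 0%E.
  apply: (maximal_entropy_atomless mf maxi muh _ (@borelC_set1 R)).
  by rewrite ln_gt0// ltr1n.
have nullpre n A : mu.-negligible A -> mu.-negligible (iter n f @^-1` A).
  move=> [B [mB B0 AB]]; have [m1 m2] := mass_iter_preim n mf maxi.1 mB.
  by exists (iter n f @^-1` B); split => //; [rewrite m2|move=> x /AB].
have null1 x : mu.-negligible [set x].
  by exists [set x]; split => //; exact: borelC_set1.
have nullseq (s : seq (borelC R)) : mu.-negligible [set` s].
  elim: s => [|x s IH]; first by rewrite set_nil; exact: negligible_set0.
  have := negligibleU (null1 x) IH; apply: negligibleS => z /=.
  by rewrite inE => /predU1P[->|]; [left|right].
pose B1 := \bigcup_k (iter k f @^-1` [set (0 : Cplx R)]).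
(* Preperiodic points: m + 1 is a period, kept positive by the shift, and i the time after which the
   orbit is periodic. *)
pose B2 := \bigcup_m \bigcup_i (iter i f @^-1` [set z | iter m.+1 f z = z]).
apply: (@negligibleS _ _ _ _ (B1 `|` B2)); last first.
  apply: negligibleU.
    by apply: negligible_bigcup => k; exact: nullpre.
  apply: negligible_bigcup => m; apply: negligible_bigcup => i; apply: nullpre.
  have [s hs] := finite_periodic c m.
  by apply: negligibleS (nullseq s) => z /hs.
move=> p [[Kp _] [s [t [st ls lt]]]].
have {}Kp : filled_julia (quadratic c) p.
  by rewrite ((closure_id _).1 (@filled_julia_closed R c)).
have landsE u : lands_at (filled_julia (quadratic c)) phi u p -> lands c phi u p.
  move=> lu; split=> // e e0.
  have : \forall r \near 1^'+, nm (ray c phi u r - p) < e.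
    have /cvgrPdist_lt/(_ e%:C) := lu; rewrite ltcR => /(_ e0).
    apply: filterS => r; rewrite normE nmB ltcR.
    exact.
  move=> [d /= d0 hd]; exists d => // r r1 r2; apply: hd => //=.
  by rewrite ltr_norml; apply/andP; split; lra.
have st' (k : int) : t <> s + k%:~R.
  move=> E; apply: st; rewrite E; congr (_ @` (_ @` _)).
  by apply/funext => r; rewrite /radial expi_int.
have := biaccessible_orbit ext falpha alpha1 (landsE _ ls) (landsE _ lt) st'.
apply: contra_notP => /not_orP[nB1 nB2]; split=> [k|].
  by apply/eqP => k0; apply: nB1; exists k.
have per i j : (i < j)%N -> iter i f p = iter j f p -> False.
  move=> ij E; apply: nB2; exists (j - i).-1 => //; exists i => //=.
  by rewrite -iterS -iterD prednK ?subn_gt0// subnK ?E// ltnW.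
by move=> i j E; case: (ltngtP i j) => // /per; [|move/esym in E]; exact.
Qed.
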